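(* Let $(M,I,\omega,\Omega)$ be a nearly Kähler 6-manifold, let $N,\bar N$ be the $(2,-1)$- and $(-1,2)$-parts of the de Rham differential, $N^*,\bar N^*$ their Hermitian adjoint operators, and $\Lambda_\omega$ the Hermitian adjoint to $L_\omega(\eta):=\omega\wedge\eta$. Then $$[L_\omega,N^*]=2\sqrt{-1}\,\bar N,\qquad [L_\omega,\bar N^*]=-2\sqrt{-1}\,N,$$ $$[\Lambda_\omega,N]=2\sqrt{-1}\,\bar N^*,\qquad [\Lambda_\omega,\bar N]=-2\sqrt{-1}\,N^*.$$
   Context: A nearly Kähler 6-manifold $(M,I,\omega,\Omega)$ is a real 6-dimensional manifold with an almost complex structure $I$ (not assumed integrable), an $I$-Hermitian Riemannian metric $g$ with Hermitian form $\omega(X,Y)=g(IX,Y)$, and a $(3,0)$-form $\Omega$ (an $SU(3)$-structure: locally there are $(1,0)$-forms $\theta_1,\theta_2,\theta_3$ with $\omega=\frac{\sqrt{-1}}{2}\sum_j\theta_j\wedge\bar\theta_j$ and $\Omega=\theta_1\wedge\theta_2\wedge\theta_3$), satisfying $d\omega=3\lambda\,\mathrm{Re}\,\Omega$ and $d\,\mathrm{Im}\,\Omega=-2\lambda\,\omega^2$ for a non-zero real constant $\lambda$. Here $(1,0)$-forms $\alpha$ are those with $\alpha(IX)=\sqrt{-1}\,\alpha(X)$. Forms are complex-valued. The de Rham differential decomposes as $d=d^{2,-1}+d^{1,0}+d^{0,1}+d^{-1,2}$ with $d^{i,j}:\Lambda^{p,q}(M)\to\Lambda^{p+i,q+j}(M)$;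 $N:=d^{2,-1}$, $\bar N:=d^{-1,2}$ (these are $C^\infty(M)$-linear). Hermitian adjoints are with respect to the Hermitian inner product on forms induced by $g$. $[A,B]=AB-BA$. *)

(* Defs.v *)
From HB Require Import structures.
From mathcomp Require Import all_boot all_order all_algebra.
From mathcomp Require Import complex.
From mathcomp Require Import all_classical all_reals all_analysis.
Import numFieldNormedType.Exports.

Set Implicit Arguments.
Unset Strict Implicit.
Unset Printing Implicit Defensive.
Import Order.TTheory GRing.Theory Num.Theory.
Local Open Scope classical_set_scope.
Local Open Scope ring_scope.
Local Open Scope complex_scope.

(* The complexified exterior algebra of (R^n)^*.
    An element is given by its coefficients on the basis
    dx_S = dx_(s_1) /\ ... /\ dx_(s_k), where S = {s_1 < ... < s_k}. *)
Definition ext (R : realType) (n : nat) := {ffun {set 'I_n} -> R[i]^o}.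

Section ExteriorAlgebra.
Context {R : realType} {n : nat}.
Implicit Types (a b : ext R n) (S T A B : {set 'I_n}).

Definition ext1 : ext R n := [ffun S => (S == finset.set0)%:R].

Definition dx (i : 'I_n) : ext R n := [ffun S => (S == [set i]%SET)%:R].

(* dx_A /\ dx_B = (-1)^(inversions A B) dx_(A :|: B) for disjoint A and B. *)
Definition inversions A B : nat :=
  #|[set u : 'I_n * 'I_n | [&& u.1 \in A, u.2 \in B & (u.2 < u.1)%N]]%SET|.

Definition wedge a b : ext R n :=
  [ffun S => \sum_(A in powerset S)
     (-1) ^+ inversions A (S :\: A) * a A * b (S :\: A)].

(* f s_1 /\ ... /\ f s_k for S = {s_1 < ... < s_k}. *)
Definition wedge_set (f : 'I_n -> ext R n) S : ext R n :=
  \big[wedge/ext1]_(s <- enum S) f s.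

Definition conj_ext a : ext R n := [ffun S => (a S)^*].
Definition re_ext a : ext R n := [ffun S => (complex.Re (a S))%:C].
Definition im_ext a : ext R n := [ffun S => (complex.Im (a S))%:C].

(* Vectors are rows and linear maps act by X |-> X *m J, as in jacobian;
   the pull-back of dx_t by J is therefore \sum_i J i t dx_i. *)
Definition pullback (J : 'M[R]_n) a : ext R n :=
  \sum_T a T *: wedge_set (fun t => \sum_i (J i t)%:C *: dx i) T.

Definition is_covector a := forall S, #|S| != 1%N -> a S = 0.

(* The covector X |-> a (I X), for a covector a. *)
Definition comp_acs (I : 'M[R]_n) a : ext R n :=
  \sum_i (\sum_j (I i j)%:C * a [set j]%SET) *: dx i.

Definition is_type10 (I : 'M[R]_n) a :=
  is_covector a /\ comp_acs I a = 'i *: a.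

(* The components of a covector in the decomposition of the covectors into
   Lambda^{1,0} (+) Lambda^{0,1}, when I *m I = - 1%:M. *)
Definition part10 (I : 'M[R]_n) a : ext R n :=
  2^-1 *: (a - 'i *: comp_acs I a).
Definition part01 (I : 'M[R]_n) a : ext R n :=
  2^-1 *: (a + 'i *: comp_acs I a).

(* The projection onto Lambda^{p,q} along the other Lambda^{p',q'}: replace
   each dx_s by part10 dx_s + part01 dx_s in dx_S, expand, and keep the
   products with p factors of type (1,0) and q factors of type (0,1). *)
Definition type_proj (I : 'M[R]_n) (p q : nat) a : ext R n :=
  \sum_(S : {set 'I_n} | #|S| == (p + q)%N) a S *:
    \sum_(A in powerset S | #|A| == p)
      wedge_set
        (fun s => if s \in A then part10 I (dx s) else part01 I (dx s)) S.

(* For #|S| = #|T|, the product of dx_S and dx_T is the determinant of the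
   <dx_s, dx_t>; the default value of nth is never used. *)
Definition gram (g : 'M[R]_n) S T : R :=
  \det (\matrix_(k < #|S|, l < #|S|)
          invmx g (enum_val k) (nth (enum_val k) (enum T) l)).

(* The Hermitian product induced by g, for which the exterior products of the
   elements of a g-orthonormal coframe are orthonormal. *)
Definition hprod (g : 'M[R]_n) a b : R[i] :=
  \sum_(S : {set 'I_n}) \sum_(T : {set 'I_n} | #|T| == #|S|)
    a S * (b T)^* * (gram g S T)%:C.

(* The 2-form X, Y |-> g (I X, Y). *)
Definition fundamental_form (I g : 'M[R]_n) : ext R n :=
  \sum_(i < n) \sum_(j < n | (i < j)%N)
    ((I *m g) i j)%:C *: wedge (dx i) (dx j).

End ExteriorAlgebra.

Section Smoothness.
Context {R : realType} {n : nat}.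
Implicit Types (V : set 'rV[R]_n) (f : 'rV[R]_n -> R).

Fixpoint Ck (k : nat) V f : Prop :=
  (forall x, V x -> {for x, continuous f}) /\
  if k is k'.+1 then
    forall i : 'I_n,
      (forall x, V x -> derivable f x (delta_mx 0 i)) /\
      Ck k' V (fun x => 'D_(delta_mx 0 i) f x)
  else True.

(* Meant for open V. *)
Definition smooth_on V f := forall k, Ck k V f.

(* The complex-valued case is reduced to real and imaginary parts. *)
Definition partial (i : 'I_n) (u : 'rV[R]_n -> ext R n) (y : 'rV[R]_n) :
    ext R n :=
  [ffun S => ('D_(delta_mx 0 i) (fun z => complex.Re (u z S)) y
              +i* 'D_(delta_mx 0 i) (fun z => complex.Im (u z S)) y)].

End Smoothness.

Record smooth_manifold (R : realType) (n : nat) (M : topologicalType) :=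
  SmoothManifold {
  chart : Type;
  dom : chart -> set M;
  chart_map : chart -> M -> 'rV[R]_n;
  chart_inv : chart -> 'rV[R]_n -> M;
  manifold_hausdorff : hausdorff_space M;
  manifold_second_countable : @second_countable M;
  dom_open : forall c, open (dom c);
  dom_cover : forall p, exists c, dom c p;
  image_open : forall c, open (chart_map c @` dom c);
  chart_mapK : forall c p, dom c p -> chart_inv c (chart_map c p) = p;
  chart_map_continuous : forall c p, dom c p -> {for p, continuous (chart_map c)};
  chart_inv_continuous : forall c y, (chart_map c @` dom c) y ->
    {for y, continuous (chart_inv c)};
  transition_smooth : forall c c' (j : 'I_n),
    smooth_on (chart_map c @` (dom c `&` dom c'))
              (fun y => chart_map c' (chart_inv c y) 0 j)
}.

Section Forms.
Context {R : realType} {n : nat} {M : topologicalType}.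
Variable A : smooth_manifold R n M.

Definition transition (c c' : chart A) (y : 'rV[R]_n) : 'rV[R]_n :=
  chart_map c' (chart_inv c y).

Definition transition_jac (c c' : chart A) (p : M) : 'M[R]_n :=
  jacobian (transition c c') (chart_map c p).

(* A differential form (of mixed degree, complex-valued) is the family of its
   expressions in all charts.  The values of [eta c] outside of the image of
   the chart c are irrelevant. *)
Definition preform := chart A -> 'rV[R]_n -> ext R n.

Definition is_form (U : set M) (eta : preform) : Prop :=
  (forall c S,
     smooth_on (chart_map c @` (U `&` dom c)) (fun y => complex.Re (eta c y S)) /\
     smooth_on (chart_map c @` (U `&` dom c)) (fun y => complex.Im (eta c y S))) /\
  (forall c c' p, U p -> dom c p -> dom c' p ->
     eta c (chart_map c p) =
     pullback (transition_jac c c' p) (eta c' (chart_map c' p))).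

Definition eq_form (U : set M) (eta xi : preform) : Prop :=
  forall c p, U p -> dom c p -> eta c (chart_map c p) = xi c (chart_map c p).

Definition exterior_d (eta : preform) : preform :=
  fun c y => \sum_i wedge (dx i) (partial i (eta c) y).

(* The components of a tensor field of type (1,1) or (0,2) in all charts. *)
Definition matrix_field := chart A -> 'rV[R]_n -> 'M[R]_n.

Definition smooth_matrix_field (F : matrix_field) : Prop :=
  forall c i j, smooth_on (chart_map c @` dom c) (fun y => F c y i j).

Definition almost_complex_structure (I : matrix_field) : Prop :=
  [/\ smooth_matrix_field I,
      forall c c' p, dom c p -> dom c' p ->
        I c (chart_map c p) *m transition_jac c c' p =
        transition_jac c c' p *m I c' (chart_map c' p)
    & forall c p, dom c p ->
        I c (chart_map c p) *m I c (chart_map c p) = - 1%:M].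

Definition riemannian_metric (g : matrix_field) : Prop :=
  [/\ smooth_matrix_field g,
      forall c c' p, dom c p -> dom c' p ->
        g c (chart_map c p) =
        transition_jac c c' p *m g c' (chart_map c' p) *m (transition_jac c c' p)^T,
      forall c p, dom c p -> (g c (chart_map c p))^T = g c (chart_map c p)
    & forall c p (X : 'rV[R]_n), dom c p -> X != 0 ->
        0 < (X *m g c (chart_map c p) *m X^T) 0 0].

Definition hermitian_metric (I g : matrix_field) : Prop :=
  riemannian_metric g /\
  forall c p, dom c p ->
    I c (chart_map c p) *m g c (chart_map c p) *m (I c (chart_map c p))^T =
    g c (chart_map c p).

Definition hermitian_form (I g : matrix_field) : preform :=
  fun c y => fundamental_form (I c y) (g c y).

Definition operator := preform -> preform.

(* Equality on the forms on M and, more generally, on all open subsets. *)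
Definition eq_operator (F G : operator) : Prop :=
  forall U eta, open U -> is_form U eta -> eq_form U (F eta) (G eta).

Definition commutator (F G : operator) : operator :=
  fun eta c y => F (G eta) c y - G (F eta) c y.

Definition scale_operator (k : R[i]) (F : operator) : operator :=
  fun eta c y => k *: F eta c y.

(* The component d^{i,j} of the de Rham differential, which maps
   Lambda^{p,q} to Lambda^{p+i,q+j}. *)
Definition d_part (I : matrix_field) (i j : int) : operator :=
  fun eta c y =>
    \sum_(p < n.+1) \sum_(q < n.+1)
      \sum_(p' < n.+1 | p'%:Z == p%:Z + i) \sum_(q' < n.+1 | q'%:Z == q%:Z + j)
        type_proj (I c y) p' q'
          (exterior_d (fun c' z => type_proj (I c' z) p q (eta c' z)) c y).

Definition lefschetz (omega : preform) : operator :=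
  fun eta c y => wedge (omega c y) (eta c y).

(* G is the Hermitian adjoint of F, for operators that are linear over smooth
   functions: the equality holds pointwise, for forms on all open subsets. *)
Definition hermitian_adjoint (g : matrix_field) (F G : operator) : Prop :=
  forall U alpha beta, open U -> is_form U alpha -> is_form U beta ->
  forall c p, U p -> dom c p ->
    hprod (g c (chart_map c p)) (F alpha c (chart_map c p)) (beta c (chart_map c p)) =
    hprod (g c (chart_map c p)) (alpha c (chart_map c p)) (G beta c (chart_map c p)).

End Forms.

Section NearlyKahler.
Context {R : realType} {M : topologicalType}.
Variable A : smooth_manifold R 6 M.

(* Near every point there is a coframe theta of (1,0)-forms such that
   omega = i/2 \sum_j theta_j /\ conj theta_j  and
   Omega = theta_1 /\ theta_2 /\ theta_3. *)
Definition su3_structure (I g : matrix_field A) (Omega : preform A) : Prop :=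
  [/\ almost_complex_structure I, hermitian_metric I g, is_form setT Omega
    & forall p, exists (U : set M) (theta1 theta2 theta3 : preform A),
      [/\ open U, U p,
          [/\ is_form U theta1, is_form U theta2 & is_form U theta3]
        & forall c q, U q -> dom c q ->
          let y := chart_map c q in
          [/\ [/\ is_type10 (I c y) (theta1 c y),
                  is_type10 (I c y) (theta2 c y)
                & is_type10 (I c y) (theta3 c y)],
              hermitian_form I g c y =
              ('i / 2) *: (wedge (theta1 c y) (conj_ext (theta1 c y)) +
                           wedge (theta2 c y) (conj_ext (theta2 c y)) +
                           wedge (theta3 c y) (conj_ext (theta3 c y)))
            & Omega c y =
              wedge (wedge (theta1 c y) (theta2 c y)) (theta3 c y)]]].

Record nearly_kahler := NearlyKahler {
  acs : matrix_field A;
  metric : matrix_field A;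
  nk_Omega : preform A;
  nk_lambda : R;
  nk_su3 : su3_structure acs metric nk_Omega;
  nk_lambda_neq0 : nk_lambda != 0;
  nk_d_omega :
    eq_form setT (exterior_d (hermitian_form acs metric))
      (fun c y => (3 * nk_lambda)%:C *: re_ext (nk_Omega c y));
  nk_d_im_Omega :
    eq_form setT (exterior_d (fun c y => im_ext (nk_Omega c y)))
      (fun c y => (- 2 * nk_lambda)%:C *:
         wedge (hermitian_form acs metric c y) (hermitian_form acs metric c y))
}.

Definition nk_omega (X : nearly_kahler) : preform A :=
  hermitian_form (acs X) (metric X).

Definition nk_N (X : nearly_kahler) : operator A := d_part (acs X) 2 (-1).
Definition nk_Nbar (X : nearly_kahler) : operator A := d_part (acs X) (-1) 2.
Definition nk_L (X : nearly_kahler) : operator A := lefschetz (nk_omega X).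

Definition nk_adjoint (X : nearly_kahler) (F G : operator A) : Prop :=
  hermitian_adjoint (metric X) F G.

End NearlyKahler.

(* Main.v *)
From HB Require Import structures.
From mathcomp Require Import all_boot all_order all_algebra.
From mathcomp Require Import complex.
From mathcomp Require Import all_classical all_reals all_analysis.
From mathcomp Require Import ring zify.
Require Import Defs.
Import numFieldNormedType.Exports.

(** All operators involved are linear over functions, so the identities can be checked at
    one point, in a local coframe [th 0], [th 1], [th 2] of (1,0)-forms with conjugates
    [tb k], in which omega is [i/2] times the sum of the [th k /\ tb k] and Omega is
    [th 0 /\ th 1 /\ th 2]. Indices are taken modulo 3.

    The operator N is the derivation that kills the [th k] and maps [tb k] to the (2,0)-part
    of [d (tb k)] ([N_is_derivP], [sum_N]). These three (2,0)-forms are determined by the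
    value of the derivation at conj Omega, from which they are recovered by contraction
    ([deriv20_vol3_inj]). Since d omega is a nonzero multiple of Re Omega, the form Re Omega
    is closed, hence the differential of conj Omega is [-i] times that of Im Omega, that is
    [2 i lambda] times the square of omega. This has type (2,2), so it equals N (conj Omega),
    and the comparison gives ([d_tb20E])
<<
      (d (tb k))^{2,0} = i lambda th (k + 1) /\ th (k + 2).
>>
    So N is [i lambda / 2] times the sum of the operators
    [th (k + 1) /\ th (k + 2) /\ iota (b k)], where the metric duals [a k], [b k] of [th k],
    [tb k] are twice the basis dual to the coframe ([unitary_frame_of_metric]); the conjugate
    operator is obtained by conjugation.

    The adjoint of multiplication by a covector is contraction with its metric dual; this is
    the Laplace expansion of Gram determinants ([hprod_wedge]). The adjoint of N is therefore
    [- i lambda / 2] times the sum of the [tb k /\ iota (a (k + 2)) iota (a (k + 1))].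
    Multiplication by omega commutes with the [tb k], and its commutator with [iota (a k)] is
    [-i] times multiplication by [tb k] ([wedge_omega_contract]); applying this to the two
    contractions gives the first identity ([omega_lower_pair]). Exchanging [th] and [tb]
    changes the sign of omega and gives the second one, and the last two are the adjoints of
    the first two ([commutator_adjoint]).

    Finally, operators that are adjoint on forms over open sets are adjoint at each point:
    local forms take all values at a given point, and the Hermitian product is nondegenerate
    ([adjoint_pointwise]). *)

Set Implicit Arguments.
Unset Strict Implicit.
Unset Printing Implicit Defensive.
Import Order.TTheory GRing.Theory Num.Theory.
Local Open Scope ring_scope.
Local Open Scope complex_scope.

(** * The exterior algebra: wedge products and contractions *)
Section Inversions.
Context {n : nat}.
Implicit Types (A B S T : {set 'I_n}) (i j : 'I_n).

Lemma inversionsE A B :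
  inversions A B = (\sum_(u in A) \sum_(v in B) (v < u)%N)%N.
Proof.
rewrite /inversions -sum1_card pair_big /=.
rewrite big_mkcond [RHS]big_mkcond; apply: eq_bigr => -[u v] _ /=.
by rewrite inE /=; case: (u \in A); case: (v \in B); case: ltnP.
Qed.

Lemma inversionsUl A A' B : [disjoint A & A'] ->
  inversions (A :|: A') B = (inversions A B + inversions A' B)%N.
Proof.
move=> dAA'; rewrite !inversionsE -bigU //=.
by apply: eq_bigl => i; rewrite inE.
Qed.

Lemma inversionsUr A B B' : [disjoint B & B'] ->
  inversions A (B :|: B') = (inversions A B + inversions A B')%N.
Proof.
move=> dBB'; rewrite !inversionsE -big_split /=; apply: eq_bigr => i _.
rewrite -bigU //=.
by apply: eq_bigl => j; rewrite inE.
Qed.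

Lemma inversions11 i j : inversions [set i] [set j] = (j < i)%N.
Proof. by rewrite inversionsE !big_set1. Qed.

Lemma inversions0l B : inversions finset.set0 B = 0%N.
Proof. by rewrite inversionsE big_set0. Qed.

End Inversions.

Section Exterior.
Context {R : realType} {n : nat}.
Local Notation C := R[i].
Local Notation E := (ext R n).
Implicit Types (a b c : E) (S T A B : {set 'I_n}) (i j : 'I_n).

(** The sign of moving [dx i] past the factors of [dx_S] with smaller index. *)
Definition move_sign i S : C := (-1) ^+ inversions [set i] S.

Lemma move_sign_sqr i S : move_sign i S * move_sign i S = 1.
Proof. by rewrite -expr2 sqrr_sign. Qed.

Lemma move_sign_setU1 i j S : j \notin S -> move_sign i (j |: S) = move_sign i [set j] * move_sign
  i S.
Proof. by move=> jS; rewrite /move_sign inversionsUr ?disjoints1 // exprD. Qed.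

Lemma move_sign_swap i j : i != j -> move_sign i [set j] = - move_sign j [set i].
Proof.
move=> ij; rewrite /move_sign !inversions11.
have : val i != val j by [].
by case: ltngtP => //= _ _; rewrite ?expr1 ?opprK.
Qed.

Lemma dxE i S : dx i S = (S == [set i])%:R :> C.
Proof. by rewrite ffunE. Qed.

Lemma wedgeE a b S : wedge a b S = \sum_(A in powerset S)
     (-1) ^+ inversions A (S :\: A) * a A * b (S :\: A) :> C.
Proof. by rewrite ffunE. Qed.

Lemma wedge_dxE i a S :
  wedge (dx i) a S = if i \in S then move_sign i (S :\ i) * a (S :\ i) else 0.
Proof.
rewrite wedgeE; case: ifP => iS.
  have iP : [set i] \in powerset S by rewrite powersetE finset.sub1set.
  rewrite (bigD1 [set i] iP) /= dxE eqxx mulr1 big1 ?addr0//.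
  by move=> A /andP[_ /negbTE Ai]; rewrite dxE Ai mulr0 mul0r.
rewrite big1// => A; rewrite powersetE dxE => AS.
case: eqP => [Ai|]; last by rewrite mulr0 mul0r.
by move: AS; rewrite Ai finset.sub1set iS.
Qed.

Definition contract_coord i a : E :=
  [ffun S : {set 'I_n} => if i \in S then 0 else move_sign i S * a (i |: S)].

Lemma contract_coordE i a S : contract_coord i a S = if i \in S then 0 else move_sign i S * a
  (i |: S).
Proof. by rewrite ffunE. Qed.

Lemma move_sign_anti i j S : i != j -> i \notin S -> j \notin S ->
  move_sign i (j |: S) * move_sign j S = - (move_sign j (i |: S) * move_sign i S).
Proof.
move=> ij iS jS; rewrite !move_sign_setU1 // (move_sign_swap ij) !mulNr; congr (- _).
by rewrite mulrAC -!mulrA; congr (_ * _); rewrite mulrC.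
Qed.

Lemma wedge_dx_anti i j a :
  wedge (dx i) (wedge (dx j) a) = - wedge (dx j) (wedge (dx i) a).
Proof.
apply/ffunP => S; rewrite [RHS]ffunE !wedge_dxE !finset.in_setD1.
have [->|ij] := eqVneq i j.
  by case: (j \in S); rewrite ?mulr0 oppr0.
have [iS|iS] := boolP (i \in S); have [jS|jS] := boolP (j \in S);
  rewrite ?andbF ?andbT ?mulr0 ?oppr0 //=.
have -> : S :\ i :\ j = S :\ j :\ i.
  by apply/setP => k; rewrite !inE andbCA.
set T := S :\ j :\ i.
have Ei : S :\ i = j |: T.
  apply/setP => k; rewrite !inE; have [->|kj] //= := eqVneq k j.
  by rewrite jS eq_sym ij.
have Ej : S :\ j = i |: T.
  apply/setP => k; rewrite !inE; have [->|ki] //= := eqVneq k i.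
  by rewrite iS ij.
rewrite Ei Ej !mulrA move_sign_anti ?mulNr // !inE ?eqxx //=; by rewrite andbF.
Qed.

Lemma wedge_dx_sqr i a : wedge (dx i) (wedge (dx i) a) = 0.
Proof.
apply/ffunP => S; rewrite [RHS]ffunE !wedge_dxE !finset.in_setD1 eqxx /=.
by rewrite mulr0 if_same.
Qed.

(** The canonical anticommutation relation between annihilation and creation
    operators, on which all later computations rest. *)
Lemma contract_coord_wedge_dx i j a :
  contract_coord i (wedge (dx j) a) = (i == j)%:R *: a - wedge (dx j) (contract_coord i a).
Proof.
apply/ffunP => S; rewrite contract_coordE !wedge_dxE 3!ffunE wedge_dxE contract_coordE !inE.
have [->|ij] := eqVneq i j.
  rewrite /=; case: ifP => jS.
    by rewrite mulrA move_sign_sqr finset.setD1K // !mul1r scale1r subrr.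
  by rewrite finset.setU1K ?jS // mulrA move_sign_sqr mul1r scale1r subr0.
rewrite /= scale0r add0r.
have [iS|iS] := boolP (i \in S); have [jS|jS] := boolP (j \in S);
  rewrite ?andbF ?andbT ?mulr0 ?oppr0 //= ?mulr0 ?oppr0 //.
set T := S :\ j.
have iT : i \notin T by rewrite !inE negb_and iS orbT.
have jT : j \notin T by rewrite !inE eqxx.
have -> : (i |: S) :\ j = i |: T.
  by apply/setP => k; rewrite !inE; case: eqVneq => // ->; rewrite eq_sym (negbTE ij).
have -> : S = j |: T by rewrite finset.setD1K.
rewrite !mulrA -mulNr; congr (_ * _); rewrite !move_sign_setU1 // (move_sign_swap ij) mulNr.
by rewrite mulNr mulrACA move_sign_sqr mul1r mulrC.
Qed.

Lemma contract_coord_anti i j a : contract_coord i (contract_coord j a) = - contract_coord j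
  (contract_coord i a).
Proof.
apply/ffunP => S; rewrite [RHS]ffunE !contract_coordE !inE.
have [->|ij] := eqVneq i j.
  by case: (j \in S); rewrite ?mulr0 oppr0.
rewrite /=.
have [iS|iS] := boolP (i \in S); have [jS|jS] := boolP (j \in S);
  rewrite ?mulr0 ?oppr0 //=.
rewrite finset.setUCA !mulrA -mulNr; congr (_ * _).
by rewrite [LHS]mulrC [in RHS]mulrC move_sign_anti // eq_sym.
Qed.

End Exterior.

HB.lock Definition contract {R : realType} {n : nat} (v : 'rV[R[i]]_n) (a : ext R n) : ext R n :=
  \sum_i v 0 i *: contract_coord i a.

Section Multilinear.
Context {R : realType} {n : nat}.
Local Notation C := R[i].
Local Notation E := (ext R n).
Implicit Types (a b c : E) (S T A B : {set 'I_n}) (i j : 'I_n).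

Lemma wedge_is_linear a : linear (wedge a : E -> E).
Proof.
move=> k b c; apply/ffunP => S; rewrite [RHS]ffunE [X in _ = X + _]ffunE !wedgeE.
rewrite scaler_sumr -big_split /=; apply: eq_bigr => A _.
by rewrite !ffunE mulrDr /GRing.scale /= mulrCA.
Qed.
HB.instance Definition _ a := GRing.isLinear.Build C E E _ (wedge a) (wedge_is_linear a).

Lemma wedgeDr a b c : wedge a (b + c) = wedge a b + wedge a c.
Proof. exact: linearD. Qed.
Lemma wedgeZr k a b : wedge a (k *: b) = k *: wedge a b.
Proof. exact: linearZ. Qed.
Lemma wedgeNr a b : wedge a (- b) = - wedge a b.
Proof. exact: linearN. Qed.
Lemma wedge0r a : wedge a 0 = 0.
Proof. exact: linear0. Qed.
Lemma wedge_sumr (J : Type) (r : seq J) (P : pred J) (F : J -> E) a :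
  wedge a (\sum_(j <- r | P j) F j) = \sum_(j <- r | P j) wedge a (F j).
Proof. exact: linear_sum. Qed.

Lemma wedgeDl a b c : wedge (a + b) c = wedge a c + wedge b c.
Proof.
apply/ffunP => S; rewrite [RHS]ffunE !wedgeE -big_split /=; apply: eq_bigr => A _.
by rewrite ffunE mulrDr mulrDl.
Qed.

Lemma wedgeZl k a b : wedge (k *: a) b = k *: wedge a b.
Proof.
apply/ffunP => S; rewrite [RHS]ffunE !wedgeE scaler_sumr; apply: eq_bigr => A _.
by rewrite ffunE /GRing.scale /= mulrCA -!mulrA.
Qed.

Lemma wedge_suml (J : Type) (r : seq J) (P : pred J) (F : J -> E) b :
  wedge (\sum_(j <- r | P j) F j) b = \sum_(j <- r | P j) wedge (F j) b.
Proof.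
elim/big_rec2: _ => [|j x y _ <-]; last by rewrite wedgeDl.
by rewrite -[X in wedge X](scale0r (0 : E)) wedgeZl scale0r.
Qed.

Lemma wedgeNl a b : wedge (- a) b = - wedge a b.
Proof. by rewrite -scaleN1r wedgeZl scaleN1r. Qed.

Lemma wedge0l b : wedge 0 b = 0.
Proof. by rewrite -[X in wedge X](scale0r (0 : E)) wedgeZl scale0r. Qed.

Lemma contract_coord_is_linear i : linear (contract_coord i : E -> E).
Proof.
move=> k b c; apply/ffunP => S; rewrite [RHS]ffunE [X in _ = X + _]ffunE !contract_coordE.
case: ifP => _; first by rewrite scaler0 addr0.
by rewrite !ffunE mulrDr /GRing.scale /= mulrCA.
Qed.
HB.instance Definition _ i := GRing.isLinear.Build C E E _ (contract_coord i)
  (contract_coord_is_linear i).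

Definition monomial S : E := [ffun T : {set 'I_n} => (T == S)%:R].

Lemma monomialE S T : monomial S T = (T == S)%:R :> C.
Proof. by rewrite ffunE. Qed.

Lemma ext_monomial a : a = \sum_S a S *: monomial S.
Proof.
apply/ffunP => T; rewrite sum_ffunE (bigD1 T) //= big1 ?addr0; last first.
  by move=> S /negbTE ST; rewrite ffunE monomialE eq_sym ST scaler0.
by rewrite ffunE monomialE eqxx /GRing.scale /= mulr1.
Qed.

Lemma wedge_dx_monomial i S :
  wedge (dx i) (monomial S) = if i \in S then 0 else move_sign i S *: monomial (i |: S).
Proof.
apply/ffunP => T; rewrite wedge_dxE monomialE.
have [iS|iS] := boolP (i \in S).
  rewrite [RHS]ffunE; case: ifP => // iT.
  by case: eqP => [Ti|]; rewrite ?mulr0 //; move: iS; rewrite -Ti !inE eqxx.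
rewrite ffunE monomialE; have [iT|iT] := boolP (i \in T); last first.
  by case: eqP iT => [->|_]; rewrite ?scaler0 // !inE eqxx.
have -> : (T :\ i == S) = (T == i |: S).
  by apply/eqP/eqP => [<-|->]; rewrite ?finset.setD1K ?finset.setU1K.
case: eqP => [->|_]; last by rewrite mulr0 scaler0.
by rewrite finset.setU1K.
Qed.

Lemma ext_lin_ind (P : E -> Prop) :
  (forall a b, P a -> P b -> P (a + b)) -> (forall k a, P a -> P (k *: a)) ->
  (forall S, P (monomial S)) -> forall a, P a.
Proof.
move=> PD PZ Pb a; rewrite (ext_monomial a); elim/big_ind: _ => [|b c|S _]; auto.
by rewrite -(scale0r (monomial finset.set0)); apply: PZ.
Qed.

Lemma monomial0 : monomial finset.set0 = ext1.
Proof. by []. Qed.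

(** The algebra is generated from [1] by the [dx i], so a linear property that is
    stable under left multiplication by each [dx i] holds everywhere. This replaces
    computations with signs of shuffles. *)
Lemma ext_ind (P : E -> Prop) :
  (forall a b, P a -> P b -> P (a + b)) -> (forall k a, P a -> P (k *: a)) ->
  P ext1 -> (forall i a, P a -> P (wedge (dx i) a)) -> forall a, P a.
Proof.
move=> PD PZ P1 Pw; apply: ext_lin_ind => // S.
have [m] := ubnP #|S|; elim: m S => // m IH S; rewrite ltnS => Sm.
have [->|[i iS]] := set_0Vmem S; first by rewrite monomial0.
have := wedge_dx_monomial i (S :\ i); rewrite !inE eqxx /= finset.setD1K // => H.
have -> : monomial S = move_sign i (S :\ i) *: wedge (dx i) (monomial (S :\ i)).
  by rewrite H scalerA move_sign_sqr scale1r.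
apply/PZ/Pw/IH; apply: leq_trans Sm.
by rewrite [X in (_ < X)%N](cardsD1 i) iS.
Qed.

Lemma wedge1l : left_id (ext1 : E) wedge.
Proof.
move=> a; apply/ffunP => S; rewrite wedgeE.
rewrite (bigD1 finset.set0) /=; last by rewrite powersetE finset.sub0set.
rewrite ffunE eqxx big1 ?addr0 => [|A /andP[_ /negbTE A0]].
  by rewrite inversions0l mulr1 finset.setD0 mul1r.
by rewrite [ext1 A]ffunE A0 mulr0 mul0r.
Qed.

Lemma wedge_dxA i a b : wedge (wedge (dx i) a) b = wedge (dx i) (wedge a b).
Proof.
apply/ffunP => S; rewrite wedge_dxE [LHS]wedgeE.
have [iS|iS] := boolP (i \in S); last first.
  rewrite big1 // => A; rewrite powersetE => AS; rewrite wedge_dxE.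
  by rewrite (contraNF (fintype.subsetP AS i) iS) mulr0 mul0r.
rewrite (bigID (fun A => i \in A)) /= [X in _ + X]big1 ?addr0; last first.
  by move=> A /andP[_ /negbTE iA]; rewrite wedge_dxE iA mulr0 mul0r.
rewrite [wedge a b _]wedgeE mulr_sumr.
rewrite (reindex_onto (fun A => i |: A) (fun A => A :\ i)) /=; last first.
  by move=> A /andP[_ iA]; rewrite finset.setD1K.
apply: eq_big => [A|A].
  rewrite !powersetE finset.subUset finset.sub1set iS /= finset.setU11 andbT.
  rewrite finset.subsetD1; apply: andb_id2l => AS.
  have [iA|iA] := boolP (i \in A); last by rewrite finset.setU1K // eqxx.
  by apply/eqP => e; move: iA; rewrite -e !inE eqxx.
rewrite powersetE => /andP[/andP[AS _] /eqP Ai].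
have iA : i \notin A by rewrite -Ai !inE eqxx.
have {}AS : A \subset S by exact: fintype.subset_trans (finset.subsetUr _ _) AS.
rewrite wedge_dxE finset.setU11 Ai.
have -> : S :\: (i |: A) = (S :\ i) :\: A by rewrite finset.setDDl.
set B := _ :\: A.
have SE : S :\ i = A :|: B.
  apply/setP => j; rewrite !inE; have [jA|//] := boolP (j \in A).
  by rewrite (fintype.subsetP AS) // andbT; apply: contraNneq iA => <-.
have AB : [disjoint A & B] by rewrite -finset.setI_eq0 finset.setIDA finset.setDIl finset.setDv
  finset.set0I.
rewrite /move_sign SE inversionsUl ?disjoints1 // inversionsUr // !exprD !mulrA.
congr (_ * _ * _).
by rewrite mulrC mulrA.
Qed.

Lemma wedgeA : associative (wedge : E -> E -> E).
Proof.
move=> a b c; elim/ext_ind: a => [a a' Ha Ha'|k a Ha||i a Ha].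
- by rewrite !wedgeDl Ha Ha'.
- by rewrite !wedgeZl Ha.
- by rewrite !wedge1l.
- by rewrite !wedge_dxA Ha.
Qed.

Lemma wedge1r : right_id (ext1 : E) wedge.
Proof.
elim/ext_ind => [a b Ha Hb|k a Ha||i a Ha].
- by rewrite wedgeDl Ha Hb.
- by rewrite wedgeZl Ha.
- exact: wedge1l.
- by rewrite wedge_dxA Ha.
Qed.

HB.instance Definition _ := Monoid.isLaw.Build E ext1 wedge wedgeA wedge1l wedge1r.

Lemma contract_def (v : 'rV[C]_n) a : contract v a = \sum_i v 0 i *: contract_coord i a.
Proof. by rewrite contract.unlock. Qed.

Lemma contract_is_linear (v : 'rV[C]_n) : linear (contract v : E -> E).
Proof.
move=> k a b; rewrite !contract_def scaler_sumr -big_split /=; apply: eq_bigr => i _.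
by rewrite linearP scalerDr !scalerA [k * _]mulrC.
Qed.
HB.instance Definition _ (v : 'rV[C]_n) := GRing.isLinear.Build C E E _ (contract v : E -> E)
  (contract_is_linear v).

Lemma contractD v a b : contract v (a + b) = contract v a + contract v b.
Proof. exact: linearD. Qed.
Lemma contractZ v k a : contract v (k *: a) = k *: contract v a.
Proof. exact: linearZ. Qed.
Lemma contractN v a : contract v (- a) = - contract v a.
Proof. exact: linearN. Qed.
Lemma contract0 (v : 'rV[C]_n) : contract v 0 = 0.
Proof. exact: linear0. Qed.
Lemma contract_sum (v : 'rV[C]_n) (J : Type) (r : seq J) (P : pred J) (F : J -> E) :
  contract v (\sum_(j <- r | P j) F j) = \sum_(j <- r | P j) contract v (F j).
Proof. exact: linear_sum. Qed.
Lemma contract_coordZ i k a : contract_coord i (k *: a) = k *: contract_coord i a.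
Proof. exact: linearZ. Qed.

Lemma contract_coord_sum i (J : Type) (r : seq J) (P : pred J) (F : J -> E) :
  contract_coord i (\sum_(j <- r | P j) F j) = \sum_(j <- r | P j) contract_coord i (F j).
Proof. exact: linear_sum. Qed.

Lemma contract_coord1 i : contract_coord i (ext1 : E) = 0.
Proof.
apply/ffunP => S; rewrite contract_coordE [RHS]ffunE; case: ifP => // _.
rewrite [ext1 _]ffunE; case: eqP => [e|]; last by rewrite mulr0.
by have := finset.setU11 i S; rewrite e inE.
Qed.

Lemma contract1 (v : 'rV[C]_n) : contract v ext1 = 0.
Proof. by rewrite !contract_def big1 // => i _; rewrite contract_coord1 scaler0. Qed.

Lemma contractDl u v a : contract (u + v) a = contract u a + contract v a.
Proof. by rewrite !contract_def -big_split; apply: eq_bigr => i _; rewrite mxE scalerDl. Qed.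

Lemma contractZl k v a : contract (k *: v) a = k *: contract v a.
Proof. by rewrite !contract_def scaler_sumr; apply: eq_bigr => i _; rewrite mxE scalerA. Qed.

Lemma contract_anti u v a : contract u (contract v a) = - contract v (contract u a).
Proof.
rewrite !contract_def -sumrN; under eq_bigr do rewrite contract_coord_sum scaler_sumr /=.
rewrite exchange_big /=; apply: eq_bigr => i _.
rewrite contract_coord_sum scaler_sumr -sumrN; apply: eq_bigr => j _.
by rewrite !contract_coordZ contract_coord_anti !scalerN !scalerA mulrC.
Qed.

Lemma is_covector0 : is_covector (0 : E).
Proof. by move=> S _; rewrite ffunE. Qed.
Lemma is_covectorD a b : is_covector a -> is_covector b -> is_covector (a + b).
Proof. by move=> Ha Hb S S1; rewrite ffunE Ha ?Hb // addr0. Qed.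
Lemma is_covectorZ k a : is_covector a -> is_covector (k *: a).
Proof. by move=> Ha S S1; rewrite ffunE Ha // scaler0. Qed.
Lemma is_covector_dx i : is_covector (dx i : E).
Proof.
by move=> S S1; rewrite dxE; case: eqP => // e; move: S1; rewrite e cards1.
Qed.
Lemma is_covector_sum (J : Type) (r : seq J) (P : pred J) (F : J -> E) :
  (forall t, P t -> is_covector (F t)) -> is_covector (\sum_(t <- r | P t) F t).
Proof. by move=> H; elim/big_ind: _ => //; [exact: is_covector0|exact: is_covectorD]. Qed.

Lemma covectorE a : is_covector a -> a = \sum_i a [set i]%SET *: dx i.
Proof.
move=> Ha; apply/ffunP => S; rewrite sum_ffunE.
have [/cards1P[i ->]|S1] := boolP (#|S| == 1%N).
  rewrite (bigD1 i) //= big1 ?addr0 => [|j ji].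
    by rewrite ffunE dxE eqxx /GRing.scale /= mulr1.
  by rewrite ffunE dxE (inj_eq set1_inj) eq_sym (negbTE ji) scaler0.
rewrite Ha // big1 // => i _; rewrite ffunE dxE.
case: eqP => [e|_]; last by rewrite scaler0.
by move: S1; rewrite e cards1.
Qed.

Lemma covector_ind (P : E -> Prop) :
  (forall a b, P a -> P b -> P (a + b)) -> (forall k a, P a -> P (k *: a)) ->
  (forall i, P (dx i)) -> P 0 -> forall a, is_covector a -> P a.
Proof.
move=> PD PZ Pdx P0 a /covectorE ->.
by elim/big_ind: _ => [|b c|i _]; auto.
Qed.

Definition pairing (v : 'rV[C]_n) a : C := \sum_i v 0 i * a [set i]%SET.

(** Both sides are linear in the covector [u]; on the [dx i] this is
    [contract_coord_wedge_dx]. *)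
Lemma contract_wedge v u a : is_covector u ->
  contract v (wedge u a) = pairing v u *: a - wedge u (contract v a).
Proof.
move=> Hu; elim/covector_ind: u / Hu => [x y Hx Hy|k x Hx|i|].
- have -> : pairing v (x + y) = pairing v x + pairing v y.
    by rewrite /pairing -big_split; apply: eq_bigr => i _; rewrite ffunE mulrDr.
  by rewrite wedgeDl contractD Hx Hy wedgeDl opprD addrACA -scalerDl.
- have -> : pairing v (k *: x) = k * pairing v x.
    by rewrite /pairing mulr_sumr; apply: eq_bigr => i _; rewrite ffunE mulrCA.
  by rewrite !wedgeZl contractZ Hx scalerBr scalerA.
- have -> : pairing v (dx i) = v 0 i.
    rewrite /pairing (bigD1 i) //= dxE eqxx mulr1 big1 ?addr0 // => j ji.
    by rewrite dxE (inj_eq set1_inj) (negbTE ji) mulr0.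
  have e j : v 0 j *: contract_coord j (wedge (dx i) a) =
      (v 0 j * (j == i)%:R) *: a - wedge (dx i) (v 0 j *: contract_coord j a).
    by rewrite contract_coord_wedge_dx scalerBr scalerA wedgeZr.
  rewrite !contract_def wedge_sumr; under eq_bigr do rewrite e.
  rewrite sumrB; congr (_ - _); rewrite (bigD1 i) //= big1 => [|j /negbTE ji].
    by rewrite eqxx mulr1 addr0.
  by rewrite ji mulr0 scale0r.
- rewrite !wedge0l contract0 subr0 /pairing big1 ?scale0r // => i _.
  by rewrite ffunE mulr0.
Qed.

Lemma wedge_anti u v a : is_covector u -> is_covector v ->
  wedge u (wedge v a) = - wedge v (wedge u a).
Proof.
move=> Hu Hv; elim/covector_ind: u / Hu => [x y Hx Hy|k x Hx|i|]; last by rewrite !wedge0l wedge0r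
  oppr0.
- by rewrite !wedgeDl wedgeDr Hx Hy opprD.
- by rewrite !wedgeZl wedgeZr Hx scalerN.
elim/covector_ind: v / Hv => [x y Hx Hy|k x Hx|j|]; last by rewrite !wedge0l wedge0r oppr0.
- by rewrite !wedgeDl wedgeDr Hx Hy opprD.
- by rewrite !wedgeZl wedgeZr Hx scalerN.
exact: wedge_dx_anti.
Qed.

Lemma wedge_sqr u a : is_covector u -> wedge u (wedge u a) = 0.
Proof.
move=> Hu; have /eqP := wedge_anti a Hu Hu.
by rewrite -addr_eq0 -mulr2n -scaler_nat scaler_eq0 pnatr_eq0 => /eqP.
Qed.

End Multilinear.

(** * Exterior products of families, pullbacks and conjugation *)
Section EnumSplit.
Context {n : nat}.
Implicit Types (A S T : {set 'I_n}) (i j : 'I_n).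

Lemma enum_pairwise A : pairwise (fun i j : 'I_n => (i < j)%N) (enum A).
Proof.
rewrite {1}/enum_mem; apply: (subseq_pairwise (filter_subseq _ _)).
rewrite -enumT -[pairwise _ _](pairwise_map val ltn) val_enum_ord.
by rewrite -sorted_pairwise ?iota_ltn_sorted //; exact: ltn_trans.
Qed.

Definition below A i := [set j in A | (j < i)%N]%SET.
Definition above A i := [set j in A | (i < j)%N]%SET.

Lemma pairwise_ltn_inj (s1 s2 : seq 'I_n) :
  pairwise (fun i j : 'I_n => (i < j)%N) s1 ->
  pairwise (fun i j : 'I_n => (i < j)%N) s2 -> s1 =i s2 -> s1 = s2.
Proof.
have tr : transitive (fun i j : 'I_n => (i < j)%N) by move=> y x z; apply: ltn_trans.
rewrite -!(sorted_pairwise tr) => H1 H2.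
by apply: (irr_sorted_eq tr) => // i; rewrite /= ltnn.
Qed.

(** Splitting an enumeration at [i] locates the factor [dx i] in a monomial; the
    length of the first half is the exponent of [move_sign]. *)
Lemma enum_split_in A i : i \in A -> enum A = enum (below A i) ++ i :: enum (above A i).
Proof.
move=> iA; apply: pairwise_ltn_inj; first exact: enum_pairwise.
  rewrite pairwise_cat /= !enum_pairwise /= andbT; apply/andP; split.
    apply/allrelP => x y; rewrite mem_enum inE => /andP[_ xi].
    by rewrite inE mem_enum inE => /predU1P[->//|/andP[_]]; apply: ltn_trans.
  by apply/allP => y; rewrite mem_enum inE => /andP[].
move=> j; rewrite mem_cat inE !mem_enum !inE; have [->|ji] := eqVneq j i.
  by rewrite iA orbT.
by case: ltngtP ji => [||/val_inj ->]; rewrite ?andbT ?andbF ?orbF ?eqxx.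
Qed.

Lemma enum_split_notin A i : i \notin A -> enum A = enum (below A i) ++ enum (above A i).
Proof.
move=> iA; apply: pairwise_ltn_inj; first exact: enum_pairwise.
  rewrite pairwise_cat /= !enum_pairwise /= andbT.
  apply/allrelP => x y; rewrite !mem_enum !inE => /andP[_ xi] /andP[_].
  exact: ltn_trans.
move=> j; rewrite mem_cat !mem_enum !inE; have [->|ji] := eqVneq j i.
  by rewrite (negbTE iA).
by case: ltngtP ji => [||/val_inj ->]; rewrite ?andbT ?andbF ?orbF ?eqxx.
Qed.

Lemma inversions_below A i : inversions [set i] A = #|below A i|.
Proof.
by rewrite inversionsE big_set1 -sum1dep_card big_mkcondr.
Qed.

Lemma belowU1 A i : below (i |: A) i = below A i.
Proof. by apply/setP => j; rewrite !inE; case: eqVneq => //= ->; rewrite ltnn andbF. Qed.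
Lemma aboveU1 A i : above (i |: A) i = above A i.
Proof. by apply/setP => j; rewrite !inE; case: eqVneq => //= ->; rewrite ltnn andbF. Qed.

End EnumSplit.

Section WedgeSet.
Context {R : realType} {n : nat}.
Local Notation C := R[i].
Local Notation E := (ext R n).
Implicit Types (a b c : E) (S T A B : {set 'I_n}) (i j : 'I_n).

Lemma wedge_seq_move (f : 'I_n -> E) (s : seq 'I_n) u a :
  (forall i, is_covector (f i)) -> is_covector u ->
  wedge (\big[wedge/ext1]_(j <- s) f j) (wedge u a) =
  (-1) ^+ size s *: wedge u (wedge (\big[wedge/ext1]_(j <- s) f j) a).
Proof.
move=> Hf Hu; elim: s => [|j s IH]; first by rewrite big_nil !wedge1l expr0 scale1r.
rewrite big_cons -!wedgeA IH wedgeZr wedge_anti // scalerN -scaleNr.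
by rewrite exprS mulN1r.
Qed.

Lemma wedge_setU1 (f : 'I_n -> E) i S : (forall i, is_covector (f i)) ->
  i \notin S -> wedge_set f (i |: S) = move_sign i S *: wedge (f i) (wedge_set f S).
Proof.
move=> Hf iS; rewrite /wedge_set (enum_split_in (setU11 _ _)) belowU1 aboveU1.
rewrite (enum_split_notin iS) !big_cat /= big_cons wedge_seq_move //.
by rewrite -cardE /move_sign inversions_below.
Qed.

Lemma wedge_wedge_set (f : 'I_n -> E) i S : (forall i, is_covector (f i)) ->
  wedge (f i) (wedge_set f S) = if i \in S then 0 else move_sign i S *: wedge_set f (i |: S).
Proof.
move=> Hf; case: ifP => iS; last first.
  by rewrite wedge_setU1 ?iS // scalerA move_sign_sqr scale1r.
by rewrite -(finset.setD1K iS) wedge_setU1 ?inE ?eqxx // wedgeZr wedge_sqr // scaler0.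
Qed.

Lemma wedge_set0 (f : 'I_n -> E) : wedge_set f finset.set0 = ext1.
Proof. by rewrite /wedge_set enum_set0 big_nil. Qed.

Lemma eq_wedge_set (f g : 'I_n -> E) S : (forall i, i \in S -> f i = g i) ->
  wedge_set f S = wedge_set g S.
Proof.
move=> H; rewrite /wedge_set; apply: eq_big_seq => i; rewrite mem_enum; exact: H.
Qed.

(** The algebra endomorphism that extends [dx i |-> f i]. The pullback of forms is the
    case where the [f i] are the columns of a Jacobian. *)
Definition subst (f : 'I_n -> E) a : E := \sum_T a T *: wedge_set f T.

Lemma subst_is_linear f : linear (subst f).
Proof.
move=> k a b; rewrite /subst scaler_sumr -big_split /=; apply: eq_bigr => S _.
by rewrite !ffunE scalerDl -!scalerA.
Qed.
HB.instance Definition _ f := GRing.isLinear.Build C E E _ (subst f) (subst_is_linear f).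

Lemma substD f a b : subst f (a + b) = subst f a + subst f b.
Proof. exact: linearD. Qed.
Lemma substZ f k a : subst f (k *: a) = k *: subst f a.
Proof. exact: linearZ. Qed.

Lemma subst_monomial f S : subst f (monomial S) = wedge_set f S.
Proof.
rewrite /subst (bigD1 S) //= big1 ?addr0 => [|T /negbTE TS].
  by rewrite monomialE eqxx scale1r.
by rewrite monomialE TS scale0r.
Qed.

Lemma subst1 f : subst f ext1 = ext1.
Proof. by rewrite -monomial0 subst_monomial wedge_set0. Qed.

Section Morphism.
Variables (f : 'I_n -> E) (Hf : forall i, is_covector (f i)).

Lemma subst_wedge_dx i a : subst f (wedge (dx i) a) = wedge (f i) (subst f a).
Proof.
elim/(@ext_lin_ind R n): a => [a b Ha Hb|k a Ha|S].
- by rewrite wedgeDr !substD wedgeDr Ha Hb.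
- by rewrite wedgeZr !substZ wedgeZr Ha.
rewrite wedge_dx_monomial subst_monomial wedge_wedge_set //; case: ifP => _.
  by rewrite linear0.
by rewrite substZ subst_monomial.
Qed.

Lemma subst_wedge a b : subst f (wedge a b) = wedge (subst f a) (subst f b).
Proof.
elim/(@ext_ind R n): a => [a c Ha Hb|k a Ha||i a Ha].
- by rewrite wedgeDl !substD wedgeDl Ha Hb.
- by rewrite wedgeZl !substZ wedgeZl Ha.
- by rewrite subst1 !wedge1l.
- by rewrite -wedgeA !subst_wedge_dx Ha wedgeA.
Qed.

(** The vector [w] is the image of [v] under the transpose of [f]: contraction is natural. *)
Lemma subst_contract (v w : 'rV[C]_n) a : (forall i, pairing v (f i) = w 0 i) ->
  contract v (subst f a) = subst f (contract w a).
Proof.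
move=> H; elim/(@ext_ind R n): a => [a b Ha Hb|k a Ha||i a Ha].
- by rewrite substD !contractD substD Ha Hb.
- by rewrite substZ !contractZ substZ Ha.
- by rewrite subst1 !contract1 linear0.
rewrite subst_wedge_dx !contract_wedge //; last exact: is_covector_dx.
rewrite linearB /= substZ subst_wedge_dx Ha H; congr (_ *: _ - _).
rewrite /pairing (bigD1 i) //= dxE eqxx mulr1 big1 ?addr0 // => j ji.
by rewrite dxE (inj_eq set1_inj) (negbTE ji) mulr0.
Qed.

End Morphism.

Lemma is_covector_pullback_dx (J : 'M[R]_n) t :
  is_covector (\sum_i (J i t)%:C *: (dx i : E)).
Proof.
by apply: is_covector_sum => i _; apply/is_covectorZ/is_covector_dx.
Qed.
#[local] Hint Resolve is_covector_pullback_dx : core.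

Lemma pullback_wedge J a b : pullback J (wedge a b) = wedge (pullback J a) (pullback J b).
Proof. exact: subst_wedge. Qed.

Lemma pullback1 J : pullback J ext1 = ext1 :> E.
Proof. exact: subst1. Qed.

Lemma pullbackD J a b : pullback J (a + b) = pullback J a + pullback J b.
Proof. exact: substD. Qed.

Lemma pullbackZ J k a : pullback J (k *: a) = k *: pullback J a.
Proof. exact: substZ. Qed.

Lemma sum_delta (F : 'I_n -> C) i : \sum_j F j * (dx i : E) [set j]%SET = F i.
Proof.
rewrite (bigD1 i) //= dxE eqxx mulr1 big1 ?addr0 // => j ji.
by rewrite dxE (inj_eq set1_inj) (negbTE ji) mulr0.
Qed.

Lemma pullback_contract J (v : 'rV[C]_n) a :
  contract v (pullback J a) = pullback J (contract (v *m map_mx (real_complex R) J) a).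
Proof.
apply: subst_contract => // t; rewrite /pairing mxE.
have E1 j : (\sum_i (J i t)%:C *: (dx i : E)) [set j]%SET = (J j t)%:C.
  rewrite sum_ffunE -[RHS](sum_delta (fun i => (J i t)%:C)).
  by apply: eq_bigr => i _; rewrite ffunE !dxE (inj_eq set1_inj) [in RHS](inj_eq set1_inj) eq_sym.
by apply: eq_bigr => j _; rewrite E1 mxE.
Qed.

Lemma conj_extE a S : conj_ext a S = (conjc (a S)) :> C.
Proof. by rewrite ffunE. Qed.

Lemma conj_extD a b : conj_ext (a + b) = conj_ext a + conj_ext b.
Proof. by apply/ffunP => S; rewrite !ffunE rmorphD. Qed.
Lemma conj_extZ k a : conj_ext (k *: a) = (conjc k) *: conj_ext a.
Proof. by apply/ffunP => S; rewrite !ffunE rmorphM. Qed.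
Lemma conj_ext0 : conj_ext (0 : E) = 0.
Proof. by apply/ffunP => S; rewrite !ffunE rmorph0. Qed.
Lemma conj_extN a : conj_ext (- a) = - conj_ext a.
Proof. by apply/ffunP => S; rewrite !ffunE rmorphN. Qed.
Lemma conj_ext_sum (K : Type) (r : seq K) (P : pred K) (F : K -> E) :
  conj_ext (\sum_(t <- r | P t) F t) = \sum_(t <- r | P t) conj_ext (F t).
Proof. by rewrite (big_morph _ conj_extD conj_ext0). Qed.
Lemma conj_extK : involutive (conj_ext : E -> E).
Proof. by move=> a; apply/ffunP => S; rewrite !ffunE conjcK. Qed.
Lemma conj_monomial S : conj_ext (monomial S) = monomial S :> E.
Proof. by apply/ffunP => T; rewrite !ffunE; case: eqP; rewrite ?rmorph1 ?rmorph0. Qed.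
Lemma conj_ext1 : conj_ext ext1 = ext1 :> E.
Proof. by rewrite -monomial0 conj_monomial. Qed.
Lemma conj_dx i : conj_ext (dx i) = dx i :> E.
Proof. exact: conj_monomial. Qed.

Lemma conj_wedge a b : conj_ext (wedge a b) = wedge (conj_ext a) (conj_ext b).
Proof.
apply/ffunP => S; rewrite conj_extE !wedgeE rmorph_sum; apply: eq_bigr => A _.
by rewrite !rmorphM !conj_extE; congr (_ * _ * _); rewrite rmorphXn rmorphN rmorph1.
Qed.

Lemma conj_contract (v : 'rV[C]_n) a : conj_ext (contract v a) = contract
  (map_mx (fun z => (conjc z)) v) (conj_ext a).
Proof.
rewrite !contract_def conj_ext_sum; apply: eq_bigr => i _; rewrite conj_extZ mxE; congr (_ *: _).
apply/ffunP => S; rewrite conj_extE !contract_coordE; case: ifP => _; first exact: rmorph0.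
by rewrite rmorphM conj_extE; congr (_ * _); rewrite /move_sign rmorphXn rmorphN rmorph1.
Qed.

Lemma conj_covector a : is_covector a -> is_covector (conj_ext a).
Proof. by move=> Ha S S1; rewrite conj_extE Ha // rmorph0. Qed.

Lemma pullback_conj J a : pullback J (conj_ext a) = conj_ext (pullback J a).
Proof.
elim/(@ext_ind R n): a => [a b Ha Hb|k a Ha||i a Ha].
- by rewrite pullbackD !conj_extD pullbackD Ha Hb.
- by rewrite pullbackZ !conj_extZ pullbackZ Ha.
- by rewrite !(pullback1,conj_ext1).
rewrite conj_wedge !pullback_wedge conj_wedge Ha conj_dx; congr wedge.
rewrite /pullback conj_ext_sum; apply: eq_bigr => T _; rewrite conj_extZ dxE.
have [->|_] := eqVneq T [set i]%SET; last first.
  by rewrite [X in _ = X *: _](rmorph0 (@conjc R)) !scale0r.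
rewrite [X in _ = X *: _](rmorph1 (@conjc R)).
rewrite /wedge_set enum_set1 big_seq1 conj_ext_sum; congr (_ *: _).
apply: eq_bigr => j _; rewrite conj_extZ conj_dx; congr (_ *: _).
by apply/eqP; rewrite eq_complex /= oppr0 !eqxx.
Qed.

End WedgeSet.

(** * The Hermitian product and the adjoint of exterior multiplication *)
(** Deleting the entry [x] of a sequence is the index map [bump], the one of minors. *)
Lemma nth_cat_bump (T : Type) (x0 x : T) (s1 s2 : seq T) k :
  nth x0 (s1 ++ x :: s2) (bump (size s1) k) = nth x0 (s1 ++ s2) k.
Proof.
rewrite !nth_cat /bump; case: (leqP (size s1) k) => sk; last by rewrite add0n sk.
by rewrite add1n ltnNge leqW //= subSn.
Qed.

Section Conjugate.
Context {R : realType}.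
Implicit Types x y : R[i].
Lemma conjM x y : (conjc (x * y)) = (conjc x) * (conjc y).
Proof. exact: rmorphM. Qed.
Lemma conjD x y : (conjc (x + y)) = (conjc x) + (conjc y).
Proof. exact: rmorphD. Qed.
Lemma conjN x : (conjc (- x)) = - (conjc x).
Proof. exact: rmorphN. Qed.
Lemma conj0 : (conjc (0 : R[i])) = 0.
Proof. exact: rmorph0. Qed.
Lemma conj1 : (conjc (1 : R[i])) = 1.
Proof. exact: rmorph1. Qed.
Lemma conj_sum (J : Type) (r : seq J) (P : pred J) (F : J -> R[i]) :
  (conjc (\sum_(j <- r | P j) F j)) = \sum_(j <- r | P j) (conjc (F j)).
Proof. exact: (rmorph_sum (@conjc R)). Qed.
End Conjugate.

Section Gram.
Context {R : realType} {n : nat}.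
Variable g : 'M[R]_n.
Local Notation C := R[i].
Local Notation E := (ext R n).
Implicit Types (a b c : E) (S T A B : {set 'I_n}) (i j : 'I_n).

Definition det_seq x0 m (s t : seq 'I_n) : R :=
  \det (\matrix_(k < m, l < m) invmx g (nth x0 s k) (nth x0 t l)).

Lemma gramE x0 m S T : #|S| = m -> #|T| = m ->
  gram g S T = det_seq x0 m (enum S) (enum T).
Proof.
move=> <- ST; rewrite /gram /det_seq; congr (\det _); apply/matrixP => k l; rewrite !mxE.
rewrite (enum_val_nth x0); congr (invmx g _ _); apply: set_nth_default.
by rewrite -cardE ST.
Qed.

(** Expansion of the Gram determinant along the row of [i]. The position of [i] in
    [i |: S], and that of [j] in [T], are the numbers of inversions, so the cofactor
    signs are those of the exterior algebra. *)
Lemma gram_laplace i S T : i \notin S -> #|T| = #|S|.+1 ->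
  gram g (i |: S) T =
  \sum_(j in T) (-1) ^+ (inversions [set i]%SET S + inversions [set j]%SET (T :\ j)) *
     invmx g i j * gram g S (T :\ j).
Proof.
move=> iS TS; rewrite (@gramE i #|S|.+1) //; last by rewrite cardsU1 iS.
have k0P : (inversions [set i]%SET S < #|S|.+1)%N.
  by rewrite inversions_below ltnS; apply/subset_leq_card/fintype.subsetP => j; rewrite inE =>
    /andP[].
rewrite /det_seq (expand_det_row _ (Ordinal k0P)) -[RHS]big_enum /=.
rewrite [RHS](big_nth i) -cardE TS big_mkord; apply: eq_bigr => l _.
set j := nth i (enum T) l.
have lT : (l < size (enum T))%N by rewrite -cardE TS.
have jT : j \in T by rewrite -mem_enum mem_nth.
have ET := enum_split_in jT.
have lE : size (enum (below T j)) = l.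
  have := index_uniq i lT (enum_uniq T); rewrite -/j {1}ET index_cat.
  by rewrite mem_enum inE ltnn andbF /= eqxx addn0.
have ETj : enum (T :\ j) = enum (below T j) ++ enum (above T j).
  by rewrite (@enum_split_notin _ _ j) ?inE ?eqxx // -belowU1 -aboveU1 finset.setD1K.
have ES : enum (i |: S) = enum (below S i) ++ i :: enum (above S i).
  by rewrite (enum_split_in (setU11 _ _)) belowU1 aboveU1.
have lE' : inversions [set j]%SET (T :\ j) = l.
  by rewrite inversions_below -belowU1 finset.setD1K // cardE lE.
have kE : inversions [set i]%SET S = size (enum (below S i)).
  by rewrite inversions_below cardE.
rewrite mxE /= -/j; have -> : nth i (enum (i |: S)) (inversions [set i]%SET S) = i.
  by rewrite ES kE nth_cat ltnn subnn.
rewrite /cofactor /= lE' mulrCA mulrA; congr (_ * _).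
rewrite (@gramE i #|S|) //; last first.
  by have := cardsD1 j T; rewrite jT TS => -[].
congr (\det _); apply/matrixP => p q; rewrite !mxE /=.
by rewrite ES kE nth_cat_bump -(enum_split_notin iS) -lE ET nth_cat_bump -ETj.
Qed.

Lemma hprodE a b : hprod g a b =
  \sum_(S : {set 'I_n}) \sum_(T : {set 'I_n} | #|T| == #|S|)
    a S * conjc (b T) * (gram g S T)%:C.
Proof. by []. Qed.

Lemma hprodDl a b c : hprod g (a + b) c = hprod g a c + hprod g b c.
Proof.
rewrite !hprodE -big_split; apply: eq_bigr => S _; rewrite -big_split.
by apply: eq_bigr => T _; rewrite ffunE !mulrDl.
Qed.

Lemma hprodZl k a c : hprod g (k *: a) c = k * hprod g a c.
Proof.
rewrite !hprodE mulr_sumr; apply: eq_bigr => S _; rewrite mulr_sumr.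
by apply: eq_bigr => T _; rewrite ffunE !mulrA.
Qed.

Lemma hprodDr a b c : hprod g a (b + c) = hprod g a b + hprod g a c.
Proof.
rewrite !hprodE -big_split; apply: eq_bigr => S _; rewrite -big_split.
by apply: eq_bigr => T _; rewrite ffunE conjD mulrDr mulrDl.
Qed.

Lemma hprodZr k a c : hprod g a (k *: c) = (conjc k) * hprod g a c.
Proof.
rewrite !hprodE mulr_sumr; apply: eq_bigr => S _; rewrite mulr_sumr.
by apply: eq_bigr => T _; rewrite ffunE conjM mulrCA !mulrA.
Qed.

Lemma hprod0r a : hprod g a 0 = 0.
Proof. by rewrite -(scale0r (0 : E)) hprodZr conj0 mul0r. Qed.
Lemma hprod0l a : hprod g 0 a = 0.
Proof. by rewrite -(scale0r (0 : E)) hprodZl mul0r. Qed.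

Lemma hprodNr a b : hprod g a (- b) = - hprod g a b.
Proof. by rewrite -scaleN1r hprodZr conjN conj1 mulN1r. Qed.
Lemma hprodNl a b : hprod g (- a) b = - hprod g a b.
Proof. by rewrite -scaleN1r hprodZl mulN1r. Qed.

Lemma hprod_monomiall S b :
  hprod g (monomial S) b = \sum_(T : {set 'I_n} | #|T| == #|S|) (conjc (b T)) * (gram g S T)%:C.
Proof.
rewrite !hprodE (bigD1 S) //= [X in _ + X]big1 ?addr0 => [|A /negbTE AS].
  by apply: eq_bigr => T _; rewrite monomialE eqxx mul1r.
by rewrite big1 // => T _; rewrite monomialE AS !mul0r.
Qed.

Definition invmx_row i : 'rV[C]_n := \row_j (invmx g i j)%:C.

Lemma conj_move_sign i S : (conjc (move_sign i S)) = move_sign i S :> C.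
Proof. by rewrite /move_sign rmorphXn rmorphN rmorph1. Qed.

Lemma contractE v a S : contract v a S = \sum_j v 0 j * contract_coord j a S :> C.
Proof. by rewrite !contract_def sum_ffunE; apply: eq_bigr => j _; rewrite ffunE. Qed.

(** Row expansion of the Gram determinants; the sum over pairs [j \in T] is
    reindexed by the sets [T :\ j], which are the indices of the contracted form. *)
Lemma hprod_wedge_monomial i S b : i \notin S ->
  hprod g (wedge (dx i) (monomial S)) b = hprod g (monomial S) (contract (invmx_row i) b).
Proof.
move=> iS; rewrite wedge_dx_monomial (negbTE iS) hprodZl !hprod_monomiall cardsU1 iS add1n.
transitivity (\sum_(T : {set 'I_n} | #|T| == #|S|.+1) \sum_(j in T)
   (invmx g i j)%:C * (move_sign j (T :\ j) * (conjc (b T)) * (gram g S (T :\ j))%:C)).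
  rewrite mulr_sumr; apply: eq_bigr => T /eqP TS.
  rewrite gram_laplace // rmorph_sum !mulr_sumr; apply: eq_bigr => j _.
  rewrite !rmorphM /= rmorphXn rmorphN rmorph1 exprD -!/(move_sign _ _).
  rewrite -[RHS]mul1r -(move_sign_sqr i S); ring.
rewrite (exchange_big_dep predT) //=.
transitivity (\sum_(j : 'I_n) \sum_(T : {set 'I_n} | (#|T| == #|S|) && (j \notin T))
   (invmx g i j)%:C * (move_sign j T * (conjc (b (j |: T))) * (gram g S T)%:C)); last first.
  rewrite (exchange_big_dep (fun T => #|T| == #|S|)) => [|j T _ /andP[]//]; apply: eq_bigr => T TS.
  rewrite contractE conj_sum mulr_suml [RHS](bigID (fun j => j \in T)) /=.
  rewrite [X in _ = X + _]big1 ?add0r => [|j jT]; last first.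
    by rewrite contract_coordE jT mulr0 conj0 mul0r.
  apply: eq_big => [j|j /andP[_ jT]]; first by rewrite TS.
  rewrite contract_coordE (negbTE jT) mxE !conjM conjc_real conj_move_sign.
  ring.
apply: eq_bigr => j _.
rewrite (reindex_onto (fun T => j |: T) (fun T => T :\ j)) /=; last first.
  by move=> T /andP[_ jT]; rewrite finset.setD1K.
apply: eq_big => [T|T].
  rewrite finset.setU11 andbT; have [jT|jT] := boolP (j \in T).
    rewrite andbF; apply/negbTE; rewrite negb_and; apply/orP; right.
    by apply/eqP => e; move: jT; rewrite -e !inE eqxx.
  by rewrite finset.setU1K // eqxx cardsU1 jT andbT.
by move=> /andP[_ /eqP ->].
Qed.

Lemma contract_sqr v a : contract v (contract v a) = 0.
Proof.
have /eqP := contract_anti v v a.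
by rewrite -addr_eq0 -mulr2n -scaler_nat scaler_eq0 pnatr_eq0 => /eqP.
Qed.

(** A monomial that contains [dx i] is itself a product with [dx i], so the left side is
    zero and the right side is a double contraction, which vanishes too. *)
Lemma hprod_wedge_dx i a b :
  hprod g (wedge (dx i) a) b = hprod g a (contract (invmx_row i) b).
Proof.
elim/(@ext_lin_ind R n): a => [a c Ha Hc|k a Ha|S].
- by rewrite wedgeDr !hprodDl Ha Hc.
- by rewrite wedgeZr !hprodZl Ha.
have [iS|] := boolP (i \in S); last exact: hprod_wedge_monomial.
have iT : i \notin S :\ i by rewrite !inE eqxx.
have -> : monomial S = move_sign i (S :\ i) *: wedge (dx i) (monomial (S :\ i)) :> E.
  by rewrite wedge_dx_monomial (negbTE iT) scalerA move_sign_sqr scale1r finset.setD1K.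
rewrite wedgeZr wedge_dx_sqr scaler0 hprod0l hprodZl hprod_wedge_monomial //.
by rewrite contract_sqr hprod0r mulr0.
Qed.

(** The metric dual of the covector [conj u]. The conjugation is there because the
    Hermitian product is antilinear in its second argument. *)
Definition sharp (u : E) : 'rV[C]_n :=
  \row_j \sum_i (conjc (u [set i]%SET)) * (invmx g i j)%:C.

Lemma sharpD u v : sharp (u + v) = sharp u + sharp v.
Proof.
apply/rowP => j; rewrite !mxE -big_split; apply: eq_bigr => i _.
by rewrite ffunE conjD mulrDl.
Qed.
Lemma sharpZ k u : sharp (k *: u) = (conjc k) *: sharp u.
Proof.
apply/rowP => j; rewrite !mxE mulr_sumr; apply: eq_bigr => i _.
by rewrite ffunE conjM mulrA.
Qed.
Lemma sharp0 : sharp 0 = 0.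
Proof. by rewrite -(scale0r (0 : E)) sharpZ conj0 scale0r. Qed.
Lemma sharp_dx i : sharp (dx i) = invmx_row i.
Proof.
apply/rowP => j; rewrite !mxE (bigD1 i) //= dxE eqxx conj1 mul1r big1 ?addr0 //.
by move=> k ki; rewrite dxE (inj_eq set1_inj) (negbTE ki) conj0 mul0r.
Qed.

Lemma contract0l a : contract 0 a = 0.
Proof. by rewrite -(scale0r (0 : 'rV[C]_n)) contractZl scale0r. Qed.

(** The adjoint of a creation operator is an annihilation operator; by linearity it is
    enough to take a coordinate covector. *)
Lemma hprod_wedge u a b : is_covector u ->
  hprod g (wedge u a) b = hprod g a (contract (sharp u) b).
Proof.
move=> Hu; elim/(@covector_ind R n): u / Hu => [u v Hu Hv|k u Hu|i|].
- by rewrite wedgeDl hprodDl sharpD contractDl hprodDr Hu Hv.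
- by rewrite wedgeZl hprodZl sharpZ contractZl hprodZr conjcK Hu.
- by rewrite sharp_dx hprod_wedge_dx.
- by rewrite wedge0l hprod0l sharp0 contract0l hprod0r.
Qed.

Section Symmetric.
Hypothesis gT : g^T = g.

Lemma gram_sym S T : #|S| = #|T| -> gram g S T = gram g T S.
Proof.
move=> ST; have [x0 _|n0] := pickP 'I_n; last first.
  have e (A : {set 'I_n}) : A = finset.set0 by apply/setP => i; have := n0 i.
  by rewrite (e S) (e T).
rewrite (@gramE x0 #|S| S T) // (@gramE x0 #|S| T S) // /det_seq -[LHS]det_tr.
congr (\det _); apply/matrixP => k l; rewrite !mxE.
by rewrite -[in LHS]gT -trmx_inv mxE.
Qed.

Lemma hprod_sym a b : hprod g b a = (conjc (hprod g a b)).
Proof.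
rewrite !hprodE conj_sum; under [RHS]eq_bigr do rewrite conj_sum.
rewrite [RHS](exchange_big_dep predT) //=; apply: eq_bigr => S _.
apply: eq_big => [T|T /eqP TS]; first by rewrite eq_sym.
by rewrite !conjM conjcK conjc_real gram_sym //; ring.
Qed.

Lemma hprod_contract u a b : is_covector u ->
  hprod g (contract (sharp u) a) b = hprod g a (wedge u b).
Proof. by move=> Hu; rewrite hprod_sym -hprod_wedge // -hprod_sym. Qed.

Lemma hprod_ext1 b : hprod g ext1 b = (conjc (b finset.set0)).
Proof.
rewrite -monomial0 hprod_monomiall cards0 (bigD1 finset.set0) ?cards0 //= big1 ?addr0.
  have det0 m (M : 'M[R]_m) : m = 0%N -> \det M = 1 by move=> m0; subst m; exact: det_mx00.
  by rewrite /gram det0 ?cards0 // mulr1.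
by move=> T /andP[/eqP/cards0_eq -> /eqP].
Qed.

(** Contractions lower the degree and preserve orthogonality to everything, and the
    scalar part is seen by [ext1]; so induction on the number of indices shows that
    every coefficient of [b] vanishes. *)
Lemma hprod_nondegenerate b : g \in unitmx ->
  (forall a, hprod g a b = 0) -> b = 0.
Proof.
move=> gU Hb; apply/ffunP => S; rewrite [RHS]ffunE.
have [m] := ubnP #|S|; elim: m S b Hb => // m IH S b Hb; rewrite ltnS => Sm.
have [->|[i iS]] := set_0Vmem S.
  by have := Hb ext1; rewrite hprod_ext1 => /(congr1 conjc); rewrite conjcK conj0.
have /IH H : forall a, hprod g a (contract_coord i b) = 0.
  (* The rows of the inverse metric span the coordinate vectors. *)
  move=> a; suff -> : contract_coord i b = \sum_j (g i j)%:C *: contract (invmx_row j) b.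
    elim/big_rec: _ => [|j x _ Hx]; first exact: hprod0r.
    by rewrite hprodDr hprodZr -hprod_wedge_dx Hb Hx mulr0 addr0.
  under eq_bigr do rewrite contract_def scaler_sumr.
  rewrite exchange_big /=; rewrite (bigD1 i) //= [X in _ + X]big1 ?addr0 => [|k ki].
    under eq_bigr do rewrite scalerA mxE -rmorphM /=.
    rewrite -scaler_suml -rmorph_sum /=.
    have := congr1 (fun M : 'M[R]_n => M i i) (mulmxV gU); rewrite !mxE eqxx => ->.
    by rewrite scale1r.
  under eq_bigr do rewrite scalerA mxE -rmorphM /=.
  rewrite -scaler_suml -rmorph_sum /=.
  have := congr1 (fun M : 'M[R]_n => M i k) (mulmxV gU); rewrite !mxE eq_sym (negbTE ki) => ->.
  by rewrite scale0r.
have := H (S :\ i); rewrite (cardsD1 i) iS in Sm.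
move/(_ Sm); rewrite contract_coordE !inE eqxx /= finset.setD1K // => /eqP.
by rewrite mulf_eq0 /move_sign signr_eq0 /= => /eqP.
Qed.

End Symmetric.
End Gram.

(** * The type decomposition *)
Section Types.
Context {R : realType} {n : nat}.
Variable J : 'M[R]_n.
Local Notation C := R[i].
Local Notation E := (ext R n).
Implicit Types (a b c u : E) (S T A B : {set 'I_n}) (i j : 'I_n).

Lemma comp_acs_is_linear : linear (comp_acs J : E -> E).
Proof.
move=> k a b; rewrite /comp_acs scaler_sumr -big_split /=; apply: eq_bigr => i _.
rewrite scalerA -scalerDl; congr (_ *: _); rewrite mulr_sumr -big_split /=.
by apply: eq_bigr => j _; rewrite !ffunE mulrDr mulrCA.
Qed.

HB.instance Definition _ := GRing.isLinear.Build C E E _ (comp_acs J) comp_acs_is_linear.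

Lemma is_covector_comp_acs a : is_covector (comp_acs J a).
Proof. by apply: is_covector_sum => i _; apply/is_covectorZ/is_covector_dx. Qed.

Lemma swap_scale (k l : C) (a : E) : k *: (l *: a) = l *: (k *: a).
Proof. by rewrite !scalerA mulrC. Qed.

Lemma part10_is_linear : linear (part10 J : E -> E).
Proof.
move=> k a b; rewrite /part10 linearP swap_scale -scalerDr.
by rewrite (scalerDr 'i) (swap_scale 'i) opprD addrACA scalerBr.
Qed.
HB.instance Definition _ := GRing.isLinear.Build C E E _ (part10 J) part10_is_linear.

Lemma part01_is_linear : linear (part01 J : E -> E).
Proof.
move=> k a b; rewrite /part01 linearP swap_scale -scalerDr.
by rewrite (scalerDr 'i) (swap_scale 'i) addrACA (scalerDr k).
Qed.
HB.instance Definition _ := GRing.isLinear.Build C E E _ (part01 J) part01_is_linear.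

Lemma part10D a b : part10 J (a + b) = part10 J a + part10 J b.
Proof. exact: linearD. Qed.
Lemma part10Z k a : part10 J (k *: a) = k *: part10 J a.
Proof. exact: linearZ. Qed.
Lemma part10_0 : part10 J 0 = 0 :> E.
Proof. exact: linear0. Qed.
Lemma part01D a b : part01 J (a + b) = part01 J a + part01 J b.
Proof. exact: linearD. Qed.
Lemma part01Z k a : part01 J (k *: a) = k *: part01 J a.
Proof. exact: linearZ. Qed.
Lemma part01_0 : part01 J 0 = 0 :> E.
Proof. exact: linear0. Qed.
Lemma comp_acsD a b : comp_acs J (a + b) = comp_acs J a + comp_acs J b.
Proof. exact: linearD. Qed.
Lemma comp_acsN a : comp_acs J (- a) = - comp_acs J a.
Proof. exact: linearN. Qed.
Lemma comp_acsZ k a : comp_acs J (k *: a) = k *: comp_acs J a.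
Proof. exact: linearZ. Qed.

Lemma is_covector_part10 a : is_covector a -> is_covector (part10 J a).
Proof.
move=> Ha; apply/is_covectorZ/is_covectorD => //; rewrite -scaleN1r.
by apply/is_covectorZ/is_covectorZ/is_covector_comp_acs.
Qed.

Lemma is_covector_part01 a : is_covector a -> is_covector (part01 J a).
Proof.
move=> Ha; apply/is_covectorZ/is_covectorD => //.
by apply/is_covectorZ/is_covector_comp_acs.
Qed.

Lemma half_twice (x : E) : 2^-1 *: (x + x) = x.
Proof.
have e : x + x = 2 *: x by rewrite scaler_nat mulr2n.
by rewrite e scalerA mulVf ?scale1r // pnatr_eq0.
Qed.

Lemma part10D01 a : part10 J a + part01 J a = a.
Proof.
by rewrite /part10 /part01 -scalerDr addrACA addNr addr0 half_twice.
Qed.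

Definition type_factor A i : E := if i \in A then part10 J (dx i) else part01 J (dx i).

Lemma is_covector_type_factor A i : is_covector (type_factor A i).
Proof.
by rewrite /type_factor; case: ifP => _;
  [apply: is_covector_part10|apply: is_covector_part01]; apply: is_covector_dx.
Qed.

Lemma type_proj_is_linear p q : linear (type_proj J p q : E -> E).
Proof.
move=> k a b; rewrite /type_proj scaler_sumr -big_split /=; apply: eq_bigr => S _.
by rewrite !ffunE scalerDl -!scalerA.
Qed.
HB.instance Definition _ p q := GRing.isLinear.Build C E E _ (type_proj J p q)
  (type_proj_is_linear p q).

Lemma type_projZ p q k a : type_proj J p q (k *: a) = k *: type_proj J p q a.
Proof. exact: linearZ. Qed.

Lemma type_proj_monomial p q S : type_proj J p q (monomial S) =
  if #|S| == (p + q)%N then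
    \sum_(A in powerset S | #|A| == p) wedge_set (type_factor A) S else 0.
Proof.
rewrite /type_proj; case: ifP => Spq.
  rewrite (bigD1 S) //= [X in _ + X]big1 ?addr0 => [|T /andP[_ /negbTE TS]].
    by rewrite monomialE eqxx scale1r.
  by rewrite monomialE TS scale0r.
rewrite big1 // => T TS; rewrite monomialE; case: eqP => [e|_]; last by rewrite scale0r.
by rewrite -e TS in Spq.
Qed.

(** The choices of factors for [i |: S], sorted by the type chosen for [dx i]. *)
Lemma sum_powersetU1 (F : {set 'I_n} -> E) i S p : i \notin S ->
  \sum_(A in powerset (i |: S) | #|A| == p) F A =
  \sum_(A in powerset S | #|A|.+1 == p) F (i |: A) + \sum_(A in powerset S | #|A| == p) F A.
Proof.
move=> iS.
have subU1 A : i \notin A -> (A \subset i |: S) = (A \subset S).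
  by move=> iA; rewrite -[S in RHS](finset.setU1K iS) finset.subsetD1 iA andbT.
 rewrite (bigID (fun A => i \in A)) /=; congr (_ + _).
  rewrite (reindex_onto (fun A => i |: A) (fun A => A :\ i)) /=; last first.
    by move=> A /andP[_ iA]; rewrite finset.setD1K.
  apply: eq_bigl => A; rewrite !powersetE finset.subUset finset.sub1set !finset.setU11 /= andbT.
  have [iA|iA] := boolP (i \in A).
    rewrite (_ : (_ :\ _ == _) = false) ?andbF.
      by apply/esym/negbTE; rewrite negb_and (contra _ iS) // => /fintype.subsetP ->.
    by apply/eqP => e; move: iA; rewrite -e !inE eqxx.
  by rewrite finset.setU1K // eqxx andbT cardsU1 iA subU1.
apply: eq_bigl => A; rewrite !powersetE andbAC; congr (_ && _).
have [iA|iA] := boolP (i \in A); last by rewrite andbT subU1.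
by rewrite andbF; apply/esym/negbTE; apply: contra iS => /fintype.subsetP ->.
Qed.

(** The value at degree zero makes the formulas for the type components of a product
    uniform. *)
Definition type_proj_pred10 p q a : E := if p is p'.+1 then type_proj J p' q a else 0.
Definition type_proj_pred01 p q a : E := if q is q'.+1 then type_proj J p q' a else 0.

Lemma type_proj_dx_monomial p q i S : i \notin S ->
  type_proj J p q (wedge (dx i) (monomial S)) =
  wedge (part10 J (dx i)) (type_proj_pred10 p q (monomial S)) + wedge (part01 J (dx i))
    (type_proj_pred01 p q (monomial S)).
Proof.
move=> iS; rewrite wedge_dx_monomial (negbTE iS) type_projZ type_proj_monomial cardsU1 iS add1n.
have H A : wedge_set (type_factor A) (i |: S) =
    move_sign i S *: wedge (type_factor A i) (wedge_set (type_factor A) S).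
  by rewrite wedge_setU1 //; apply: is_covector_type_factor.
have L : wedge (part10 J (dx i)) (type_proj_pred10 p q (monomial S)) =
    if #|S|.+1 == (p + q)%N then
     \sum_(A in powerset S | #|A|.+1 == p) move_sign i S *: wedge_set (type_factor (i |: A))
       (i |: S)
    else 0.
  case: p => [|p] /=; first by rewrite wedge0r big_pred0 ?if_same // => A; rewrite andbF.
  rewrite type_proj_monomial addSn eqSS; case: ifP => _; last by rewrite wedge0r.
  rewrite wedge_sumr; apply: eq_bigr => A /andP[]; rewrite powersetE => AS _.
  rewrite H scalerA move_sign_sqr scale1r /type_factor finset.setU11; congr wedge.
  apply: eq_wedge_set => j jS; rewrite !inE; case: eqP => // e.
  by move: iS; rewrite -e jS.
have L' : wedge (part01 J (dx i)) (type_proj_pred01 p q (monomial S)) =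
    if #|S|.+1 == (p + q)%N then
     \sum_(A in powerset S | #|A| == p) move_sign i S *: wedge_set (type_factor A) (i |: S)
    else 0.
  case: q {L} => [|q] /=.
    rewrite wedge0r; case: eqP => // e; rewrite big_pred0 // => A.
    rewrite powersetE; apply/negP => /andP[/subset_leq_card].
    by rewrite leqNgt => /negP H1 /eqP H2; apply: H1; rewrite H2 -[p]addn0 -e.
  rewrite type_proj_monomial addnS eqSS; case: ifP => _; last by rewrite wedge0r.
  rewrite wedge_sumr; apply: eq_bigr => A /andP[]; rewrite powersetE => AS _.
  have iA : i \notin A by apply: contra iS; exact: fintype.subsetP AS i.
  by rewrite H scalerA move_sign_sqr scale1r {2}/type_factor (negbTE iA).
rewrite L L'; case: ifP => _; last by rewrite scaler0 addr0.
by rewrite sum_powersetU1 // scalerDr !scaler_sumr.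
Qed.

Definition is_type01 a := is_covector a /\ comp_acs J a = - 'i *: a.

Lemma sqr_i : 'i * 'i = -1 :> C.
Proof. by rewrite -expr2 sqr_i. Qed.

Lemma part10_type10 a : is_type10 J a -> part10 J a = a.
Proof. by move=> [_ e]; rewrite /part10 e scalerA sqr_i scaleN1r opprK half_twice. Qed.
Lemma part01_type10 a : is_type10 J a -> part01 J a = 0.
Proof. by move=> [_ e]; rewrite /part01 e scalerA sqr_i scaleN1r subrr scaler0. Qed.
Lemma part10_type01 a : is_type01 a -> part10 J a = 0.
Proof. by move=> [_ e]; rewrite /part10 e scalerA mulrN sqr_i opprK scale1r subrr scaler0. Qed.
Lemma part01_type01 a : is_type01 a -> part01 J a = a.
Proof. by move=> [_ e]; rewrite /part01 e scalerA mulrN sqr_i opprK scale1r half_twice. Qed.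

Lemma type_proj_big p q a : (n < p + q)%N -> type_proj J p q a = 0 :> E.
Proof.
move=> npq; rewrite /type_proj big1 // => S /eqP Spq.
by move: npq; rewrite -Spq ltnNge -[X in (_ <= X)%N]card_ord max_card.
Qed.

Section AlmostComplex.
Hypothesis JJ : J *m J = - 1%:M.

Lemma comp_acsK a : is_covector a -> comp_acs J (comp_acs J a) = - a.
Proof.
move=> Ha; rewrite {2}/comp_acs [LHS]/comp_acs [in RHS](covectorE Ha) -sumrN.
apply: eq_bigr => i _; rewrite -scaleNr; congr (_ *: _).
have e j : (\sum_i (\sum_k (J i k)%:C * a [set k]%SET) *: (dx i : E)) [set j]%SET
     = \sum_k (J j k)%:C * a [set k]%SET.
  rewrite sum_ffunE -[RHS](sum_delta (fun j => \sum_k (J j k)%:C * a [set k]%SET)).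
  apply: eq_bigr => k _; rewrite ffunE !dxE; congr (_ * _).
  by rewrite !(inj_eq set1_inj) eq_sym.
under eq_bigr do rewrite e mulr_sumr.
rewrite exchange_big /=.
transitivity (\sum_k ((- 1%:M : 'M[R]_n) i k)%:C * a [set k]%SET).
  apply: eq_bigr => k _; rewrite -JJ mxE rmorph_sum mulr_suml.
  by apply: eq_bigr => j _; rewrite rmorphM mulrA.
rewrite (bigD1 i) //= !mxE eqxx big1 ?addr0 => [|k ki].
  by rewrite rmorphN rmorph1 mulN1r.
by rewrite !mxE eq_sym (negbTE ki) oppr0 mul0r.
Qed.

Lemma part10_is_type10 a : is_covector a -> is_type10 J (part10 J a).
Proof.
move=> Ha; split; first exact: is_covector_part10.
rewrite /part10 comp_acsZ comp_acsD comp_acsN comp_acsZ comp_acsK // scalerN opprK.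
by rewrite swap_scale scalerBr scalerA sqr_i scaleN1r opprK addrC.
Qed.

Lemma part01_is_type01 a : is_covector a -> is_type01 (part01 J a).
Proof.
move=> Ha; split; first exact: is_covector_part01.
rewrite /part01 comp_acsZ comp_acsD comp_acsZ comp_acsK // scalerN.
by rewrite scaleNr swap_scale (scalerDr 'i) scalerA sqr_i scaleN1r -[RHS]scalerN opprD opprK addrC.
Qed.

End AlmostComplex.

Lemma conj_comp_acs a : conj_ext (comp_acs J a) = comp_acs J (conj_ext a).
Proof.
rewrite /comp_acs conj_ext_sum; apply: eq_bigr => i _; rewrite conj_extZ conj_dx.
congr (_ *: _); rewrite conj_sum; apply: eq_bigr => j _.
by rewrite conjM conjc_real conj_extE.
Qed.

Lemma conj_i : conjc 'i = - 'i :> C.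
Proof. by apply/eqP; rewrite eq_complex /= oppr0 !eqxx. Qed.

Lemma conj_half : conjc (2^-1) = 2^-1 :> C.
Proof. by rewrite (fmorphV (@conjc R)) (rmorph_nat (@conjc R)). Qed.

Lemma conj_part10 a : conj_ext (part10 J a) = part01 J (conj_ext a).
Proof.
rewrite /part10 /part01 conj_extZ conj_half conj_extD conj_extN conj_extZ conj_i.
by rewrite conj_comp_acs scaleNr opprK.
Qed.

Lemma conj_part01 a : conj_ext (part01 J a) = part10 J (conj_ext a).
Proof. by rewrite -[a in LHS]conj_extK -conj_part10 conj_extK. Qed.

Lemma conj_type10 a : is_type10 J a -> is_type01 (conj_ext a).
Proof.
move=> [Ha e]; split; first exact: conj_covector.
by rewrite -conj_comp_acs e conj_extZ conj_i.
Qed.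

Lemma type_proj_ext1 p q :
  type_proj J p q ext1 = if (p == 0%N) && (q == 0%N) then ext1 else 0 :> E.
Proof.
rewrite -monomial0 type_proj_monomial cards0 eq_sym addn_eq0; case: ifP => // /andP[/eqP -> _].
rewrite (big_pred1 finset.set0) ?wedge_set0 // => A.
by rewrite powersetE finset.subset0 /=; case: eqP => [->|//]; rewrite cards0.
Qed.

End Types.

(* From here on the type projections are used only through their algebraic laws,
    never through the expansion over subsets that defines them. *)
HB.lock Definition proj10 {R : realType} {n : nat} (J : 'M[R]_n) (a : ext R n) : ext R n := part10
  J a.
HB.lock Definition proj01 {R : realType} {n : nat} (J : 'M[R]_n) (a : ext R n) : ext R n := part01
  J a.
HB.lock Definition type_part {R : realType} {n : nat} (J : 'M[R]_n) (p q : nat) (a : ext R n) :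
  ext R n :=
  type_proj J p q a.
HB.lock Definition type_part_pred10 {R : realType} {n : nat} (J : 'M[R]_n) (p q : nat)
  (a : ext R n) : ext R n :=
  type_proj_pred10 J p q a.
HB.lock Definition type_part_pred01 {R : realType} {n : nat} (J : 'M[R]_n) (p q : nat)
  (a : ext R n) : ext R n :=
  type_proj_pred01 J p q a.

Section TypesLocked.
Context {R : realType} {n : nat}.
Variable J : 'M[R]_n.
Local Notation C := R[i].
Local Notation E := (ext R n).
Implicit Types (a b c u : E) (S T A B : {set 'I_n}) (i j : 'I_n).

Lemma proj10D a b : proj10 J (a + b) = proj10 J a + proj10 J b.
Proof. by rewrite proj10.unlock part10D. Qed.
Lemma proj10Z k a : proj10 J (k *: a) = k *: proj10 J a.
Proof. by rewrite proj10.unlock part10Z. Qed.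
Lemma proj10_0 : proj10 J 0 = 0 :> E.
Proof. by rewrite proj10.unlock part10_0. Qed.
Lemma proj01D a b : proj01 J (a + b) = proj01 J a + proj01 J b.
Proof. by rewrite proj01.unlock part01D. Qed.
Lemma proj01Z k a : proj01 J (k *: a) = k *: proj01 J a.
Proof. by rewrite proj01.unlock part01Z. Qed.
Lemma proj01_0 : proj01 J 0 = 0 :> E.
Proof. by rewrite proj01.unlock part01_0. Qed.
Lemma proj10D01 a : proj10 J a + proj01 J a = a.
Proof. by rewrite proj10.unlock proj01.unlock part10D01. Qed.
Lemma is_covector_proj10 a : is_covector a -> is_covector (proj10 J a).
Proof. by rewrite proj10.unlock; apply: is_covector_part10. Qed.
Lemma is_covector_proj01 a : is_covector a -> is_covector (proj01 J a).
Proof. by rewrite proj01.unlock; apply: is_covector_part01. Qed.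
Lemma proj10_type10 a : is_type10 J a -> proj10 J a = a.
Proof. by rewrite proj10.unlock; apply: part10_type10. Qed.
Lemma proj01_type10 a : is_type10 J a -> proj01 J a = 0.
Proof. by rewrite proj01.unlock; apply: part01_type10. Qed.
Lemma proj10_type01 a : is_type01 J a -> proj10 J a = 0.
Proof. by rewrite proj10.unlock; apply: part10_type01. Qed.
Lemma proj01_type01 a : is_type01 J a -> proj01 J a = a.
Proof. by rewrite proj01.unlock; apply: part01_type01. Qed.
Lemma proj10_is_type10 a : J *m J = - 1%:M -> is_covector a -> is_type10 J (proj10 J a).
Proof. by move=> JJ Ha; rewrite proj10.unlock; apply: part10_is_type10. Qed.
Lemma proj01_is_type01 a : J *m J = - 1%:M -> is_covector a -> is_type01 J (proj01 J a).
Proof. by move=> JJ Ha; rewrite proj01.unlock; apply: part01_is_type01. Qed.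
Lemma conj_proj10 a : conj_ext (proj10 J a) = proj01 J (conj_ext a).
Proof. by rewrite proj10.unlock proj01.unlock conj_part10. Qed.
Lemma conj_proj01 a : conj_ext (proj01 J a) = proj10 J (conj_ext a).
Proof. by rewrite proj10.unlock proj01.unlock conj_part01. Qed.

Lemma type_partD p q a b : type_part J p q (a + b) = type_part J p q a + type_part J p q b.
Proof. by rewrite type_part.unlock [LHS]linearD. Qed.
Lemma type_partZ p q k a : type_part J p q (k *: a) = k *: type_part J p q a.
Proof. by rewrite type_part.unlock [LHS]linearZ. Qed.
Lemma type_partN p q a : type_part J p q (- a) = - type_part J p q a.
Proof. by rewrite type_part.unlock [LHS]linearN. Qed.
Lemma type_part_0 p q : type_part J p q (0 : E) = 0.
Proof. by rewrite type_part.unlock [LHS]linear0. Qed.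
Lemma type_part_sum p q (K : Type) (r : seq K) (P : pred K) (F : K -> E) :
  type_part J p q (\sum_(t <- r | P t) F t) = \sum_(t <- r | P t) type_part J p q (F t).
Proof. by rewrite (big_morph _ (type_partD p q) (type_part_0 p q)). Qed.

Lemma type_part_pred10_0 q a : type_part_pred10 J 0 q a = 0.
Proof. by rewrite type_part_pred10.unlock. Qed.
Lemma type_part_pred10S p q a : type_part_pred10 J p.+1 q a = type_part J p q a.
Proof. by rewrite type_part_pred10.unlock type_part.unlock. Qed.
Lemma type_part_pred01_0 p a : type_part_pred01 J p 0 a = 0.
Proof. by rewrite type_part_pred01.unlock. Qed.
Lemma type_part_pred01S p q a : type_part_pred01 J p q.+1 a = type_part J p q a.
Proof. by rewrite type_part_pred01.unlock type_part.unlock. Qed.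
Definition type_part_predE := (type_part_pred10_0, type_part_pred10S, type_part_pred01_0,
  type_part_pred01S).

Lemma type_part_pred10D p q a b : type_part_pred10 J p q (a + b) = type_part_pred10 J p q a +
  type_part_pred10 J p q b.
Proof. by case: p => [|p]; rewrite !type_part_predE ?addr0 ?type_partD. Qed.
Lemma type_part_pred10Z p q k a : type_part_pred10 J p q (k *: a) = k *: type_part_pred10 J p q a.
Proof. by case: p => [|p]; rewrite !type_part_predE ?scaler0 ?type_partZ. Qed.
Lemma type_part_pred01D p q a b : type_part_pred01 J p q (a + b) = type_part_pred01 J p q a +
  type_part_pred01 J p q b.
Proof. by case: q => [|q]; rewrite !type_part_predE ?addr0 ?type_partD. Qed.
Lemma type_part_pred01Z p q k a : type_part_pred01 J p q (k *: a) = k *: type_part_pred01 J p q a.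
Proof. by case: q => [|q]; rewrite !type_part_predE ?scaler0 ?type_partZ. Qed.

Lemma type_part_wedge_dx_monomial p q i S : i \notin S ->
  type_part J p q (wedge (dx i) (monomial S)) =
  wedge (proj10 J (dx i)) (type_part_pred10 J p q (monomial S)) + wedge (proj01 J (dx i))
    (type_part_pred01 J p q (monomial S)).
Proof.
by rewrite type_part.unlock proj10.unlock proj01.unlock type_part_pred10.unlock
  type_part_pred01.unlock; apply: type_proj_dx_monomial.
Qed.

Lemma type_part_ext1 p q :
  type_part J p q ext1 = if (p == 0%N) && (q == 0%N) then ext1 else 0 :> E.
Proof. by rewrite type_part.unlock; apply: type_proj_ext1. Qed.

Lemma type_part_big p q a : (n < p + q)%N -> type_part J p q a = 0 :> E.
Proof. by rewrite type_part.unlock; apply: type_proj_big. Qed.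

(** For [i \notin S] this is the defining expansion. Otherwise the left side is zero, and
    on the right the two remaining terms, one for each order of the types, cancel by
    anticommutation. *)
Lemma type_part_wedge_dx p q i a :
  type_part J p q (wedge (dx i) a) =
  wedge (proj10 J (dx i)) (type_part_pred10 J p q a) + wedge (proj01 J (dx i))
    (type_part_pred01 J p q a).
Proof.
elim/(@ext_lin_ind R n): a => [a b Ha Hb|k a Ha|S].
- rewrite wedgeDr type_partD Ha Hb.
  by rewrite type_part_pred10D type_part_pred01D !wedgeDr addrACA.
- rewrite wedgeZr type_partZ Ha.
  by rewrite type_part_pred10Z type_part_pred01Z !wedgeZr scalerDr.
have [iS|iS] := boolP (i \in S); last exact: type_part_wedge_dx_monomial.
have iT : i \notin S :\ i by rewrite !inE eqxx.
have -> : monomial S = move_sign i (S :\ i) *: wedge (dx i) (monomial (S :\ i)) :> E.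
  by rewrite wedge_dx_monomial (negbTE iT) scalerA move_sign_sqr scale1r finset.setD1K.
rewrite wedgeZr wedge_dx_sqr scaler0 type_part_0.
rewrite type_part_pred10Z type_part_pred01Z !wedgeZr -scalerDr.
apply/esym/eqP; rewrite scaler_eq0 /move_sign signr_eq0 /=; apply/eqP.
have c10 : is_covector (proj10 J (dx i : E)) by apply/is_covector_proj10/is_covector_dx.
have c01 : is_covector (proj01 J (dx i : E)) by apply/is_covector_proj01/is_covector_dx.
case: p => [|p]; case: q => [|q]; rewrite ?type_part_predE ?wedge0r ?addr0 ?add0r //
  type_part_wedge_dx_monomial // ?type_part_predE
  ?wedgeDr ?wedge0r ?add0r ?addr0 ?wedge_sqr ?wedge0r ?addr0 //.
by rewrite type_part_wedge_dx_monomial // ?type_part_predE wedgeDr !wedge_sqr // add0r addr0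
  wedge_anti // addNr.
Qed.

Lemma type_part_wedge_covector p q u a : is_covector u ->
  type_part J p q (wedge u a) =
  wedge (proj10 J u) (type_part_pred10 J p q a) + wedge (proj01 J u) (type_part_pred01 J p q a).
Proof.
elim/(@covector_ind R n) => [x y Hx Hy|k x Hx|i|].
- by rewrite wedgeDl type_partD Hx Hy proj10D proj01D !wedgeDl addrACA.
- rewrite wedgeZl type_partZ Hx.
  by rewrite proj10Z proj01Z !wedgeZl scalerDr.
- exact: type_part_wedge_dx.
- by rewrite proj10_0 proj01_0 !wedge0l type_part_0 addr0.
Qed.

Lemma type_part_wedge10 p q u a : is_type10 J u ->
  type_part J p q (wedge u a) = wedge u (type_part_pred10 J p q a).
Proof.
move=> Hu; have [cu _] := Hu.
by rewrite type_part_wedge_covector // proj10_type10 // proj01_type10 // wedge0l addr0.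
Qed.

Lemma type_part_wedge01 p q u a : is_type01 J u ->
  type_part J p q (wedge u a) = wedge u (type_part_pred01 J p q a).
Proof.
move=> Hu; have [cu _] := Hu.
by rewrite type_part_wedge_covector // proj10_type01 // proj01_type01 // wedge0l add0r.
Qed.

Section AlmostComplexLocked.
Hypothesis JJ : J *m J = - 1%:M.

Lemma type10_proj10 i : is_type10 J (proj10 J (dx i : E)).
Proof. exact/proj10_is_type10/is_covector_dx. Qed.
Lemma type01_proj01 i : is_type01 J (proj01 J (dx i : E)).
Proof. exact/proj01_is_type01/is_covector_dx. Qed.

(** The induction goes through because multiplication by a covector of pure type shifts
    one degree by one. *)
Lemma type_part_type_part p q p' q' a :
  type_part J p' q' (type_part J p q a) =
  if (p' == p) && (q' == q) then type_part J p q a else 0.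
Proof.
elim/(@ext_ind R n): a p q p' q' => [a b Ha Hb|k a Ha||i a Ha] p q p' q'.
- by rewrite !type_partD Ha Hb; case: ifP => _; rewrite ?addr0.
- by rewrite !type_partZ Ha; case: ifP => _; rewrite ?scaler0.
- rewrite [type_part J p q ext1]type_part_ext1; case: ifP => [/andP[/eqP -> /eqP ->]|_].
    exact: type_part_ext1.
  by rewrite type_part_0 if_same.
rewrite type_part_wedge_dx type_partD (type_part_wedge10 _ _ _ (type10_proj10 i)).
rewrite (type_part_wedge01 _ _ _ (type01_proj01 i)).
have -> : type_part_pred10 J p' q' (type_part_pred10 J p q a) = if (p' == p) && (q' == q) then
  type_part_pred10 J p q a else 0.
  case: p p' => [|p] [|p']; rewrite !type_part_predE ?type_part_0 ?if_same //.
  by rewrite Ha eqSS.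
have -> : type_part_pred01 J p' q' (type_part_pred01 J p q a) = if (p' == p) && (q' == q) then
  type_part_pred01 J p q a else 0.
  case: q q' => [|q] [|q']; rewrite !type_part_predE ?andbF ?type_part_0 ?if_same //.
  by rewrite Ha eqSS.
by case: ifP => _ //; rewrite !wedge0r addr0.
Qed.

(** The bound leaves room for the degrees that exceed [n]; a product with a covector
    shifts the summation range by one, and the terms lost at the ends are zero. *)
Lemma sum_type_part N a : (n.+1 < N)%N ->
  \sum_(p < N) \sum_(q < N) type_part J p q a = a.
Proof.
case: N => // N; rewrite ltnS => nN.
elim/(@ext_ind R n): a => [a b Ha Hb|k a Ha||i a Ha].
- rewrite -[in RHS]Ha -[in RHS]Hb -big_split; apply: eq_bigr => p _ /=.
  by rewrite -big_split; apply: eq_bigr => q _; rewrite type_partD.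
- rewrite -[in RHS]Ha scaler_sumr; apply: eq_bigr => p _ /=.
  by rewrite scaler_sumr; apply: eq_bigr => q _; rewrite type_partZ.
- rewrite big_ord_recl [X in _ + X]big1 ?addr0 => [|p _].
    rewrite big_ord_recl [X in _ + X]big1 ?addr0 => [|q _]; last by rewrite type_part_ext1.
    by rewrite type_part_ext1.
  by rewrite big1 // => q _; rewrite type_part_ext1.
under eq_bigr do under eq_bigr do rewrite type_part_wedge_dx.
under eq_bigr do rewrite big_split /=.
rewrite big_split /= -[in RHS](proj10D01 (dx i)) wedgeDl.
congr (_ + _).
  under eq_bigr do rewrite -wedge_sumr.
  rewrite -wedge_sumr; congr wedge.
  rewrite -[RHS]Ha big_ord_recl [X in X + _]big1 ?add0r => [|q _]; last exact: type_part_pred10_0.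
  rewrite [RHS]big_ord_recr /= [X in _ = _ + X]big1 => [|q _]; last by rewrite type_part_big //
    ltn_addr.
  rewrite addr0; apply: eq_bigr => p _; apply: eq_bigr => q _.
  by rewrite /bump /= add1n type_part_pred10S.
under eq_bigr do rewrite -wedge_sumr.
rewrite -wedge_sumr; congr wedge; rewrite -[RHS]Ha; apply: eq_bigr => p _.
rewrite big_ord_recl type_part_pred01_0 add0r [RHS]big_ord_recr /=
  [type_part J p N a]type_part_big ?ltn_addl //.
by rewrite addr0; apply: eq_bigr => q _; rewrite /bump /= add1n type_part_pred01S.
Qed.

End AlmostComplexLocked.

Lemma conj_type_part p q a : conj_ext (type_part J p q a) = type_part J q p (conj_ext a).
Proof.
elim/(@ext_ind R n): a p q => [a b Ha Hb|k a Ha||i a Ha] p q.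
- by rewrite type_partD !conj_extD type_partD Ha Hb.
- by rewrite type_partZ !conj_extZ type_partZ Ha.
- by rewrite conj_ext1 !type_part_ext1 andbC; case: ifP; rewrite ?conj_ext1 ?conj_ext0.
rewrite conj_wedge conj_dx !type_part_wedge_dx conj_extD !conj_wedge conj_proj10 conj_proj01
  conj_dx addrC.
congr (wedge _ _ + wedge _ _).
  by case: q => [|q]; rewrite !type_part_predE ?conj_ext0.
by case: p => [|p]; rewrite !type_part_predE ?conj_ext0.
Qed.

End TypesLocked.

(** * Unitary coframes *)
Section FrameGeneral.
Context {R : realType} {n : nat}.
Local Notation C := R[i].
Local Notation E := (ext R n).

Lemma pairingD (v : 'rV[C]_n) (a b : E) : pairing v (a + b) = pairing v a + pairing v b.
Proof. by rewrite /pairing -big_split; apply: eq_bigr => i _; rewrite ffunE mulrDr. Qed.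
Lemma pairingZ (v : 'rV[C]_n) k (a : E) : pairing v (k *: a) = k * pairing v a.
Proof. by rewrite /pairing mulr_sumr; apply: eq_bigr => i _; rewrite ffunE mulrCA. Qed.
Lemma pairing0 (v : 'rV[C]_n) : pairing v (0 : E) = 0.
Proof. by rewrite -(scale0r (0 : E)) pairingZ mul0r. Qed.
Lemma pairing_sum (v : 'rV[C]_n) (K : Type) (r : seq K) (P : pred K) (F : K -> E) :
  pairing v (\sum_(t <- r | P t) F t) = \sum_(t <- r | P t) pairing v (F t).
Proof. by rewrite (big_morph _ (pairingD v) (pairing0 v)). Qed.

Definition conj_vec (v : 'rV[C]_n) : 'rV[C]_n := map_mx (fun z => conjc z) v.

Lemma pairing_conj (v : 'rV[C]_n) (a : E) : pairing (conj_vec v) (conj_ext a) = conjc (pairing v a).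
Proof. by rewrite /pairing conj_sum; apply: eq_bigr => i _; rewrite mxE conj_extE conjM. Qed.

Lemma sharp_conj (g : 'M[R]_n) (u : E) : sharp g (conj_ext u) = conj_vec (sharp g u).
Proof.
apply/rowP => j; rewrite !mxE conj_sum; apply: eq_bigr => i _.
by rewrite conj_extE conjM conjc_real.
Qed.

Lemma contract_coord2_wedge i j (u v : E) : is_covector u -> is_covector v ->
  contract_coord j (contract_coord i (wedge u v)) =
  (u [set i]%SET * v [set j]%SET - u [set j]%SET * v [set i]%SET) *: ext1.
Proof.
move=> cu cv.
have e k (w a : E) : is_covector w ->
    contract_coord k (wedge w a) = w [set k]%SET *: a - wedge w (contract_coord k a).
  move=> cw; elim/(@covector_ind R n): w / cw => [x y Hx Hy|l x Hx|l|].
  - rewrite wedgeDl [contract_coord _ (_ + _)]linearD /= Hx Hy ffunE scalerDl wedgeDl opprD.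
    by rewrite addrACA.
  - by rewrite !wedgeZl contract_coordZ Hx ffunE scalerBr scalerA.
  - by rewrite contract_coord_wedge_dx dxE (inj_eq set1_inj).
  - by rewrite !wedge0l [contract_coord _ _]linear0 ffunE scale0r subrr.
have e1 k (w : E) : is_covector w -> contract_coord k w = w [set k]%SET *: ext1.
  by move=> cw; rewrite -{1}[w]wedge1r e // contract_coord1 wedge0r subr0.
rewrite e // (e1 i v cv) wedgeZr wedge1r [contract_coord _ (_ - _)]linearB /= !contract_coordZ
  (e1 j v cv) (e1 j u cu).
by rewrite !scalerA -scalerBl [X in _ - X]mulrC.
Qed.

Lemma comp_acs_coef (J : 'M[R]_n) (a : E) i :
  comp_acs J a [set i]%SET = \sum_j (J i j)%:C * a [set j]%SET :> C.
Proof.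
rewrite sum_ffunE -[RHS](sum_delta (fun j => \sum_k (J j k)%:C * a [set k]%SET)).
apply: eq_bigr => k _; rewrite ffunE !dxE; congr (_ * _).
by rewrite !(inj_eq set1_inj) eq_sym.
Qed.

(** The component [(i, j)] of a two-form. *)
Definition coef2 i j (a : E) : C := contract_coord j (contract_coord i a) finset.set0.

Lemma coef2Z i j k a : coef2 i j (k *: a) = k * coef2 i j a.
Proof. by rewrite /coef2 !contract_coordZ ffunE. Qed.
Lemma coef2_sum i j (K : Type) (r : seq K) (P : pred K) (F : K -> E) :
  coef2 i j (\sum_(t <- r | P t) F t) = \sum_(t <- r | P t) coef2 i j (F t).
Proof. by rewrite /coef2 !contract_coord_sum sum_ffunE. Qed.
Lemma coef2_wedge i j (u v : E) : is_covector u -> is_covector v ->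
  coef2 i j (wedge u v) = u [set i]%SET * v [set j]%SET - u [set j]%SET * v [set i]%SET.
Proof. by move=> cu cv; rewrite /coef2 contract_coord2_wedge // ffunE [ext1 _]ffunE eqxx
  /GRing.scale /= mulr1. Qed.

Lemma sum_delta2 (F : 'I_n -> 'I_n -> C) i j :
  \sum_a \sum_b F a b * ((dx a : E) [set i]%SET * (dx b : E) [set j]%SET) = F i j.
Proof.
rewrite (bigD1 i) //= [X in _ + X]big1 ?addr0 => [|a ai]; last first.
  by rewrite big1 // => b _; rewrite dxE (inj_eq set1_inj) eq_sym (negbTE ai) mul0r mulr0.
rewrite (bigD1 j) //= [X in _ + X]big1 ?addr0 => [|b bj]; last first.
  by rewrite [X in _ * X]mulrC dxE (inj_eq set1_inj) eq_sym (negbTE bj) mul0r mulr0.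
by rewrite !dxE !eqxx !mulr1.
Qed.

(** The form is defined by a sum over [i < j]; antisymmetry of [J *m g] is what extends
    the formula to all pairs. *)
Lemma fundamental_form_coef (J g : 'M[R]_n) i j : (J *m g)^T = - (J *m g) ->
  coef2 i j (fundamental_form J g) = ((J *m g) i j)%:C.
Proof.
move=> anti; set M := J *m g; pose F (a b : 'I_n) : C := if (a < b)%N then (M a b)%:C else 0.
transitivity (F i j - F j i).
  rewrite -(sum_delta2 F i j) -(sum_delta2 F j i) -sumrB coef2_sum; apply: eq_bigr => a _.
  rewrite coef2_sum -sumrB big_mkcond; apply: eq_bigr => b _ /=.
  rewrite /F; case: ifP => ab; last by rewrite !mul0r subrr.
  rewrite coef2Z coef2_wedge ?mulrBr //; exact: is_covector_dx.
have antiE a b : M a b = - M b a.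
  by have := congr1 (fun M : 'M[R]_n => M b a) anti; rewrite !mxE.
rewrite /F; case: ltngtP => [_|_|/val_inj ->]; first by rewrite subr0.
  by rewrite sub0r (antiE i j) (rmorphN (real_complex R)).
rewrite subrr; suff -> : M j j = 0 by [].
have /eqP := antiE j j; rewrite -addr_eq0 -mulr2n -mulr_natl mulf_eq0 pnatr_eq0 /=.
by move/eqP.
Qed.

End FrameGeneral.

Section HermitianFrame.
Context {R : realType}.
Local Notation C := R[i].
Local Notation E := (ext R 6).
Implicit Types (J g : 'M[R]_6) (th : 'I_3 -> E).

(** A coframe of (1,0)-forms with squared length 2, the normalization for which
    omega is [i/2] times the sum of [th k /\ conj (th k)]. The metric duals of the
    coframe are therefore twice a dual basis, and [uf_span] is the expansion of a
    covector in the coframe. *)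
Record unitary_frame J g th : Prop := UnitaryFrame {
  uf_JJ : J *m J = - 1%:M;
  uf_type10 : forall k, is_type10 J (th k);
  uf_sym : g^T = g;
  uf_unit : g \in unitmx;
  uf_dual : forall k l, pairing (sharp g (th k)) (th l) = 2 * (k == l)%:R;
  uf_dual0 : forall k l, pairing (sharp g (th k)) (conj_ext (th l)) = 0;
  uf_span : forall i, dx i =
    \sum_k (2^-1 * sharp g (th k) 0 i) *: th k +
    \sum_k (2^-1 * sharp g (conj_ext (th k)) 0 i) *: conj_ext (th k) }.

Lemma posdef_unitmx m (g : 'M[R]_m) :
  (forall X : 'rV[R]_m, X != 0 -> 0 < (X *m g *m X^T) 0 0) -> g \in unitmx.
Proof.
move=> H; rewrite -row_free_unit -kermx_eq0; apply/eqP/row_matrixP => k; rewrite row0.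
apply/eqP; apply: contraT => /H; rewrite -row_mul mulmx_ker row0 mul0mx mxE ltxx.
by [].
Qed.

Definition frame_mx (e : 'I_3 -> E) : 'M[C]_(6, 3) := \matrix_(i, k) e k [set i]%SET.

(** Let F be the square matrix whose columns are the [th k] and their conjugates.
    Multiplying the coefficient matrix of omega by [J], which acts on the columns by
    [i] and [-i], turns it into [g = T Tb^T / 2 + Tb T^T / 2]. This says that
    F has an explicit right inverse; it is then a left inverse as well, which gives the
    pairings, while the right inverse gives the expansion. *)
Lemma unitary_frame_of_metric J g th :
  J *m J = - 1%:M -> g^T = g -> J *m g *m J^T = g ->
  (forall X : 'rV[R]_6, X != 0 -> 0 < (X *m g *m X^T) 0 0) ->
  (forall k, is_type10 J (th k)) ->
  fundamental_form J g = ('i / 2) *: \sum_k wedge (th k) (conj_ext (th k)) ->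
  unitary_frame J g th.
Proof.
move=> JJ gT JgJ pos t10 om.
have gU := posdef_unitmx pos.
have Jg_anti : (J *m g)^T = - (J *m g).
  have e : - (g *m J^T) = J *m g.
    by rewrite -[in RHS]JgJ !mulmxA JJ mulNmx mulNmx mul1mx.
  by rewrite trmx_mul gT -e opprK.
set T := frame_mx th; set Tb := frame_mx (fun k => conj_ext (th k)).
pose Jc : 'M[C]_6 := map_mx (real_complex R) J.
pose gc : 'M[C]_6 := map_mx (real_complex R) g.
have cth k : is_covector (th k) by case: (t10 k).
have JT : Jc *m T = 'i *: T.
  apply/matrixP => i k; rewrite !mxE.
  have <- : comp_acs J (th k) [set i]%SET = 'i * th k [set i]%SET :> C.
    by rewrite (t10 k).2 ffunE.
  by rewrite comp_acs_coef; apply: eq_bigr => j _; rewrite !mxE.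
have JTb : Jc *m Tb = - 'i *: Tb.
  apply/matrixP => i k; have := congr1 conjc (congr1 (fun M : 'M[C]_(6,3) => M i k) JT).
  rewrite !mxE conj_sum conjM conj_i conj_extE => <-; apply: eq_bigr => j _.
  by rewrite !mxE conjM conjc_real conj_extE.
have omE : map_mx (real_complex R) (J *m g) = ('i / 2) *: (T *m Tb^T - Tb *m T^T).
  apply/matrixP => i j.
  rewrite mxE -(fundamental_form_coef i j Jg_anti) om coef2Z coef2_sum !mxE -sumrB.
  congr (_ * _); apply: eq_bigr => k _; rewrite coef2_wedge //; last exact: conj_covector.
  by rewrite !mxE [X in _ - X]mulrC.
have gE : gc = 2^-1 *: (T *m Tb^T + Tb *m T^T).
  have : Jc *m map_mx (real_complex R) (J *m g) = - gc.
    by rewrite map_mxM mulmxA -map_mxM JJ map_mxN map_mx1 mulNmx mul1mx.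
  rewrite omE -scalemxAr mulmxBr !mulmxA JT JTb -!scalemxAl scaleNr opprK -scalerDr.
  rewrite scalerA mulrAC sqr_i mulN1r scaleNr => /(congr1 (fun M => - M)).
  by rewrite !opprK => ->.
pose F : 'M[C]_(6, 3 + 3) := row_mx T Tb.
pose F' : 'M[C]_(3 + 3, 6) := 2^-1 *: (col_mx Tb^T T^T *m map_mx (real_complex R) (invmx g)).
have FF' : F *m F' = 1%:M.
  rewrite -scalemxAr mulmxA mul_row_col scalemxAl -gE -map_mxM mulmxV //.
  exact: map_mx1.
have F'F : F' *m F = 1%:M by exact: mulmx1C.
have F'l k i : F' (lshift 3 k) i = 2^-1 * sharp g (th k) 0 i.
  rewrite !mxE; congr (_ * _); apply: eq_bigr => j _.
  by rewrite col_mxEu !mxE conj_extE.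
have F'r k i : F' (rshift 3 k) i = 2^-1 * sharp g (conj_ext (th k)) 0 i.
  rewrite !mxE; congr (_ * _); apply: eq_bigr => j _.
  by rewrite col_mxEd !mxE conj_extE conjcK.
have half2 (x y : C) : 2^-1 * x = y -> x = 2 * y.
  by move=> <-; rewrite mulrA mulfV ?mul1r // pnatr_eq0.
split => //.
- move=> k l; apply: half2; have := congr1 (fun M : 'M[C]_(3 + 3) => M (lshift 3 k) (lshift 3 l))
  F'F.
  rewrite !mxE (inj_eq (@lshift_inj _ _)) => <-.
  rewrite /pairing mulr_sumr; apply: eq_bigr => i _; rewrite F'l row_mxEl !mxE mulrA //.
- move=> k l; rewrite -[RHS](mulr0 2); apply: half2.
  have := congr1 (fun M : 'M[C]_(3 + 3) => M (lshift 3 k) (rshift 3 l)) F'F.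
  rewrite !mxE eq_lrshift => e; apply: etrans _ e.
  rewrite /pairing mulr_sumr; apply: eq_bigr => i _; rewrite F'l row_mxEr !mxE mulrA //.
- move=> i.
  have ccth k : is_covector (conj_ext (th k)) by exact: conj_covector.
  have S1 : \sum_k (2^-1 * sharp g (th k) 0 i) *: th k =
      \sum_j (\sum_k T j k * F' (lshift 3 k) i) *: (dx j : E).
    under [RHS]eq_bigr do rewrite scaler_suml.
    rewrite [RHS]exchange_big /=; apply: eq_bigr => k _.
    rewrite -F'l [th k in LHS](covectorE (cth k)) scaler_sumr; apply: eq_bigr => j _.
    by rewrite scalerA mulrC [T j k]mxE.
  have S2 : \sum_k (2^-1 * sharp g (conj_ext (th k)) 0 i) *: conj_ext (th k) =
      \sum_j (\sum_k Tb j k * F' (rshift 3 k) i) *: (dx j : E).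
    under [RHS]eq_bigr do rewrite scaler_suml.
    rewrite [RHS]exchange_big /=; apply: eq_bigr => k _.
    rewrite -F'r [conj_ext (th k) in LHS](covectorE (ccth k)) scaler_sumr; apply: eq_bigr => j _.
    by rewrite scalerA mulrC [Tb j k]mxE.
  rewrite S1 S2 -big_split /=.
  transitivity (\sum_j (F *m F') j i *: (dx j : E)).
    rewrite FF' (bigD1 i) //= big1 ?addr0 => [|j ji]; last by rewrite mxE (negbTE ji) scale0r.
    by rewrite mxE eqxx scale1r.
  apply: eq_bigr => j _; rewrite mxE big_split_ord /= scalerDl.
  have e1 : \sum_(k < 3) F j (lshift 3 k) * F' (lshift 3 k) i = \sum_k T j k * F' (lshift 3 k) i.
    by apply: eq_bigr => k _; rewrite row_mxEl.
  have e2 : \sum_(k < 3) F j (rshift 3 k) * F' (rshift 3 k) i = \sum_k Tb j k * F' (rshift 3 k) i.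
    by apply: eq_bigr => k _; rewrite row_mxEr.
  by rewrite e1 e2.
Qed.

End HermitianFrame.

(** * The derivation of bidegree (2,-1) *)
Section TwoForms.
Context {R : realType} {n : nat}.
Local Notation E := (ext R n).
Variable J : 'M[R]_n.
Implicit Types (a u v t : E).

(** Inductive descriptions by decomposable forms are used for the differentials of
    covectors, since type computations only need the decomposable case. *)
Inductive two_form : E -> Prop :=
| two_form0 : two_form 0
| two_formD a b : two_form a -> two_form b -> two_form (a + b)
| two_form_wedge u v : is_covector u -> is_covector v -> two_form (wedge u v).

Inductive form20 : E -> Prop :=
| form20_0 : form20 0
| form20D a b : form20 a -> form20 b -> form20 (a + b)
| form20_wedge u v : is_type10 J u -> is_type10 J v -> form20 (wedge u v).

Lemma form20_type_part0 q t a : form20 t -> type_part J 0 q (wedge t a) = 0.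
Proof.
elim=> [|x y _ Hx _ Hy|u v Hu Hv]; first by rewrite wedge0l type_part_0.
  by rewrite wedgeDl type_partD Hx Hy addr0.
by rewrite -wedgeA (type_part_wedge10 _ _ _ Hu) type_part_predE wedge0r.
Qed.

Lemma form20_type_part1 q t a : form20 t -> type_part J 1 q (wedge t a) = 0.
Proof.
elim=> [|x y _ Hx _ Hy|u v Hu Hv]; first by rewrite wedge0l type_part_0.
  by rewrite wedgeDl type_partD Hx Hy addr0.
by rewrite -wedgeA (type_part_wedge10 _ _ _ Hu) type_part_predE (type_part_wedge10 _ _ _ Hv)
  type_part_predE !wedge0r.
Qed.

Lemma form20_type_part p q t a : form20 t -> type_part J p.+2 q (wedge t a) = wedge t
  (type_part J p q a).
Proof.
elim=> [|x y _ Hx _ Hy|u v Hu Hv]; first by rewrite !wedge0l type_part_0.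
  by rewrite !wedgeDl type_partD Hx Hy.
by rewrite -!wedgeA (type_part_wedge10 _ _ _ Hu) type_part_predE (type_part_wedge10 _ _ _ Hv)
  type_part_predE.
Qed.

Lemma form20_commute u t a : is_covector u -> form20 t ->
  wedge u (wedge t a) = wedge t (wedge u a).
Proof.
move=> cu; elim=> [|x y _ Hx _ Hy|v w [cv _] [cw _]]; first by rewrite !wedge0l wedge0r.
  by rewrite !wedgeDl wedgeDr Hx Hy.
by rewrite -!wedgeA (wedge_anti _ cu cv) (wedge_anti _ cu cw) wedgeNr opprK.
Qed.

Lemma form20_contract x t a : (forall u, is_type10 J u -> pairing x u = 0) -> form20 t ->
  contract x (wedge t a) = wedge t (contract x a).
Proof.
move=> Hx; elim=> [|y z _ Hy _ Hz|v w Hv Hw]; first by rewrite !wedge0l contract0.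
  by rewrite !wedgeDl contractD Hy Hz.
have [cv _] := Hv; have [cw _] := Hw.
rewrite -!wedgeA (contract_wedge _ _ cv) (contract_wedge _ _ cw) !Hx // !scale0r !sub0r.
by rewrite wedgeNr opprK.
Qed.

Hypothesis JJ : J *m J = - 1%:M.

Lemma two_form_type_part20 t : two_form t -> form20 (type_part J 2 0 t).
Proof.
elim=> [|x y _ Hx _ Hy|u v cu cv]; first by rewrite type_part_0; exact: form20_0.
  by rewrite type_partD; exact: form20D.
rewrite -[v]wedge1r (type_part_wedge_covector _ _ _ _ cu) !type_part_predE wedge0r addr0
  (type_part_wedge_covector _ _ _ _ cv) !type_part_predE wedge0r addr0.
rewrite type_part_ext1 /= wedge1r; apply: form20_wedge; exact: proj10_is_type10.
Qed.

Lemma type_part_wedge_covector_high p p' q q' u a : is_covector u -> (p'.+1 < p)%N ->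
  type_part J p q (wedge u (type_part J p' q' a)) = 0.
Proof.
case: p => // p cu pp; rewrite (type_part_wedge_covector _ _ _ _ cu) type_part_predE
  (type_part_type_part JJ).
rewrite (_ : (p == p') = false) ?wedge0r ?add0r; last by rewrite gtn_eqF.
case: q => [|q]; rewrite type_part_predE ?wedge0r // (type_part_type_part JJ).
by rewrite (_ : (p.+1 == p') = false) ?wedge0r // gtn_eqF // ltnW.
Qed.

Lemma two_form_type_part_high p q q' t a : two_form t ->
  type_part J p.+3 q (wedge t (type_part J p q' a)) = 0.
Proof.
elim=> [|x y _ Hx _ Hy|u v cu cv]; first by rewrite wedge0l type_part_0.
  by rewrite wedgeDl type_partD Hx Hy addr0.
rewrite -wedgeA (type_part_wedge_covector _ _ _ _ cu) type_part_predE
  type_part_wedge_covector_high // wedge0r add0r.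
by case: q => [|q]; rewrite type_part_predE ?type_part_wedge_covector_high ?wedge0r.
Qed.

(** A two-form raises the first degree by at most two, and by exactly two only
    through its (2,0)-part. *)
Lemma two_form_type_part p q t a : two_form t ->
  type_part J p.+2 q (wedge t (type_part J p q a)) = wedge (type_part J 2 0 t) (type_part J p q a).
Proof.
elim=> [|x y _ Hx _ Hy|u v cu cv]; first by rewrite !(wedge0l, type_part_0).
  by rewrite wedgeDl type_partD Hx Hy type_partD wedgeDl.
rewrite -wedgeA (type_part_wedge_covector _ _ _ _ cu) type_part_predE
  (type_part_wedge_covector _ _ _ _ cv) type_part_predE (type_part_type_part JJ) !eqxx /=.
have -> : type_part_pred01 J p.+2 q (wedge v (type_part J p q a)) = 0.
  by case: q => [|q]; rewrite type_part_predE ?type_part_wedge_covector_high.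
have -> : type_part_pred01 J p.+1 q (type_part J p q a) = 0.
  by case: q => [|q]; rewrite type_part_predE // (type_part_type_part JJ) gtn_eqF.
rewrite !wedge0r !addr0 wedgeA; congr (wedge _ _).
rewrite -[in RHS](wedge1r v) (type_part_wedge_covector _ _ _ _ cu) !type_part_predE wedge0r addr0
  (type_part_wedge_covector _ _ _ _ cv) !type_part_predE.
by rewrite wedge0r addr0 type_part_ext1 /= wedge1r.
Qed.

End TwoForms.

(** When [vb] is twice dual to the [tb k] and vanishes on the [th k], and the [m k] are
    even, this is the derivation that kills each [th k] and maps [tb k] to [m k]. *)
HB.lock Definition deriv20 {R : realType} {n : nat} (vb : 'I_3 -> 'rV[R[i]]_n) (m : 'I_3 -> ext R n)
  (a : ext R n) : ext R n := \sum_k wedge (m k) (2^-1 *: contract (vb k) a).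

Section Frames.
Context {R : realType}.
Local Notation C := R[i].
Local Notation E := (ext R 6).
Local Notation rV := 'rV[R]_6.

(** Types and pairings of a coframe and of its metric duals, without the metric. The
    metric dual of [th k] is twice the vector dual to [th k] because of the length of
    the covectors. *)
Record adapted_frame (J : 'M[R]_6) (th tb : 'I_3 -> E) (va vb : 'I_3 -> 'rV[C]_6) : Prop :=
  AdaptedFrame {
  af_JJ : J *m J = - 1%:M;
  af_type10 : forall k, is_type10 J (th k);
  af_type01 : forall k, is_type01 J (tb k);
  af_a_th : forall k l, pairing (va k) (th l) = 2 * (k == l)%:R;
  af_a_tb : forall k l, pairing (va k) (tb l) = 0;
  af_b_th : forall k l, pairing (vb k) (th l) = 0;
  af_b_tb : forall k l, pairing (vb k) (tb l) = 2 * (k == l)%:R;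
  af_span : forall i, dx i =
    \sum_k (2^-1 * va k 0 i) *: th k + \sum_k (2^-1 * vb k 0 i) *: tb k }.

Lemma adapted_frame_of_unitary J g th : unitary_frame J g th ->
  adapted_frame J th (fun k => conj_ext (th k)) (fun k => sharp g (th k))
    (fun k => sharp g (conj_ext (th k))).
Proof.
move=> H; split.
- exact: uf_JJ H.
- exact: uf_type10 H.
- by move=> k; apply/conj_type10/(uf_type10 H).
- exact: uf_dual H.
- exact: uf_dual0 H.
- by move=> k l; rewrite sharp_conj -[th l]conj_extK pairing_conj (uf_dual0 H) conj0.
- move=> k l; rewrite sharp_conj pairing_conj (uf_dual H) conjM.
  by rewrite (rmorph_nat (@conjc R)) (rmorph_nat (@conjc R)).
- exact: uf_span H.
Qed.

Section Pointwise.
Variables (J : 'M[R]_6) (th tb : 'I_3 -> E) (va vb : 'I_3 -> 'rV[C]_6).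
Hypothesis H : adapted_frame J th tb va vb.

Lemma covector_th k : is_covector (th k). Proof. by have [] := af_type10 H k. Qed.
Lemma covector_tb k : is_covector (tb k). Proof. by have [] := af_type01 H k. Qed.

(** Induction over products of coframe elements, in place of products of the [dx i]. *)
Lemma frame_ind (P : E -> Prop) :
  (forall a b, P a -> P b -> P (a + b)) -> (forall k a, P a -> P (k *: a)) ->
  P ext1 -> (forall k a, P a -> P (wedge (th k) a)) ->
  (forall k a, P a -> P (wedge (tb k) a)) -> forall a, P a.
Proof.
move=> PD PZ P1 Pt Pb; have P0 : P 0 by rewrite -(scale0r (ext1 : E)); exact: PZ.
apply: ext_ind => // i a Pa; rewrite (af_span H) wedgeDl !wedge_suml.
have Psum (F : 'I_3 -> E) : (forall k, P (F k)) -> P (\sum_k F k).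
  by move=> HF; elim/big_ind: _.
by apply: PD; apply: Psum => k; rewrite wedgeZl; apply: PZ; [exact: Pt|exact: Pb].
Qed.

Lemma proj10_sum (r : seq 'I_3) (F : 'I_3 -> E) :
  proj10 J (\sum_(i <- r) F i) = \sum_(i <- r) proj10 J (F i).
Proof. by rewrite (big_morph _ (proj10D J) (proj10_0 J)). Qed.

Lemma pairing_vb_type10 k u : is_type10 J u -> pairing (vb k) u = 0.
Proof.
move=> Hu; have [cu _] := Hu; rewrite -(proj10_type10 Hu).
elim/(@covector_ind R 6): u / cu {Hu} => [x y Hx Hy|l x Hx|i|].
- by rewrite proj10D pairingD Hx Hy addr0.
- by rewrite proj10Z pairingZ Hx mulr0.
- rewrite (af_span H) proj10D !proj10_sum pairingD !pairing_sum big1 ?add0r => [|l _]; last first.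
    by rewrite proj10Z (proj10_type10 (af_type10 H l)) pairingZ (af_b_th H) mulr0.
  by rewrite big1 // => l _; rewrite proj10Z (proj10_type01 (af_type01 H l)) scaler0 pairing0.
- by rewrite proj10_0 pairing0.
Qed.

Lemma contract_b_form20 k t a : form20 J t -> contract (vb k) (wedge t a) = wedge t
  (contract (vb k) a).
Proof. by apply: form20_contract => u; exact: pairing_vb_type10. Qed.

Variable m : 'I_3 -> E.
Hypothesis Hm : forall k, form20 J (m k).

Lemma deriv20E a : deriv20 vb m a = \sum_k wedge (m k) (2^-1 *: contract (vb k) a).
Proof. by rewrite deriv20.unlock. Qed.

Lemma deriv20D a b : deriv20 vb m (a + b) = deriv20 vb m a + deriv20 vb m b.
Proof.
rewrite !deriv20E -big_split; apply: eq_bigr => k _.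
by rewrite contractD scalerDr wedgeDr.
Qed.
Lemma deriv20Z l a : deriv20 vb m (l *: a) = l *: deriv20 vb m a.
Proof.
rewrite !deriv20E scaler_sumr; apply: eq_bigr => k _.
by rewrite contractZ !wedgeZr !scalerA mulrC.
Qed.
Lemma deriv20_1 : deriv20 vb m ext1 = 0.
Proof. by rewrite !deriv20E big1 // => k _; rewrite contract1 scaler0 wedge0r. Qed.
Lemma deriv20_th k a : deriv20 vb m (wedge (th k) a) = - wedge (th k) (deriv20 vb m a).
Proof.
rewrite !deriv20E wedge_sumr -sumrN; apply: eq_bigr => l _.
rewrite (contract_wedge _ _ (covector_th k)) (af_b_th H) scale0r sub0r scalerN wedgeNr.
by rewrite -wedgeZr (form20_commute _ (covector_th k) (Hm l)).
Qed.
Lemma deriv20_tb k a :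
  deriv20 vb m (wedge (tb k) a) = wedge (m k) a - wedge (tb k) (deriv20 vb m a).
Proof.
have -> : wedge (m k) a = \sum_l (l == k)%:R *: wedge (m l) a.
  rewrite (bigD1 k) //= eqxx scale1r big1 ?addr0 // => l /negbTE ->.
  by rewrite scale0r.
rewrite !deriv20E wedge_sumr -sumrB; apply: eq_bigr => l _.
rewrite (contract_wedge _ _ (covector_tb k)) (af_b_tb H) scalerBr wedgeDr wedgeNr; congr (_ - _).
  by rewrite scalerA mulrA mulVf ?mul1r ?wedgeZr // pnatr_eq0.
by rewrite -wedgeZr (form20_commute _ (covector_tb k) (Hm l)).
Qed.
Lemma type_part0_deriv20 q a : type_part J 0 q (deriv20 vb m a) = 0.
Proof. by rewrite !deriv20E type_part_sum big1 // => k _; apply: form20_type_part0. Qed.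
Lemma type_part1_deriv20 q a : type_part J 1 q (deriv20 vb m a) = 0.
Proof. by rewrite !deriv20E type_part_sum big1 // => k _; apply: form20_type_part1. Qed.

End Pointwise.
End Frames.

(** * Three-dimensional coframes *)
Lemma wedge_anti2 {R : realType} {n : nat} (u v : ext R n) :
  is_covector u -> is_covector v -> wedge u v = - wedge v u.
Proof. by move=> cu cv; rewrite -{1}[v]wedge1r wedge_anti // wedge1r. Qed.

Section ThreeIndices.
Context {R : realType}.
Local Notation C := R[i].
Local Notation E := (ext R 6).
Variables (J : 'M[R]_6) (th tb : 'I_3 -> E) (va vb : 'I_3 -> 'rV[C]_6).
Hypothesis H : adapted_frame J th tb va vb.

Definition vol3 (e : 'I_3 -> E) : E := wedge (e 0) (wedge (e 1) (e 2)).

Lemma contract_tb k l a : contract (vb k) (wedge (tb l) a) = (2 * (k == l)%:R) *: a - wedge (tb l)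
  (contract (vb k) a).
Proof. by rewrite (contract_wedge _ _ (covector_tb H l)) (af_b_tb H). Qed.

Lemma contract_tb1 k l : contract (vb k) (tb l) = (2 * (k == l)%:R) *: ext1.
Proof. by rewrite -{1}[tb l]wedge1r contract_tb contract1 wedge0r subr0. Qed.

Lemma I3_cases (P : 'I_3 -> Prop) : P 0 -> P 1 -> P 2 -> forall k, P k.
Proof.
move=> P0 P1 P2 [[|[|[|//]]] Hk].
- by rewrite (_ : Ordinal Hk = 0) //; apply: val_inj.
- by rewrite (_ : Ordinal Hk = 1) //; apply: val_inj.
- by rewrite (_ : Ordinal Hk = 2) //; apply: val_inj.
Qed.

Lemma half_two (x : E) : 2^-1 *: (2 *: x) = x.
Proof. by rewrite scalerA mulVf ?scale1r // pnatr_eq0. Qed.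

(** Indices are taken modulo three, so that cyclic permutations are translations. *)
Lemma I3_add : (((0 + 1)%R = 1%R :> 'I_3) * ((0 + 2)%R = 2%R :> 'I_3) *
  ((1 + 1)%R = 2%R :> 'I_3) * ((1 + 2)%R = 0%R :> 'I_3) *
  ((2 + 1)%R = 0%R :> 'I_3) * ((2 + 2)%R = 1%R :> 'I_3))%type.
Proof. by do !split; apply: val_inj. Qed.

Lemma I3_eq : ((((0 : 'I_3) == 1)%R = false) * (((0 : 'I_3) == 2)%R = false) *
  (((1 : 'I_3) == 0)%R = false) * (((1 : 'I_3) == 2)%R = false) *
  (((2 : 'I_3) == 0)%R = false) * (((2 : 'I_3) == 1)%R = false))%type.
Proof. by do !split. Qed.

Lemma half_contract_vol3 k : 2^-1 *: contract (vb k) (vol3 tb) = wedge (tb (k + 1)) (tb (k + 2)).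
Proof.
have ctb := covector_tb H; rewrite /vol3 !contract_tb contract_tb1.
elim/I3_cases: k; rewrite !I3_eq !I3_add !eqxx /=
  !(mulr0, mulr1, scale0r, wedge0r, sub0r, subr0, oppr0).
- exact: half_two.
- by rewrite wedgeZr scalerN half_two (wedge_anti2 (ctb 0) (ctb 2)) opprK.
- by rewrite wedgeNr opprK !wedgeZr half_two wedge1r.
Qed.

Lemma contract2_tb a b j k : contract (vb b) (contract (vb a) (wedge (tb j) (tb k))) =
  (4 * ((a == j)%:R * (b == k)%:R - (a == k)%:R * (b == j)%:R)) *: ext1.
Proof.
rewrite contract_tb contract_tb1 [contract _ (_ - _)]linearB /= wedgeZr wedge1r !contractZ
  !contract_tb1 !scalerA -scalerBl.
congr (_ *: _); ring.
Qed.

(** The derivation sends [vol3 tb] to the sum of the [m l /\ tb (l + 1) /\ tb (l + 2)], and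
    contractions with the duals of [tb] commute with the (2,0)-forms [m l]; so each
    [m k] can be read off, with a factor 2 for each of the two contractions. *)
Lemma deriv20_vol3_inj (m : 'I_3 -> E) k : (forall k, form20 J (m k)) ->
  contract (vb (k + 2)) (contract (vb (k + 1)) (deriv20 vb m (vol3 tb))) = 4 *: m k.
Proof.
move=> Hm; rewrite deriv20E !contract_sum (bigD1 k) //= big1 ?addr0 => [|l lk].
  rewrite half_contract_vol3 !(contract_b_form20 H _ _ (Hm k)) contract2_tb !eqxx.
  have -> : (k + 1 == k + 2) = false by elim/I3_cases: k.
  by rewrite mul0r subr0 !mulr1 wedgeZr wedge1r.
rewrite half_contract_vol3 !(contract_b_form20 H _ _ (Hm l)) contract2_tb.
have -> : (k + 1 == l + 1) = false by rewrite (inj_eq (addIr 1)) eq_sym (negbTE lk).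
rewrite mul0r sub0r.
have -> : (k + 1 == l + 2)%:R * (k + 2 == l + 1)%:R = 0 :> C.
  by elim/I3_cases: k {lk} => //; elim/I3_cases: l; rewrite ?mulr0 ?mul0r.
by rewrite oppr0 mulr0 scale0r wedge0r.
Qed.

Lemma contract_th k l a : contract (vb k) (wedge (th l) a) = - wedge (th l) (contract (vb k) a).
Proof. by rewrite (contract_wedge _ _ (covector_th H l)) (af_b_th H) scale0r sub0r. Qed.

Definition omega_frame : E := ('i / 2) *: \sum_k wedge (th k) (tb k).

Lemma omega_frame_sqr : wedge omega_frame omega_frame =
  4^-1 *: \sum_j \sum_k wedge (wedge (th j) (th k)) (wedge (tb j) (tb k)).
Proof.
rewrite /omega_frame wedgeZl wedgeZr scalerA wedge_suml scaler_sumr scaler_sumr.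
apply: eq_bigr => j _; rewrite wedge_sumr !scaler_sumr; apply: eq_bigr => k _.
rewrite -!wedgeA (wedge_anti _ (covector_tb H j) (covector_th H k)) wedgeNr scalerN -scaleNr.
congr (_ *: _).
rewrite mulrACA sqr_i mulN1r opprK -invfM; congr (_^-1); ring.
Qed.

Lemma sum_delta_pair (a b : 'I_3) (F : 'I_3 -> 'I_3 -> E) :
  \sum_i \sum_j ((a == i)%:R * (b == j)%:R : C) *: F i j = F a b.
Proof.
rewrite (bigD1 a) //= [X in _ + X]big1 ?addr0 => [|i /negbTE ia]; last first.
  by rewrite big1 // => j _; rewrite eq_sym ia mul0r scale0r.
rewrite (bigD1 b) //= [X in _ + X]big1 ?addr0 => [|j /negbTE jb]; last first.
  by rewrite [b == j]eq_sym jb mulr0 scale0r.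
by rewrite !eqxx mulr1 scale1r.
Qed.

Lemma contract2_omega_sqr k :
  contract (vb (k + 2)) (contract (vb (k + 1)) (wedge omega_frame omega_frame)) =
  2 *: wedge (th (k + 1)) (th (k + 2)).
Proof.
set a := k + 1; set b := k + 2.
rewrite omega_frame_sqr !contractZ !contract_sum.
have e i j : contract (vb b) (contract (vb a) (wedge (wedge (th i) (th j)) (wedge (tb i) (tb j)))) =
    (4 * ((a == i)%:R * (b == j)%:R - (a == j)%:R * (b == i)%:R)) *: wedge (th i) (th j).
  by rewrite -wedgeA !contract_th wedgeNr opprK !contract_th wedgeNr opprK contract2_tb !wedgeZr
    wedge1r.
transitivity (4^-1 *: (4 *: wedge (th a) (th b) + 4 *: wedge (th a) (th b))); last first.
  by rewrite -scalerDr scalerA mulVf ?scale1r ?pnatr_eq0 // -mulr2n scaler_nat.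
congr (_ *: _).
transitivity (4 *: (wedge (th a) (th b) - wedge (th b) (th a))); last first.
  by rewrite (wedge_anti2 (covector_th H b) (covector_th H a)) opprK scalerDr.
rewrite -(sum_delta_pair a b (fun i j => wedge (th i) (th j))).
rewrite -(sum_delta_pair b a (fun i j => wedge (th i) (th j))) -sumrB scaler_sumr.
apply: eq_bigr => i _; rewrite contract_sum contract_sum -sumrB scaler_sumr; apply: eq_bigr => j _.
by rewrite e -scalerBl scalerA [X in _ - X]mulrC.
Qed.
End ThreeIndices.

(** * The commutator identities at a point *)
Section Anticommutation.
Context {R : realType}.
Local Notation C := R[i].
Local Notation E := (ext R 6).
Variables (e f : 'I_3 -> E) (x : 'I_3 -> 'rV[C]_6).
Hypothesis ce : forall k, is_covector (e k).
Hypothesis cf : forall k, is_covector (f k).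
Hypothesis xe : forall k l, pairing (x k) (e l) = 2 * (k == l)%:R.
Hypothesis xf : forall k l, pairing (x k) (f l) = 0.

Lemma wedge_omega_frame b : wedge (omega_frame e f) b = ('i / 2) *: \sum_k wedge (e k)
  (wedge (f k) b).
Proof.
rewrite /omega_frame wedgeZl wedge_suml; congr (_ *: _).
by apply: eq_bigr => k _; rewrite wedgeA.
Qed.

(** Moving a contraction past omega leaves the contraction of omega itself, which is
    a multiple of [f l] because the vector [x l] is dual to [e l] and kills the [f k]. *)
Lemma wedge_omega_contract l b :
  wedge (omega_frame e f) (contract (x l) b) =
  contract (x l) (wedge (omega_frame e f) b) - 'i *: wedge (f l) b.
Proof.
rewrite !wedge_omega_frame contractZ contract_sum.
have ek k : contract (x l) (wedge (e k) (wedge (f k) b)) =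
    (2 * (l == k)%:R) *: wedge (f k) b + wedge (e k) (wedge (f k) (contract (x l) b)).
  by rewrite contract_wedge // contract_wedge // xe xf scale0r sub0r wedgeNr opprK.
under [in RHS]eq_bigr do rewrite ek.
have S : \sum_k (2 * (l == k)%:R) *: wedge (f k) b = 2 *: wedge (f l) b.
  rewrite (bigD1 l) //= eqxx mulr1 big1 ?addr0 => [//|k kl].
  by rewrite eq_sym (negbTE kl) mulr0 scale0r.
by rewrite big_split S scalerDr scalerA divfK ?pnatr_eq0 // [X in X - _]addrC addrK.
Qed.

Lemma wedge_omega_f l b :
  wedge (omega_frame e f) (wedge (f l) b) = wedge (f l) (wedge (omega_frame e f) b).
Proof.
rewrite !wedge_omega_frame wedgeZr wedge_sumr; congr (_ *: _); apply: eq_bigr => k _.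
by rewrite (wedge_anti _ (cf l) (ce k)) (wedge_anti _ (cf l) (cf k)) wedgeNr opprK.
Qed.

(** Up to a scalar, the adjoint of N or of its conjugate. *)
Definition lower_pair b : E := \sum_k wedge (f k) (contract (x (k + 2)) (contract (x (k + 1)) b)).

(** Omega commutes with [f k] and produces one term for each of the two contractions.
    Cyclic relabelling of the indices makes the two sums equal up to the sign of
    exchanging two covectors. *)
Lemma omega_lower_pair b :
  wedge (omega_frame e f) (lower_pair b) - lower_pair (wedge (omega_frame e f) b) =
  (2 * 'i) *: \sum_k wedge (f (k + 1)) (wedge (f (k + 2)) (contract (x k) b)).
Proof.
rewrite /lower_pair wedge_sumr -sumrB.
have ek k : wedge (omega_frame e f) (wedge (f k) (contract (x (k + 2)) (contract (x (k + 1)) b))) -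
      wedge (f k) (contract (x (k + 2)) (contract (x (k + 1)) (wedge (omega_frame e f) b))) =
    'i *: (wedge (f k) (wedge (f (k + 1)) (contract (x (k + 2)) b)) -
           wedge (f k) (wedge (f (k + 2)) (contract (x (k + 1)) b))).
  have s2 : wedge (omega_frame e f) (contract (x (k + 2)) (contract (x (k + 1)) b)) =
      contract (x (k + 2)) (contract (x (k + 1)) (wedge (omega_frame e f) b)) +
      'i *: (wedge (f (k + 1)) (contract (x (k + 2)) b) - wedge (f (k + 2))
        (contract (x (k + 1)) b)).
    rewrite (wedge_omega_contract (k + 2)) (wedge_omega_contract (k + 1)) contractD contractN
      contractZ.
    by rewrite (contract_wedge _ _ (cf (k + 1))) xf scale0r sub0r scalerN opprK scalerBr [RHS]addrA.
  by rewrite wedge_omega_f s2 wedgeDr [X in X - _]addrC addrK wedgeZr wedgeDr wedgeNr.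
rewrite (eq_bigr _ (fun k _ => ek k)) -scaler_sumr sumrB.
have e1 : \sum_k wedge (f k) (wedge (f (k + 1)) (contract (x (k + 2)) b)) =
    \sum_k wedge (f (k + 1)) (wedge (f (k + 2)) (contract (x k) b)).
  rewrite (reindex_inj (@addIr 'I_3 1)); apply: eq_bigr => k _.
  have -> : k + 1 + 1 = k + 2 by rewrite -addrA I3_add.
  by have -> : k + 1 + 2 = k by rewrite -addrA I3_add addr0.
have e2 : \sum_k wedge (f k) (wedge (f (k + 2)) (contract (x (k + 1)) b)) =
    - \sum_k wedge (f (k + 1)) (wedge (f (k + 2)) (contract (x k) b)).
  rewrite (reindex_inj (@addIr 'I_3 2)) -sumrN; apply: eq_bigr => k _.
  have -> : k + 2 + 2 = k + 1 by rewrite -addrA I3_add.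
  have -> : k + 2 + 1 = k by rewrite -addrA I3_add addr0.
  by rewrite wedge_anti.
rewrite e1 e2 opprK mulrC -[RHS]scalerA; congr (_ *: _).
by rewrite -mulr2n scaler_nat.
Qed.

End Anticommutation.

Section PointwiseOperators.
Context {R : realType}.
Local Notation C := R[i].
Local Notation E := (ext R 6).
Variables (J g : 'M[R]_6) (th : 'I_3 -> E) (lam : R).
Hypothesis Hf : unitary_frame J g th.
Let tb k := conj_ext (th k).
Let va k := sharp g (th k).
Let vb k := sharp g (tb k).
Let Ht : adapted_frame J th tb va vb := adapted_frame_of_unitary Hf.

Definition L_op b : E := wedge (omega_frame th tb) b.
(** The values at one point of N, of its conjugate, of L and of their adjoints, written in
    a unitary coframe; [lam] is the constant of the structure equations. *)
Definition N_op b : E :=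
  deriv20 vb (fun k => ('i * lam%:C) *: wedge (th (k + 1)) (th (k + 2))) b.
Definition Nbar_op b : E :=
  deriv20 va (fun k => (- ('i * lam%:C)) *: wedge (tb (k + 1)) (tb (k + 2))) b.
Definition Nstar_op b : E := (- ('i * lam%:C) / 2) *: lower_pair tb va b.
Definition Nbarstar_op b : E := ('i * lam%:C / 2) *: lower_pair th vb b.
Definition Lambda_op b : E := (- 'i / 2) *: \sum_k contract (vb k) (contract (va k) b).

Lemma N_opE b : N_op b =
  ('i * lam%:C / 2) *: \sum_k wedge (th (k + 1)) (wedge (th (k + 2)) (contract (vb k) b)).
Proof.
rewrite /N_op deriv20.unlock scaler_sumr; apply: eq_bigr => k _.
by rewrite wedgeZl wedgeZr scalerA wedgeA.
Qed.

Lemma Nbar_opE b : Nbar_op b =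
  (- ('i * lam%:C) / 2) *: \sum_k wedge (tb (k + 1)) (wedge (tb (k + 2)) (contract (va k) b)).
Proof.
rewrite /Nbar_op deriv20.unlock scaler_sumr; apply: eq_bigr => k _.
by rewrite wedgeZl wedgeZr scalerA wedgeA.
Qed.

Definition adjoint_pair (F G : E -> E) := forall a b, hprod g (F a) b = hprod g a (G b).

Lemma adjoint_pair_sym F G : adjoint_pair F G -> adjoint_pair G F.
Proof.
move=> FG a b; rewrite (hprod_sym (uf_sym Hf) b) -FG.
by rewrite -(hprod_sym (uf_sym Hf)).
Qed.

Lemma hprod_suml (F : 'I_3 -> E) b : hprod g (\sum_k F k) b = \sum_k hprod g (F k) b.
Proof. by rewrite (big_morph (fun a => hprod g a b) (fun a c => hprodDl g a c b) (hprod0l g b)).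
  Qed.
Lemma hprod_sumr (F : 'I_3 -> E) b : hprod g b (\sum_k F k) = \sum_k hprod g b (F k).
Proof. by rewrite (big_morph _ (hprodDr g b) (hprod0r g b)). Qed.

Lemma conj_coef (k : C) : conjc (k / 2) = conjc k / 2.
Proof. by rewrite conjM conj_half. Qed.

Lemma conj_ilam : conjc ('i * lam%:C) = - ('i * lam%:C).
Proof. by rewrite conjM conj_i conjc_real mulNr. Qed.

Lemma adjoint_N : adjoint_pair N_op Nstar_op.
Proof.
move=> a b; rewrite N_opE /Nstar_op /lower_pair hprodZl hprodZr conj_coef conjN conj_ilam opprK.
rewrite hprod_suml hprod_sumr; congr (_ * _); apply: eq_bigr => k _.
rewrite (hprod_wedge _ _ _ (covector_th Ht _)) (hprod_wedge _ _ _ (covector_th Ht _)).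
by rewrite (hprod_contract (uf_sym Hf) _ _ (covector_tb Ht k)).
Qed.

Lemma adjoint_Nbar : adjoint_pair Nbar_op Nbarstar_op.
Proof.
move=> a b; rewrite Nbar_opE /Nbarstar_op /lower_pair hprodZl hprodZr conj_coef conj_ilam.
rewrite hprod_suml hprod_sumr; congr (_ * _); apply: eq_bigr => k _.
rewrite (hprod_wedge _ _ _ (covector_tb Ht _)) (hprod_wedge _ _ _ (covector_tb Ht _)).
by rewrite (hprod_contract (uf_sym Hf) _ _ (covector_th Ht k)).
Qed.

Lemma adjoint_L : adjoint_pair L_op Lambda_op.
Proof.
move=> a b; rewrite /L_op wedge_omega_frame /Lambda_op hprodZl hprodZr conj_coef conjN conj_i opprK.
rewrite hprod_suml hprod_sumr; congr (_ * _); apply: eq_bigr => k _.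
by rewrite (hprod_wedge _ _ _ (covector_th Ht _)) (hprod_wedge _ _ _ (covector_tb Ht _)).
Qed.

Lemma L_Nstar b : L_op (Nstar_op b) - Nstar_op (L_op b) = (2 * 'i) *: Nbar_op b.
Proof.
rewrite /L_op /Nstar_op wedgeZr -scalerBr.
rewrite (omega_lower_pair (covector_th Ht) (covector_tb Ht) (af_a_th Ht) (af_a_tb Ht)).
by rewrite Nbar_opE !scalerA mulrC.
Qed.

Lemma omega_frame_swap : omega_frame tb th = - omega_frame th tb.
Proof.
rewrite /omega_frame -scalerN -sumrN; congr (_ *: _); apply: eq_bigr => k _.
exact: wedge_anti2 (covector_tb Ht k) (covector_th Ht k).
Qed.

(** The roles of [th] and its conjugate are exchanged, which changes the sign of omega. *)
Lemma L_Nbarstar b : L_op (Nbarstar_op b) - Nbarstar_op (L_op b) = (- (2 * 'i)) *: N_op b.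
Proof.
have := omega_lower_pair (covector_tb Ht) (covector_th Ht) (af_b_tb Ht) (af_b_th Ht) b.
rewrite omega_frame_swap !wedgeNl /lower_pair.
under [X in _ - X]eq_bigr do rewrite !contractN wedgeNr.
rewrite sumrN opprK addrC => e.
rewrite /L_op /Nbarstar_op wedgeZr -scalerBr -opprB e N_opE.
by rewrite scalerN -scaleNr !scalerA mulNr -mulrN mulrC mulNr.
Qed.

Lemma hprod_inj a b : (forall c, hprod g c a = hprod g c b) -> a = b.
Proof.
move=> H; apply/eqP; rewrite -subr_eq0; apply/eqP.
apply: (hprod_nondegenerate (uf_unit Hf)) => c.
by rewrite hprodDr hprodNr H subrr.
Qed.

Lemma conj_2i : conjc (2 * 'i) = - (2 * 'i) :> C.
Proof. by rewrite conjM conj_i (rmorph_nat (@conjc R)) mulrN. Qed.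

(** Taking adjoints reverses products, so a commutator identity for one pair of operators
    becomes one for their adjoints, with the conjugate scalar and the opposite sign. *)
Lemma commutator_adjoint (L L' G G' K K' : E -> E) (z : C) :
  adjoint_pair L L' -> adjoint_pair G G' -> adjoint_pair K K' ->
  (forall b, L (G' b) - G' (L b) = z *: K b) ->
  forall b, L' (G b) - G (L' b) = (- conjc z) *: K' b.
Proof.
move=> HL HG HK H b; apply: hprod_inj => c; have HG' := adjoint_pair_sym HG.
rewrite hprodDr hprodNr -HL -HG' -HG' -HL hprodZr conjN conjcK mulNr -HK -hprodZl -H.
by rewrite hprodDl hprodNl opprB.
Qed.

Lemma Lambda_N b : Lambda_op (N_op b) - N_op (Lambda_op b) = (2 * 'i) *: Nbarstar_op b.
Proof.
rewrite (commutator_adjoint adjoint_L adjoint_N adjoint_Nbar L_Nstar).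
by rewrite conj_2i opprK.
Qed.

Lemma Lambda_Nbar b : Lambda_op (Nbar_op b) - Nbar_op (Lambda_op b) = (- (2 * 'i)) *: Nstar_op b.
Proof.
rewrite (commutator_adjoint adjoint_L adjoint_Nbar adjoint_N L_Nbarstar).
by rewrite conjN conj_2i opprK.
Qed.

End PointwiseOperators.

Local Open Scope classical_set_scope.
Local Open Scope ring_scope.
Local Open Scope complex_scope.

(** * Calculus of smooth functions *)
Section RealSmooth.
Context {R : realType} {n : nat}.
Implicit Types (V W : set 'rV[R]_n) (f g : 'rV[R]_n -> R) (i : 'I_n).

Lemma Ck_sub k V W f : W `<=` V -> Ck k V f -> Ck k W f.
Proof.
move=> WV; elim: k f => [|k IH] f [cf] /=; first by split => // x /WV/cf.
move=> df; split => [x /WV/cf //|i]; have [df1 df2] := df i.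
by split => [x /WV/df1 //|]; exact: IH.
Qed.

Lemma open_near V x : open V -> V x -> \forall y \near x, V y.
Proof. by move=> oV Vx; apply: open_nbhs_nbhs. Qed.

Lemma continuous_eq V f g x : open V -> V x -> (forall x, V x -> f x = g x) ->
  {for x, continuous f} -> {for x, continuous g}.
Proof.
move=> oV Vx fg cf; suff : g @ x --> g x by [].
rewrite -(fg x Vx); apply: cvg_trans (cf : f @ x --> f x).
by apply: (@near_eq_cvg _ _ (nbhs x) _ f g); near=> y; apply: fg; near: y; exact: open_near.
Unshelve. all: by end_near. Qed.

Lemma Ck_eq k V f g : open V -> (forall x, V x -> f x = g x) -> Ck k V f -> Ck k V g.
Proof.
move=> oV; elim: k f g => [|k IH] f g fg [cf df].
  by split => // x Vx; apply: (continuous_eq oV Vx fg); exact: cf.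
split => [x Vx|i]; first by apply: (continuous_eq oV Vx fg); exact: cf.
have [df1 df2] := df i; split => [x Vx|].
  apply: near_eq_derivable (df1 x Vx).
  by near=> y; apply: fg; near: y; exact: open_near.
apply: IH df2 => x Vx; apply: near_eq_derive.
by near=> y; apply: fg; near: y; exact: open_near.
Unshelve. all: by end_near. Qed.

Lemma CkW k V f : Ck k.+1 V f -> Ck k V f.
Proof.
elim: k f => [|k IH] f [cf df]; first by split.
by split => // i; have [df1 df2] := df i; split => //; exact: IH.
Qed.

Lemma Ck_cst k V (r : R) : Ck k V (fun=> r).
Proof.
elim: k r => [|k IH] r; first by split => // x _; exact: cst_continuous.
split => [x _|i]; first exact: cst_continuous.
split => [x _|]; first exact: derivable_cst.
have -> : 'D_(delta_mx 0 i) (fun=> r) = (fun=> 0) :> ('rV[R]_n -> R).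
  by apply/funext => x; exact: derive_cst.
exact: IH.
Qed.

Lemma CkD k V f g : open V -> Ck k V f -> Ck k V g -> Ck k V (fun x => f x + g x).
Proof.
move=> oV; elim: k f g => [|k IH] f g [cf df] [cg dg].
  by split => // x Vx; apply: (@continuousD _ _ _ f g x); [exact: cf|exact: cg].
split => [x Vx|i]; first by apply: (@continuousD _ _ _ f g x); [exact: cf|exact: cg].
have [df1 df2] := df i; have [dg1 dg2] := dg i.
split => [x Vx|]; first by apply: derivableD; [exact: df1|exact: dg1].
apply: Ck_eq (IH _ _ df2 dg2) => // x Vx.
exact/esym/(deriveD (df1 x Vx) (dg1 x Vx)).
Qed.

Lemma CkM k V f g : open V -> Ck k V f -> Ck k V g -> Ck k V (fun x => f x * g x).
Proof.
move=> oV; elim: k f g => [|k IH] f g.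
  by move=> [cf df] [cg dg]; split => // x Vx; apply: (@continuousM _ _ f g x);
    [exact: cf|exact: cg].
move=> Cf Cg; have [cf df] := Cf; have [cg dg] := Cg.
split => [x Vx|i]; first by apply: (@continuousM _ _ f g x); [exact: cf|exact: cg].
have [df1 df2] := df i; have [dg1 dg2] := dg i.
split => [x Vx|]; first by apply: derivableM; [exact: df1|exact: dg1].
apply: Ck_eq (CkD oV (IH _ _ (CkW Cf) dg2) (IH _ _ (CkW Cg) df2)) => // x Vx.
exact/esym/(deriveM (df1 x Vx) (dg1 x Vx)).
Qed.

Lemma CkV k V f : open V -> (forall x, V x -> f x != 0) -> Ck k V f ->
  Ck k V (fun x => (f x)^-1).
Proof.
move=> oV f0; elim: k => [|k IH].
  by move=> [cf df]; split => // x Vx; apply: continuousV; [exact: f0|exact: cf].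
move=> Cf; have [cf df] := Cf.
split => [x Vx|i]; first by apply: continuousV; [exact: f0|exact: cf].
have [df1 df2] := df i; split => [x Vx|]; first by apply: derivableV; [exact: f0|exact: df1].
have If := IH (CkW Cf).
apply: Ck_eq (CkM oV (CkM oV (Ck_cst k V (-1)) (CkM oV If If)) df2) => // x Vx.
rewrite deriveV; [|exact: f0|exact: df1].
by rewrite mulN1r expr2 invfM.
Qed.

Lemma line_quotientE (f : 'rV[R]_n -> R) x w (t : R) :
  (fun h : R => h^-1 *: (f (x + (h%:A + t) *: w) - f (x + t *: w))) =
  (fun h : R => h^-1 *: (f (h *: w + (x + t *: w)) - f (x + t *: w))).
Proof.
apply/funext => h; congr (_ *: (f _ - _)).
by rewrite [h%:A]mulr1 scalerDl addrCA.
Qed.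

Lemma is_derive_line f x w (t : R) : derivable f (x + t *: w) w ->
  is_derive t 1 (fun s => f (x + s *: w)) ('D_w f (x + t *: w)).
Proof.
move=> df.
have e : (fun h : R => h^-1 *: ((fun s => f (x + s *: w)) (h *: 1 + t) - f (x + t *: w))) =
   (fun h : R => h^-1 *: (f (h *: w + (x + t *: w)) - f (x + t *: w))) by exact: line_quotientE.
apply: DeriveDef; first by rewrite /derivable e.
by rewrite /derive e.
Qed.

Lemma line_MVT f x w (h : R) : 0 < h ->
  (forall t, 0 <= t <= h -> derivable f (x + t *: w) w) ->
  exists2 t, 0 <= t <= h & f (x + h *: w) - f x = h * 'D_w f (x + t *: w).
Proof.
move=> h0 df.
have dF t : t \in `[0, h] -> is_derive t 1 (fun s => f (x + s *: w)) ('D_w f (x + t *: w)).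
  by rewrite in_itv /= => /df; exact: is_derive_line.
pose F (s : R) := f (x + s *: w); pose dFf (t : R) := 'D_w f (x + t *: w).
have dF' t : t \in `]0, h[ -> is_derive t 1 F (dFf t).
  by rewrite in_itv /= => /andP[t0 th]; apply: dF; rewrite in_itv /= !ltW.
have cF : {within `[0, h], continuous F}.
  by apply: derivable_within_continuous => t /dF [].
have [c cP] := MVT h0 dF' cF.
rewrite /F scale0r addr0 subr0 mulrC => ->; exists c => //.
by move: cP; rewrite in_itv /= => /andP[t0 th]; rewrite !ltW.
Qed.

(** The second difference of [f] over a square of side [h] is a mixed derivative at some
    point of the square, by two applications of the mean value theorem. *)
Lemma mixed_difference f x u v (h : R) : 0 < h ->
  (forall s t, 0 <= s <= h -> 0 <= t <= h -> derivable f (x + s *: u + t *: v) u /\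
     derivable (fun y => 'D_u f y) (x + s *: u + t *: v) v) ->
  exists s t, [/\ 0 <= s <= h, 0 <= t <= h &
    f (x + h *: u + h *: v) - f (x + h *: u) - (f (x + h *: v) - f x) =
    h ^+ 2 * 'D_v (fun y => 'D_u f y) (x + s *: u + t *: v)].
Proof.
move=> h0 df; have hh : 0 <= h <= h by rewrite lexx ltW.
have zz : 0 <= (0 : R) <= h by rewrite lexx ltW.
pose G y := f (y + h *: v) - f y.
have shift y : derivable f (y + h *: v) u ->
    derivable (fun z => f (z + h *: v)) y u /\
    'D_u (fun z => f (z + h *: v)) y = 'D_u f (y + h *: v).
  move=> d; have e : (fun k : R => k^-1 *: ((fun z => f (z + h *: v)) (k *: u + y) - f
    (y + h *: v))) =
     (fun k : R => k^-1 *: (f (k *: u + (y + h *: v)) - f (y + h *: v))).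
    by apply/funext => k; rewrite addrA.
  by split; [rewrite /derivable e|rewrite /derive e].
have dG s : 0 <= s <= h -> derivable G (x + s *: u) u /\
    'D_u G (x + s *: u) = 'D_u f (x + s *: u + h *: v) - 'D_u f (x + s *: u).
  move=> sh; have [d1 _] := df s h sh hh; have [d0 _] := df s 0 sh zz.
  rewrite scale0r addr0 in d0; have [d2 e2] := shift _ d1.
  split; first exact: derivableB.
  by rewrite /G (@deriveB _ _ _ (fun z => f (z + h *: v)) f) // e2.
have [s sh es] : exists2 s, 0 <= s <= h & G (x + h *: u) - G x = h * 'D_u G (x + s *: u).
  by apply: line_MVT => // t /dG [].
have [t th et] : exists2 t, 0 <= t <= h &
   'D_u f (x + s *: u + h *: v) - 'D_u f (x + s *: u) =
   h * 'D_v (fun y => 'D_u f y) (x + s *: u + t *: v).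
  by apply: (@line_MVT (fun y => 'D_u f y)) => // t th; have [] := df s t sh th.
exists s, t; split => //.
by move: es; rewrite /G (dG s sh).2 et => ->; rewrite expr2 mulrA.
Qed.

Lemma second_differenceC (a b c d : R) : a - c - (b - d) = a - b - (c - d).
Proof. by ring. Qed.

(** The second difference is symmetric in the two directions, so in every small
    square the two mixed derivatives take a common value, each at some point; by
    continuity they agree at [x]. *)
Lemma mixed_derivatives V f x i j : open V -> Ck 2 V f -> V x ->
  'D_(delta_mx 0 i) (fun y => 'D_(delta_mx 0 j) f y) x =
  'D_(delta_mx 0 j) (fun y => 'D_(delta_mx 0 i) f y) x.
Proof.
move=> oV [_ Cf] Vx; set u := delta_mx 0 i; set v := delta_mx 0 j.
apply/eqP; rewrite -subr_eq0; apply: contraT => AB.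
set A := 'D_u _ x in AB *; set B := 'D_v _ x in AB *.
pose e := `|A - B| / 2.
have e0 : 0 < e by rewrite divr_gt0 // normr_gt0.
have [fi [_ /(_ j)[fij cij]]] := Cf i; have [fj [_ /(_ i)[fji cji]]] := Cf j.
have cA := cji.1 x Vx; have cB := cij.1 x Vx.
have nA : \forall y \near x, `|A - 'D_u ('D_v f) y| < e.
  exact: (@cvgr_dist_lt _ _ _ (nbhs x) _ ('D_u ('D_v f)) A cA e e0).
have nB : \forall y \near x, `|B - 'D_v ('D_u f) y| < e.
  exact: (@cvgr_dist_lt _ _ _ (nbhs x) _ ('D_v ('D_u f)) B cB e e0).
have : \forall y \near x, V y /\ `|A - 'D_u ('D_v f) y| < e /\ `|B - 'D_v ('D_u f) y| < e.
  exact: (filterI (open_near oV Vx) (filterI nA nB)).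
move=> /nbhs_ballP[d /= d0 Hd].
have [h h0 Hh] : exists2 h : R, 0 < h & forall s t, 0 <= s <= h -> 0 <= t <= h ->
    ball x d (x + s *: u + t *: v).
  have k0 : 0 < `|u| + `|v| + 1 by rewrite ltr_wpDl // addr_ge0.
  exists (d / (`|u| + `|v| + 1)); first exact: divr_gt0.
  move=> s t /andP[s0 sh] /andP[t0 th]; rewrite -ball_normE /ball_ /=.
  rewrite opprD addrA opprD addrA subrr sub0r -opprD normrN.
  apply: le_lt_trans (ler_normD _ _) _; rewrite !normrZ !ger0_norm //.
  apply: le_lt_trans (lerD (ler_wpM2r (normr_ge0 u) sh) (ler_wpM2r (normr_ge0 v) th)) _.
  by rewrite -mulrDr -mulrA gtr_pMr // mulrC ltr_pdivrMr // mul1r ltrDl.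
have D1 s t : 0 <= s <= h -> 0 <= t <= h -> derivable f (x + s *: u + t *: v) u /\
    derivable (fun y => 'D_u f y) (x + s *: u + t *: v) v.
  move=> sh th; have [Vy _] := Hd _ (Hh s t sh th).
  by split; [exact: (fi _ Vy)|exact: (fij _ Vy)].
have D2 s t : 0 <= s <= h -> 0 <= t <= h -> derivable f (x + s *: v + t *: u) v /\
    derivable (fun y => 'D_v f y) (x + s *: v + t *: u) u.
  move=> sh th; have [Vy _] := Hd _ (Hh t s th sh).
  by rewrite addrAC; split; [exact: (fj _ Vy)|exact: (fji _ Vy)].
have [s [t [sh th E1]]] := mixed_difference h0 D1.
have [s' [t' [sh' th' E2]]] := mixed_difference h0 D2.
have [_ [_ HB]] := Hd _ (Hh s t sh th).
have [_ [HA _]] := Hd _ (Hh t' s' th' sh').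
move: HA HB; rewrite (addrAC x (t' *: u)).
have -> : 'D_u (fun y => 'D_v f y) (x + s' *: v + t' *: u) =
          'D_v (fun y => 'D_u f y) (x + s *: u + t *: v).
  apply: (@mulfI _ (h ^+ 2)); first by rewrite expf_neq0 // gt_eqF.
  rewrite (addrAC x (h *: v)) in E2; have := etrans (esym E2) (second_differenceC _ _ _ _).
  by rewrite E1.
move=> HA; rewrite distrC => HB.
have H1 := ler_distD ('D_v (fun y => 'D_u f y) (x + s *: u + t *: v)) A B.
have := le_lt_trans H1 (ltrD HA HB); by rewrite -splitr ltxx.
Unshelve. all: by end_near. Qed.

End RealSmooth.

(** * Complex-valued smooth functions *)
Section ComplexSmooth.
Context {R : realType} {n : nat}.
Local Notation C := R[i].
Local Notation rV := 'rV[R]_n.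
Implicit Types (V W : set rV) (f g : rV -> R) (w z : rV -> C) (i : 'I_n).

Lemma smooth_sub V W f : W `<=` V -> smooth_on V f -> smooth_on W f.
Proof. by move=> WV Hf k; apply: Ck_sub (Hf k). Qed.
Lemma smooth_eq V f g : open V -> (forall x, V x -> f x = g x) -> smooth_on V f -> smooth_on V g.
Proof. by move=> oV fg Hf k; apply: Ck_eq (Hf k). Qed.
Lemma smooth_cst V (r : R) : smooth_on V (fun=> r).
Proof. by move=> k; exact: Ck_cst. Qed.
Lemma smoothD V f g : open V -> smooth_on V f -> smooth_on V g -> smooth_on V (fun x => f x + g x).
Proof. by move=> oV Hf Hg k; apply: CkD. Qed.
Lemma smoothM V f g : open V -> smooth_on V f -> smooth_on V g -> smooth_on V (fun x => f x * g x).
Proof. by move=> oV Hf Hg k; apply: CkM. Qed.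
Lemma smoothV V f : open V -> (forall x, V x -> f x != 0) -> smooth_on V f ->
  smooth_on V (fun x => (f x)^-1).
Proof. by move=> oV f0 Hf k; apply: CkV. Qed.
Lemma smoothN V f : open V -> smooth_on V f -> smooth_on V (fun x => - f x).
Proof.
move=> oV Hf; apply: (smooth_eq oV (f := fun x => -1 * f x)) => [x _|].
  by rewrite mulN1r.
by apply: smoothM => //; exact: smooth_cst.
Qed.
Lemma smoothB V f g : open V -> smooth_on V f -> smooth_on V g -> smooth_on V (fun x => f x - g x).
Proof. by move=> oV Hf Hg; apply: smoothD => //; exact: smoothN. Qed.
Lemma smooth_sum V (K : Type) (r : seq K) (P : pred K) (F : K -> rV -> R) : open V ->
  (forall t, P t -> smooth_on V (F t)) -> smooth_on V (fun x => \sum_(t <- r | P t) F t x).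
Proof.
move=> oV H; elim: r => [|t r IH].
  apply: (smooth_eq oV (f := fun=> 0)) => [x _|]; first by rewrite big_nil.
  exact: smooth_cst.
case Pt: (P t).
  apply: (smooth_eq oV (f := fun x => F t x + \sum_(t <- r | P t) F t x)) => [x _|].
    by rewrite big_cons Pt.
  by apply: smoothD => //; exact: H.
apply: (smooth_eq oV _ IH) => x _; by rewrite big_cons Pt.
Qed.
Lemma smooth_prod V (K : Type) (r : seq K) (P : pred K) (F : K -> rV -> R) : open V ->
  (forall t, P t -> smooth_on V (F t)) -> smooth_on V (fun x => \prod_(t <- r | P t) F t x).
Proof.
move=> oV H; elim: r => [|t r IH].
  apply: (smooth_eq oV (f := fun=> 1)) => [x _|]; first by rewrite big_nil.
  exact: smooth_cst.
case Pt: (P t).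
  apply: (smooth_eq oV (f := fun x => F t x * \prod_(t <- r | P t) F t x)) => [x _|].
    by rewrite big_cons Pt.
  by apply: smoothM => //; exact: H.
apply: (smooth_eq oV _ IH) => x _; by rewrite big_cons Pt.
Qed.
Lemma smooth_derive V f i : smooth_on V f -> smooth_on V (fun x => 'D_(delta_mx 0 i) f x).
Proof. by move=> Hf k; have [_ /(_ i)[]] := Hf k.+1. Qed.
Lemma smooth_derivable V f i x : smooth_on V f -> V x -> derivable f x (delta_mx 0 i).
Proof. by move=> Hf Vx; have [_ /(_ i)[H _]] := Hf 1%N; apply: H. Qed.

Lemma smooth_det V m (F : rV -> 'M[R]_m) : open V ->
  (forall k l, smooth_on V (fun x => F x k l)) -> smooth_on V (fun x => \det (F x)).
Proof.
move=> oV H; apply: smooth_sum => // s _; apply: smoothM => //; first exact: smooth_cst.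
by apply: smooth_prod.
Qed.

(** By Cramer's rule the entries of the inverse are rational in those of the matrix. *)
Lemma smooth_invmx V m (F : rV -> 'M[R]_m) : open V ->
  (forall k l, smooth_on V (fun x => F x k l)) -> (forall x, V x -> F x \in unitmx) ->
  forall k l, smooth_on V (fun x => invmx (F x) k l).
Proof.
move=> oV H U i j.
apply: (smooth_eq oV (f := fun x => (\det (F x))^-1 *
    ((-1) ^+ (j + i) * \det (row' j (col' i (F x)))))) => [x Vx|].
  by rewrite /invmx U // !mxE.
apply: smoothM => //.
  by apply: smoothV => //; [move=> x /U; rewrite unitmxE unitfE|exact: smooth_det].
apply: smoothM => //; first exact: smooth_cst.
apply: smooth_det => // k l; apply: (smooth_eq oV _ (H (lift j k) (lift i l))) => x _.
by rewrite !mxE.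
Qed.

Definition csmooth V w := smooth_on V (fun y => complex.Re (w y)) /\ smooth_on V
  (fun y => complex.Im (w y)).
Definition cderive i w (y : rV) : C :=
  'D_(delta_mx 0 i) (fun x => complex.Re (w x)) y +i* 'D_(delta_mx 0 i)
    (fun x => complex.Im (w x)) y.

Lemma ReD (x y : C) : complex.Re (x + y) = complex.Re x + complex.Re y.
Proof. by case: x y => [? ?] [? ?]. Qed.
Lemma ImD (x y : C) : complex.Im (x + y) = complex.Im x + complex.Im y.
Proof. by case: x y => [? ?] [? ?]. Qed.
Lemma ReM (x y : C) : complex.Re (x * y) = complex.Re x * complex.Re y - complex.Im x * complex.Im
  y.
Proof. by case: x y => [? ?] [? ?]. Qed.
Lemma ImM (x y : C) : complex.Im (x * y) = complex.Re x * complex.Im y + complex.Im x * complex.Re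
  y.
Proof. by case: x y => [? ?] [? ?]. Qed.

Lemma csmooth_sub V W w : W `<=` V -> csmooth V w -> csmooth W w.
Proof. by move=> WV [H1 H2]; split; apply: smooth_sub WV _. Qed.
Lemma csmooth_eq V w z : open V -> (forall x, V x -> w x = z x) -> csmooth V w -> csmooth V z.
Proof.
move=> oV wz [H1 H2]; split; [apply: smooth_eq oV _ H1|apply: smooth_eq oV _ H2] => x Vx;
  by rewrite wz.
Qed.
Lemma csmooth_cst V (c : C) : csmooth V (fun=> c).
Proof. by split; exact: smooth_cst. Qed.
Lemma csmoothD V w z : open V -> csmooth V w -> csmooth V z -> csmooth V (fun x => w x + z x).
Proof.
move=> oV [w1 w2] [z1 z2]; split.
  by apply: (smooth_eq oV _ (smoothD oV w1 z1)) => x _; rewrite ReD.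
by apply: (smooth_eq oV _ (smoothD oV w2 z2)) => x _; rewrite ImD.
Qed.
Lemma csmoothM V w z : open V -> csmooth V w -> csmooth V z -> csmooth V (fun x => w x * z x).
Proof.
move=> oV [w1 w2] [z1 z2]; split.
  apply: (smooth_eq oV _ (smoothB oV (smoothM oV w1 z1) (smoothM oV w2 z2))) => x _.
  by rewrite ReM.
apply: (smooth_eq oV _ (smoothD oV (smoothM oV w1 z2) (smoothM oV w2 z1))) => x _.
by rewrite ImM.
Qed.
Lemma csmooth_conj V w : open V -> csmooth V w -> csmooth V (fun x => conjc (w x)).
Proof.
move=> oV [w1 w2]; split.
  by apply: (smooth_eq oV _ w1) => x _; case: (w x).
by apply: (smooth_eq oV _ (smoothN oV w2)) => x _; case: (w x).
Qed.
Lemma csmooth_real V f : smooth_on V f -> csmooth V (fun x => (f x)%:C).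
Proof. by move=> Hf; split => //; exact: smooth_cst. Qed.
Lemma csmooth_sum V (K : Type) (r : seq K) (P : pred K) (F : K -> rV -> C) : open V ->
  (forall t, P t -> csmooth V (F t)) -> csmooth V (fun x => \sum_(t <- r | P t) F t x).
Proof.
move=> oV H; elim: r => [|t r IH].
  apply: (csmooth_eq oV (w := fun=> 0)) => [x _|]; first by rewrite big_nil.
  exact: csmooth_cst.
case Pt: (P t).
  apply: (csmooth_eq oV (w := fun x => F t x + \sum_(t <- r | P t) F t x)) => [x _|].
    by rewrite big_cons Pt.
  by apply: csmoothD => //; exact: H.
apply: (csmooth_eq oV _ IH) => x _; by rewrite big_cons Pt.
Qed.
Lemma csmooth_cderive V i w : csmooth V w -> csmooth V (cderive i w).
Proof. by move=> [w1 w2]; split; exact: smooth_derive. Qed.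

Lemma cderive_eq V i w z y : open V -> V y -> (forall x, V x -> w x = z x) -> cderive i w y =
  cderive i z y.
Proof.
move=> oV Vy wz; congr (_ +i* _); apply: near_eq_derive; near=> x;
  rewrite wz //; near: x; exact: open_near.
Unshelve. all: by end_near. Qed.

Lemma cderive_cst i (c : C) y : cderive i (fun=> c) y = 0.
Proof. by rewrite /cderive !derive_cst. Qed.

Lemma cderiveD V i w z y : V y -> csmooth V w -> csmooth V z ->
  cderive i (fun x => w x + z x) y = cderive i w y + cderive i z y.
Proof.
move=> Vy [w1 w2] [z1 z2].
have e1 := deriveD (smooth_derivable (i:=i) w1 Vy) (smooth_derivable (i:=i) z1 Vy).
have e2 := deriveD (smooth_derivable (i:=i) w2 Vy) (smooth_derivable (i:=i) z2 Vy).
have f1 : (fun x => complex.Re (w x + z x)) =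
    (fun x => complex.Re (w x)) + (fun x => complex.Re (z x)).
  by apply/funext => x; rewrite ReD.
have f2 : (fun x => complex.Im (w x + z x)) =
    (fun x => complex.Im (w x)) + (fun x => complex.Im (z x)).
  by apply/funext => x; rewrite ImD.
by rewrite /cderive f1 f2 e1 e2.
Qed.

Lemma leibniz_complex (a b c d a' b' c' d' : R) :
  (a *: c' + c *: a' - (b *: d' + d *: b')) +i* (a *: d' + d *: a' + (b *: c' + c *: b')) =
  (a' +i* b') * (c +i* d) + (a +i* b) * (c' +i* d').
Proof.
apply/eqP; rewrite eq_complex /= /GRing.scale /=; apply/andP; split; apply/eqP; ring.
Qed.

Lemma cderiveM V i w z y : V y -> csmooth V w -> csmooth V z ->
  cderive i (fun x => w x * z x) y = cderive i w y * z y + w y * cderive i z y.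
Proof.
move=> Vy [w1 w2] [z1 z2].
have dw1 := smooth_derivable (i:=i) w1 Vy; have dw2 := smooth_derivable (i:=i) w2 Vy.
have dz1 := smooth_derivable (i:=i) z1 Vy; have dz2 := smooth_derivable (i:=i) z2 Vy.
have e1 := deriveB (derivableM dw1 dz1) (derivableM dw2 dz2).
have e2 := deriveD (derivableM dw1 dz2) (derivableM dw2 dz1).
rewrite (deriveM dw1 dz1) (deriveM dw2 dz2) in e1.
rewrite (deriveM dw1 dz2) (deriveM dw2 dz1) in e2.
have f1 : (fun x => complex.Re (w x * z x)) =
    (fun x => complex.Re (w x)) * (fun x => complex.Re (z x)) -
    (fun x => complex.Im (w x)) * (fun x => complex.Im (z x)).
  by apply/funext => x; rewrite ReM.
have f2 : (fun x => complex.Im (w x * z x)) =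
    (fun x => complex.Re (w x)) * (fun x => complex.Im (z x)) +
    (fun x => complex.Im (w x)) * (fun x => complex.Re (z x)).
  by apply/funext => x; rewrite ImM.
rewrite /cderive f1 f2 e1 e2; case: (w y) (z y) => [a b] [c d].
exact: leibniz_complex.
Qed.

Lemma cderive_sum V i (K : Type) (r : seq K) (P : pred K) (F : K -> rV -> C) y : open V -> V y ->
  (forall t, P t -> csmooth V (F t)) ->
  cderive i (fun x => \sum_(t <- r | P t) F t x) y = \sum_(t <- r | P t) cderive i (F t) y.
Proof.
move=> oV Vy H; elim: r => [|t r IH].
  rewrite big_nil (cderive_eq i oV Vy (z := fun=> 0)) ?cderive_cst // => x _; exact: big_nil.
rewrite big_cons; case Pt: (P t).
  rewrite -IH -(cderiveD i Vy (H t Pt) (csmooth_sum r oV H)).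
  by apply: (cderive_eq i oV Vy) => x _; rewrite big_cons Pt.
by rewrite -IH; apply: (cderive_eq i oV Vy) => x _; rewrite big_cons Pt.
Qed.

Lemma cderive_sym V i j w y : open V -> V y -> csmooth V w ->
  cderive i (cderive j w) y = cderive j (cderive i w) y.
Proof.
move=> oV Vy [w1 w2].
have e1 := mixed_derivatives i j oV (w1 2%N) Vy.
have e2 := mixed_derivatives i j oV (w2 2%N) Vy.
exact: (f_equal2 (@Complex R) e1 e2).
Qed.

Lemma cderive_conj V i w y : V y -> csmooth V w -> cderive i (fun x => conjc (w x)) y = conjc
  (cderive i w y).
Proof.
move=> Vy [w1 w2].
have f1 : (fun x => complex.Re (conjc (w x))) = (fun x => complex.Re (w x)).
  by apply/funext => x; case: (w x).
have f2 : (fun x => complex.Im (conjc (w x))) = - (fun x => complex.Im (w x)).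
  by apply/funext => x /=; rewrite [RHS]/GRing.opp /=; case: (w x).
by rewrite /cderive f1 f2 (deriveN (smooth_derivable (i:=i) w2 Vy)).
Qed.

End ComplexSmooth.

(** * The differential in a chart *)
HB.lock Definition chart_d {R : realType} {n : nat} (u : 'rV[R]_n -> ext R n) (y : 'rV[R]_n) : ext
  R n :=
  \sum_i wedge (dx i) (partial i u y).

Section ExtSmooth.
Context {R : realType} {n : nat}.
Local Notation C := R[i].
Local Notation E := (ext R n).
Local Notation rV := 'rV[R]_n.
Implicit Types (V W : set rV) (i j : 'I_n) (u v : rV -> E) (y : rV).

Definition esmooth V u := forall S : {set 'I_n}, csmooth V (fun y => u y S : C).

Lemma esmooth_sub V W u : W `<=` V -> esmooth V u -> esmooth W u.
Proof. by move=> WV Hu S; apply: csmooth_sub (Hu S). Qed.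
Lemma esmooth_eq V u v : open V -> (forall y, V y -> u y = v y) -> esmooth V u -> esmooth V v.
Proof. by move=> oV uv Hu S; apply: csmooth_eq (Hu S) => // y Vy; rewrite uv. Qed.
Lemma esmooth_cst V (a : E) : esmooth V (fun=> a).
Proof. by move=> S; exact: csmooth_cst. Qed.
Lemma esmoothD V u v : open V -> esmooth V u -> esmooth V v -> esmooth V (fun y => u y + v y).
Proof.
move=> oV Hu Hv S; apply: (csmooth_eq oV _ (csmoothD oV (Hu S) (Hv S))) => y _.
by rewrite ffunE.
Qed.
Lemma esmoothZ V (f : rV -> C) u : open V -> csmooth V f -> esmooth V u -> esmooth V
  (fun y => f y *: u y).
Proof.
move=> oV Hf Hu S; apply: (csmooth_eq oV _ (csmoothM oV Hf (Hu S))) => y _.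
by rewrite ffunE.
Qed.
Lemma esmooth_sum V (K : Type) (r : seq K) (P : pred K) (F : K -> rV -> E) : open V ->
  (forall t, P t -> esmooth V (F t)) -> esmooth V (fun x => \sum_(t <- r | P t) F t x).
Proof.
move=> oV H; elim: r => [|t r IH].
  apply: (esmooth_eq oV (u := fun=> 0)) => [x _|]; first by rewrite big_nil.
  exact: esmooth_cst.
case Pt: (P t).
  apply: (esmooth_eq oV (u := fun x => F t x + \sum_(t <- r | P t) F t x)) => [x _|].
    by rewrite big_cons Pt.
  by apply: esmoothD => //; exact: H.
apply: (esmooth_eq oV _ IH) => x _; by rewrite big_cons Pt.
Qed.
Lemma esmooth_wedge V u v : open V -> esmooth V u -> esmooth V v -> esmooth V
  (fun y => wedge (u y) (v y)).
Proof.
move=> oV Hu Hv S.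
apply: (csmooth_eq oV (w := fun y => \sum_(A in powerset S)
   ((-1) ^+ inversions A (S :\: A) * (u y A : C)) * v y (S :\: A))) => [y _|].
  by rewrite wedgeE.
apply: csmooth_sum => // A _; apply: csmoothM => //; apply: csmoothM => //; exact: csmooth_cst.
Qed.
Lemma esmooth_conj V u : open V -> esmooth V u -> esmooth V (fun y => conj_ext (u y)).
Proof.
move=> oV Hu S; apply: (csmooth_eq oV _ (csmooth_conj oV (Hu S))) => y _.
by rewrite conj_extE.
Qed.
Lemma esmooth_contract V (x : rV -> 'rV[C]_n) u : open V ->
  (forall i, csmooth V (fun y => x y 0 i)) ->
  esmooth V u -> esmooth V (fun y => contract (x y) (u y)).
Proof.
move=> oV Hx Hu S.
apply: (csmooth_eq oV (w := fun y => \sum_i x y 0 i *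
  (if i \in S then 0 else move_sign i S * u y (i |: S)%SET))) => [y _|].
  by rewrite contractE; apply: eq_bigr => i _; rewrite contract_coordE.
apply: csmooth_sum => // i _; apply: csmoothM => //; case: (i \in S); first exact: csmooth_cst.
by apply: csmoothM => //; exact: csmooth_cst.
Qed.

Lemma partialE i u y (S : {set 'I_n}) : partial i u y S = cderive i (fun z => u z S) y :> C.
Proof. by rewrite ffunE. Qed.

Lemma esmooth_partial V i u : open V -> esmooth V u -> esmooth V (partial i u).
Proof.
move=> oV Hu S; apply: (csmooth_eq oV _ (csmooth_cderive i (Hu S))) => y _.
by rewrite partialE.
Qed.

Lemma partial_eq V i u v y : open V -> V y -> (forall y, V y -> u y = v y) ->
  partial i u y = partial i v y.
Proof.
move=> oV Vy uv; apply/ffunP => S; rewrite !partialE.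
by apply: (cderive_eq i oV Vy) => x Vx; rewrite uv.
Qed.
Lemma partialD V i u v y : open V -> V y -> esmooth V u -> esmooth V v ->
  partial i (fun x => u x + v x) y = partial i u y + partial i v y.
Proof.
move=> oV Vy Hu Hv; apply/ffunP => S; rewrite [RHS]ffunE !partialE.
rewrite -(cderiveD i Vy (Hu S) (Hv S)); apply: (cderive_eq i oV Vy) => x _; exact: ffunE.
Qed.
Lemma partialZ V i (f : rV -> C) u y : open V -> V y -> csmooth V f -> esmooth V u ->
  partial i (fun x => f x *: u x) y = cderive i f y *: u y + f y *: partial i u y.
Proof.
move=> oV Vy Hf Hu; apply/ffunP => S.
rewrite [RHS]ffunE [X in X + _]ffunE [X in _ + X]ffunE !partialE.
rewrite -[RHS](cderiveM i Vy Hf (Hu S)); apply: (cderive_eq i oV Vy) => x _; exact: ffunE.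
Qed.
Lemma partial_sum V i (K : Type) (r : seq K) (P : pred K) (F : K -> rV -> E) y : open V -> V y ->
  (forall t, P t -> esmooth V (F t)) ->
  partial i (fun x => \sum_(t <- r | P t) F t x) y = \sum_(t <- r | P t) partial i (F t) y.
Proof.
move=> oV Vy H; apply/ffunP => S; rewrite partialE sum_ffunE.
transitivity (cderive i (fun x => \sum_(t <- r | P t) (F t x S : C)) y).
  by apply: (cderive_eq i oV Vy) => x _; rewrite sum_ffunE.
rewrite (cderive_sum i r oV Vy) => [|t Pt]; last exact: H.
by apply: eq_bigr => t _; rewrite partialE.
Qed.
Lemma partial_wedge V i u v y : open V -> V y -> esmooth V u -> esmooth V v ->
  partial i (fun x => wedge (u x) (v x)) y =
  wedge (partial i u y) (v y) + wedge (u y) (partial i v y).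
Proof.
move=> oV Vy Hu Hv; apply/ffunP => S; rewrite [RHS]ffunE partialE !wedgeE -big_split /=.
transitivity (cderive i (fun x => \sum_(A in powerset S)
   ((-1) ^+ inversions A (S :\: A) * (u x A : C)) * v x (S :\: A)) y).
  by apply: (cderive_eq i oV Vy) => x _; rewrite wedgeE.
have c1 A : csmooth V (fun x => (-1) ^+ inversions A (S :\: A) * (u x A : C)).
  by apply: csmoothM => //; exact: csmooth_cst.
rewrite (cderive_sum i _ oV Vy) => [|A _]; last by apply: csmoothM => //; exact: Hv.
apply: eq_bigr => A _; rewrite (cderiveM i Vy (c1 A) (Hv _)).
rewrite (cderiveM i Vy (csmooth_cst _ _) (Hu A)) cderive_cst mul0r add0r.
by rewrite !partialE.
Qed.
Lemma partial_cst i (a : E) y : partial i (fun=> a) y = 0.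
Proof. by apply/ffunP => S; rewrite partialE cderive_cst ffunE. Qed.
Lemma partial_conj V i u y : V y -> esmooth V u ->
  partial i (fun x => conj_ext (u x)) y = conj_ext (partial i u y).
Proof.
move=> Vy Hu; apply/ffunP => S; rewrite conj_extE !partialE -(cderive_conj i Vy (Hu S)).
by congr (cderive i _ y); apply/funext => x; rewrite conj_extE.
Qed.
Lemma partial2E V i j u y (S : {set 'I_n}) : open V -> V y ->
  partial i (partial j u) y S = cderive i (cderive j (fun z => u z S)) y :> C.
Proof.
move=> oV Vy; apply: etrans (partialE i _ y S) _.
by apply: (cderive_eq i oV Vy) => x _; exact: partialE.
Qed.
Lemma partial_sym V i j u y : open V -> V y -> esmooth V u ->
  partial i (partial j u) y = partial j (partial i u) y.
Proof.
move=> oV Vy Hu; apply/ffunP => S; apply: etrans (partial2E i j u S oV Vy) _.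
exact: etrans (cderive_sym i j oV Vy (Hu S)) (esym (partial2E j i u S oV Vy)).
Qed.

Lemma covector_partial V i u y : open V -> V y -> (forall y, V y -> is_covector (u y)) ->
  is_covector (partial i u y).
Proof.
move=> oV Vy Hu S S1; rewrite partialE.
by rewrite (cderive_eq i oV Vy (z := fun=> 0)) ?cderive_cst // => x Vx; rewrite Hu.
Qed.

Lemma chart_dE u y : chart_d u y = \sum_i wedge (dx i) (partial i u y).
Proof. by rewrite chart_d.unlock. Qed.

Lemma esmooth_chart_d V u : open V -> esmooth V u -> esmooth V (chart_d u).
Proof.
move=> oV Hu; apply: (esmooth_eq oV (u := fun y => \sum_i wedge (dx i) (partial i u y))) => [y _|].
  by rewrite chart_dE.
apply: esmooth_sum => // i _; apply: esmooth_wedge => //; first exact: esmooth_cst.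
exact: esmooth_partial.
Qed.
Lemma chart_d_eq V u v y : open V -> V y -> (forall y, V y -> u y = v y) -> chart_d u y = chart_d
  v y.
Proof. by move=> oV Vy uv; rewrite !chart_dE; apply: eq_bigr => i _; rewrite
  (partial_eq i oV Vy uv). Qed.
Lemma chart_dD V u v y : open V -> V y -> esmooth V u -> esmooth V v ->
  chart_d (fun x => u x + v x) y = chart_d u y + chart_d v y.
Proof.
move=> oV Vy Hu Hv; rewrite !chart_dE -big_split; apply: eq_bigr => i _.
by rewrite (partialD i oV Vy Hu Hv) wedgeDr.
Qed.
Lemma chart_dZ V (f : rV -> C) u y : open V -> V y -> csmooth V f -> esmooth V u ->
  chart_d (fun x => f x *: u x) y = wedge (\sum_i cderive i f y *: dx i) (u y) + f y *: chart_d u y.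
Proof.
move=> oV Vy Hf Hu; rewrite !chart_dE wedge_suml scaler_sumr -big_split; apply: eq_bigr => i _.
by rewrite (partialZ i oV Vy Hf Hu) wedgeDr !wedgeZr wedgeZl.
Qed.
Lemma chart_d_scale V (k : C) u y : open V -> V y -> esmooth V u -> chart_d (fun x => k *: u x) y
  = k *: chart_d u y.
Proof.
move=> oV Vy Hu; rewrite (chart_dZ oV Vy (csmooth_cst _ _) Hu) big1 ?wedge0l ?add0r // => i _.
by rewrite cderive_cst scale0r.
Qed.
Lemma chart_d_cst (a : E) y : chart_d (fun=> a) y = 0.
Proof. by rewrite !chart_dE big1 // => i _; rewrite partial_cst wedge0r. Qed.
Lemma chart_d_wedge V u v y : open V -> V y -> (forall y, V y -> is_covector (u y)) ->
  esmooth V u -> esmooth V v ->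
  chart_d (fun x => wedge (u x) (v x)) y = wedge (chart_d u y) (v y) - wedge (u y) (chart_d v y).
Proof.
move=> oV Vy cu Hu Hv; rewrite !chart_dE wedge_suml wedge_sumr -sumrB; apply: eq_bigr => i _.
rewrite (partial_wedge i oV Vy Hu Hv) wedgeDr wedgeA; congr (_ + _).
by rewrite wedge_anti //; [exact: is_covector_dx|exact: cu].
Qed.
Lemma chart_d_conj V u y : V y -> esmooth V u -> chart_d (fun x => conj_ext (u x)) y = conj_ext
  (chart_d u y).
Proof.
move=> Vy Hu; rewrite !chart_dE conj_ext_sum; apply: eq_bigr => i _.
by rewrite (partial_conj i Vy Hu) conj_wedge conj_dx.
Qed.

(** Partial derivatives commute while the [dx i] anticommute, so the double sum is its own
    opposite. *)
Lemma chart_d_chart_d V u y : open V -> V y -> esmooth V u -> chart_d (chart_d u) y = 0.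
Proof.
move=> oV Vy Hu.
have e : chart_d (chart_d u) y = \sum_i \sum_j wedge (dx i)
  (wedge (dx j) (partial i (partial j u) y)).
  rewrite chart_dE; apply: eq_bigr => i _.
  rewrite (partial_eq i oV Vy (v := fun y => \sum_j wedge (dx j) (partial j u y))) => [|z _]; last
    exact: chart_dE.
  rewrite (partial_sum i _ oV Vy) => [|j _]; last first.
    by apply: esmooth_wedge => //; [exact: esmooth_cst|exact: esmooth_partial].
  rewrite wedge_sumr; apply: eq_bigr => j _; congr wedge.
  rewrite (partial_wedge i oV Vy (esmooth_cst _ _) (esmooth_partial j oV Hu)).
  by rewrite partial_cst wedge0l add0r.
have : chart_d (chart_d u) y = - chart_d (chart_d u) y.
  rewrite {1}e exchange_big e -sumrN /=; apply: eq_bigr => i _; rewrite -sumrN.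
  by apply: eq_bigr => j _; rewrite wedge_dx_anti (partial_sym j i oV Vy Hu).
move/eqP; rewrite -addr_eq0 -mulr2n -scaler_nat scaler_eq0 pnatr_eq0 /=.
by move/eqP.
Qed.

End ExtSmooth.

(** * The (2,-1)-part of the differential in a coframe *)
Section DifferentialTwoForm.
Context {R : realType}.
Local Notation C := R[i].
Local Notation E := (ext R 6).
Local Notation rV := 'rV[R]_6.

Lemma two_form_chart_d V (u : rV -> E) y : open V -> V y -> (forall y, V y -> is_covector (u y)) ->
  two_form (chart_d u y).
Proof.
move=> oV Vy cu; rewrite chart_dE; elim/big_ind: _ => [|a b|i _].
- exact: two_form0.
- exact: two_formD.
- by apply: two_form_wedge; [exact: is_covector_dx|exact: covector_partial oV Vy cu].
Qed.

End DifferentialTwoForm.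

Section LocalFrame.
Context {R : realType}.
Local Notation C := R[i].
Local Notation E := (ext R 6).
Local Notation rV := 'rV[R]_6.
Variables (V : set rV) (J : rV -> 'M[R]_6) (th tb : 'I_3 -> rV -> E).
Variables (va vb : 'I_3 -> rV -> 'rV[C]_6).
Hypothesis oV : open V.
Hypothesis HF : forall y, V y ->
  adapted_frame (J y) (fun k => th k y) (fun k => tb k y) (fun k => va k y) (fun k => vb k y).
Hypothesis Hth : forall k, esmooth V (th k).
Hypothesis Htb : forall k, esmooth V (tb k).
Hypothesis Hva : forall k i, csmooth V (fun y => va k y 0 i).
Hypothesis Hvb : forall k i, csmooth V (fun y => vb k y 0 i).

(** The coframe version of the expansion in monomials: smooth forms are combinations,
    with smooth coefficients, of products of coframe elements. The coefficients of the
    change of coframe are the components of the smooth vectors [va] and [vb]. *)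
Lemma smooth_frame_ind (Q : (rV -> E) -> Prop) :
  (forall u v, (forall y, V y -> u y = v y) -> Q u -> Q v) ->
  (forall u v, Q u -> Q v -> Q (fun y => u y + v y)) ->
  (forall f u, csmooth V f -> Q u -> Q (fun y => f y *: u y)) ->
  Q (fun=> ext1) ->
  (forall k u, Q u -> Q (fun y => wedge (th k y) (u y))) ->
  (forall k u, Q u -> Q (fun y => wedge (tb k y) (u y))) ->
  forall u, esmooth V u -> Q u.
Proof.
move=> Qeq QD QZ Q1 Qth Qtb.
have Q0 : Q (fun=> 0).
  by apply: Qeq (QZ (fun=> 0) _ (csmooth_cst V 0) Q1) => y _; rewrite scale0r.
have Qsum (K : finType) (F : K -> rV -> E) : (forall t, Q (F t)) -> Q (fun y => \sum_t F t y).
  move=> HFt; elim: (index_enum K) => [|t r IH].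
    by apply: Qeq Q0 => y _; rewrite big_nil.
  by apply: Qeq (QD _ _ (HFt t) IH) => y _; rewrite big_cons.
have Qdx i u : Q u -> Q (fun y => wedge (dx i) (u y)).
  move=> Qu; apply: (Qeq (fun y => \sum_k (2^-1 * va k y 0 i) *: wedge (th k y) (u y) +
      \sum_k (2^-1 * vb k y 0 i) *: wedge (tb k y) (u y))) => [y Vy|].
    rewrite (af_span (HF Vy)) wedgeDl !wedge_suml.
    by congr (_ + _); apply: eq_bigr => k _; rewrite wedgeZl.
  have c2 (f : rV -> C) : csmooth V f -> csmooth V (fun y => 2^-1 * f y).
    by move=> Hf; apply: csmoothM => //; exact: csmooth_cst.
  by apply: QD; apply: Qsum => k; apply: QZ; auto.
have Qbas S : Q (fun=> monomial S).
  have [m] := ubnP #|S|; elim: m S => // m IH S; rewrite ltnS => Sm.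
  have [->|[i iS]] := set_0Vmem S; first by rewrite monomial0.
  apply: (Qeq (fun=> move_sign i (S :\ i) *: wedge (dx i) (monomial (S :\ i)))) => [y _|].
    by rewrite wedge_dx_monomial !inE eqxx /= scalerA move_sign_sqr scale1r finset.setD1K.
  apply: QZ; first exact: csmooth_cst.
  by apply: Qdx; apply: IH; apply: leq_trans Sm; rewrite [X in (_ < X)%N](cardsD1 i) iS.
move=> u Hu; apply: (Qeq (fun y => \sum_S (u y S : C) *: monomial S)) => [y _|].
  by rewrite -ext_monomial.
by apply: Qsum => S; apply: QZ.
Qed.

Definition d_tb20 k y : E := type_part (J y) 2 0 (chart_d (tb k) y).

Lemma form20_d_tb20 k y : V y -> form20 (J y) (d_tb20 k y).
Proof.
move=> Vy; apply: two_form_type_part20; first exact: (af_JJ (HF Vy)).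
apply: (two_form_chart_d oV Vy) => z Vz; exact: (covector_tb (HF Vz)).
Qed.

(** The (2,-1)-part of d agrees with the derivation, in each bidegree. Smoothness of the
    type components is carried along because each of them is differentiated, and
    both statements are proved by the same induction over the coframe. The second
    degree is written [q.+1] since d^{2,-1} lowers it by one. *)
Definition N_is_deriv (u : rV -> E) : Prop :=
  [/\ esmooth V u, forall p q, esmooth V (fun z => type_part (J z) p q (u z))
    & forall p q y, V y ->
      type_part (J y) p.+2 q (chart_d (fun z => type_part (J z) p q.+1 (u z)) y) =
      type_part (J y) p.+2 q (deriv20 (fun k => vb k y) (fun k => d_tb20 k y) (u y))].

Lemma N_is_deriv_eq u v : (forall y, V y -> u y = v y) -> N_is_deriv u -> N_is_deriv v.
Proof.
move=> uv [H0 H1 H2]; split => [|p q|p q y Vy]; first exact: esmooth_eq oV uv H0.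
  by apply: (esmooth_eq oV _ (H1 p q)) => z Vz; rewrite uv.
rewrite -(uv _ Vy) -(H2 p q y Vy).
by rewrite (chart_d_eq oV Vy (v := fun z => type_part (J z) p q.+1 (u z))) // => z Vz; rewrite uv.
Qed.

Lemma N_is_derivD u v : N_is_deriv u -> N_is_deriv v -> N_is_deriv (fun y => u y + v y).
Proof.
move=> [H0 H1 H2] [K0 K1 K2]; split => [|p q|p q y Vy]; first exact: esmoothD.
  by apply: (esmooth_eq oV _ (esmoothD oV (H1 p q) (K1 p q))) => z _; rewrite type_partD.
rewrite deriv20D type_partD -(H2 p q y Vy) -(K2 p q y Vy) -type_partD.
rewrite -(chart_dD oV Vy (H1 p q.+1) (K1 p q.+1)).
rewrite (chart_d_eq oV Vy (v := fun z => type_part (J z) p q.+1 (u z) + type_part (J z) p q.+1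
  (v z))) // => z _.
exact: type_partD.
Qed.

Lemma type_part_wedge_type J0 p q (w a : E) : J0 *m J0 = - 1%:M -> is_covector w ->
  type_part J0 p.+2 q (wedge w (type_part J0 p q.+1 a)) = 0.
Proof.
move=> JJ cw; rewrite (type_part_wedge_covector _ _ _ _ cw) type_part_predE
  (type_part_type_part JJ) gtn_eqF //= wedge0r add0r.
by case: q => [|q]; rewrite type_part_predE ?wedge0r // (type_part_type_part JJ) gtn_eqF ?wedge0r
  // ltnW.
Qed.

(** The derivative of the coefficient contributes the product with a one-form, which
    raises the first degree by at most one and so drops out of bidegree (2,-1). *)
Lemma N_is_derivZ f u : csmooth V f -> N_is_deriv u -> N_is_deriv (fun y => f y *: u y).
Proof.
move=> Hf [H0 H1 H2]; split => [|p q|p q y Vy]; first exact: esmoothZ.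
  by apply: (esmooth_eq oV _ (esmoothZ oV Hf (H1 p q))) => z _; rewrite type_partZ.
rewrite deriv20Z type_partZ -(H2 p q y Vy).
rewrite (chart_d_eq oV Vy (v := fun z => f z *: type_part (J z) p q.+1 (u z))) => [|z _]; last by
  rewrite type_partZ.
rewrite (chart_dZ oV Vy Hf (H1 p q.+1)) type_partD type_partZ type_part_wedge_type ?add0r //;
  first exact: af_JJ (HF Vy).
by apply: is_covector_sum => i _; apply/is_covectorZ/is_covector_dx.
Qed.

Lemma N_is_deriv1 : N_is_deriv (fun=> ext1).
Proof.
split => [|p q|p q y Vy]; first exact: esmooth_cst.
  by apply: (esmooth_eq oV _ (esmooth_cst V (if (p == 0%N) && (q == 0%N) then ext1 else 0))) => z _;
    rewrite type_part_ext1.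
rewrite deriv20_1 type_part_0 (chart_d_eq oV Vy (v := fun=> 0)) => [|z _]; last by rewrite
  type_part_ext1 andbF.
by rewrite chart_d_cst type_part_0.
Qed.

(** By the Leibniz rule; d of a (1,0)-form has no component of bidegree (3,-1), so the
    coframe element passes through with a sign. *)
Lemma N_is_deriv_th k u : N_is_deriv u -> N_is_deriv (fun y => wedge (th k y) (u y)).
Proof.
move=> [H0 H1 H2].
have T1 p q z : V z -> type_part (J z) p q (wedge (th k z) (u z)) =
    if p is p'.+1 then wedge (th k z) (type_part (J z) p' q (u z)) else 0.
  move=> Vz; rewrite (type_part_wedge10 _ _ _ (af_type10 (HF Vz) k)).
  by case: p => [|p]; rewrite type_part_predE ?wedge0r.
have cth z : V z -> is_covector (th k z) by move=> Vz; exact: (covector_th (HF Vz)).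
split => [|p q|p q y Vy]; first exact: esmooth_wedge.
  case: p => [|p].
    by apply: (esmooth_eq oV _ (esmooth_cst V 0)) => z Vz; rewrite T1.
  by apply: (esmooth_eq oV _ (esmooth_wedge oV (Hth k) (H1 p q))) => z Vz; rewrite T1.
have F20 l : form20 (J y) (d_tb20 l y) by exact: form20_d_tb20.
rewrite (deriv20_th (HF Vy)) // type_partN (type_part_wedge10 _ _ _ (af_type10 (HF Vy) k))
  type_part_predE.
case: p => [|p].
  rewrite (type_part1_deriv20 _ _ _) // wedge0r oppr0 (chart_d_eq oV Vy (v := fun=> 0)) =>
    [|z Vz]; last by rewrite T1.
  by rewrite chart_d_cst type_part_0.
rewrite (chart_d_eq oV Vy (v := fun z => wedge (th k z) (type_part (J z) p q.+1 (u z)))) =>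
  [|z Vz]; last by rewrite T1.
rewrite (chart_d_wedge oV Vy cth (Hth k) (H1 p q.+1)) type_partD type_partN.
rewrite two_form_type_part_high ?sub0r; [|exact: af_JJ (HF Vy)|exact: two_form_chart_d oV Vy cth].
by rewrite (type_part_wedge10 _ _ _ (af_type10 (HF Vy) k)) type_part_predE (H2 p q y Vy).
Qed.

(** By the Leibniz rule; d of a (0,1)-form contributes its (2,0)-part, the value of the
    derivation. *)
Lemma N_is_deriv_tb k u : N_is_deriv u -> N_is_deriv (fun y => wedge (tb k y) (u y)).
Proof.
move=> [H0 H1 H2].
have T1 p q z : V z -> type_part (J z) p q (wedge (tb k z) (u z)) =
    if q is q'.+1 then wedge (tb k z) (type_part (J z) p q' (u z)) else 0.
  move=> Vz; rewrite (type_part_wedge01 _ _ _ (af_type01 (HF Vz) k)).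
  by case: q => [|q]; rewrite type_part_predE ?wedge0r.
have ctb z : V z -> is_covector (tb k z) by move=> Vz; exact: (covector_tb (HF Vz)).
split => [|p q|p q y Vy]; first exact: esmooth_wedge.
  case: q => [|q].
    by apply: (esmooth_eq oV _ (esmooth_cst V 0)) => z Vz; rewrite T1.
  by apply: (esmooth_eq oV _ (esmooth_wedge oV (Htb k) (H1 p q))) => z Vz; rewrite T1.
have F20 l : form20 (J y) (d_tb20 l y) by exact: form20_d_tb20.
rewrite (deriv20_tb (HF Vy)) // type_partD type_partN (form20_type_part _ _ _ (F20 k)).
rewrite (chart_d_eq oV Vy (v := fun z => wedge (tb k z) (type_part (J z) p q (u z)))) => [|z Vz];
  last by rewrite T1.
rewrite (chart_d_wedge oV Vy ctb (Htb k) (H1 p q)) type_partD type_partN.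
rewrite two_form_type_part; [|exact: af_JJ (HF Vy)|exact: two_form_chart_d oV Vy ctb].
rewrite !(type_part_wedge01 _ _ _ (af_type01 (HF Vy) k)).
by case: q => [|q]; rewrite !type_part_predE // (H2 p q y Vy).
Qed.

Lemma N_is_derivP u : esmooth V u -> N_is_deriv u.
Proof.
apply: smooth_frame_ind.
- exact: N_is_deriv_eq.
- exact: N_is_derivD.
- exact: N_is_derivZ.
- exact: N_is_deriv1.
- exact: N_is_deriv_th.
- exact: N_is_deriv_tb.
Qed.

End LocalFrame.

(** * The structure equations *)
Section RealParts.
Context {R : realType} {n : nat}.
Local Notation E := (ext R n).
Lemma conj_re_im (a : E) : conj_ext a = re_ext a + (- 'i) *: im_ext a.
Proof.
apply/ffunP => S; rewrite !ffunE; case: (a S) => x y.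
apply/eqP; rewrite eq_complex /GRing.scale /=; apply/andP; split; apply/eqP; ring.
Qed.
End RealParts.

Section ChartFormula.
Context {R : realType}.
Local Notation C := R[i].
Local Notation E := (ext R 6).
Local Notation rV := 'rV[R]_6.
Variables (V : set rV) (J : rV -> 'M[R]_6) (th tb : 'I_3 -> rV -> E).
Variables (va vb : 'I_3 -> rV -> 'rV[C]_6).
Hypothesis oV : open V.
Hypothesis HF : forall y, V y ->
  adapted_frame (J y) (fun k => th k y) (fun k => tb k y) (fun k => va k y) (fun k => vb k y).
Hypothesis Hth : forall k, esmooth V (th k).
Hypothesis Htb : forall k, esmooth V (tb k).
Hypothesis Hva : forall k i, csmooth V (fun y => va k y 0 i).
Hypothesis Hvb : forall k i, csmooth V (fun y => vb k y 0 i).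

Local Notation db k y := (d_tb20 J tb k y).
Local Notation nu y := (deriv20 (fun k => vb k y) (fun k => db k y)).

Lemma N_formula u p q y : esmooth V u -> V y ->
  type_part (J y) p.+2 q (chart_d (fun z => type_part (J z) p q.+1 (u z)) y) = type_part (J y)
    p.+2 q (nu y (u y)).
Proof. by move=> Hu Vy; have [_ _ ->] := N_is_derivP oV HF Hth Htb Hva Hvb Hu. Qed.

Lemma esmooth_type_part u p q : esmooth V u -> esmooth V (fun z => type_part (J z) p q (u z)).
Proof. by move=> Hu; have [_ H _] := N_is_derivP oV HF Hth Htb Hva Hvb Hu. Qed.

Lemma sum_ord_eq m (F : nat -> E) k :
  \sum_(i < m | (i : nat) == k) F i = if (k < m)%N then F k else 0.
Proof.
case: ltnP => km; first by rewrite (big_pred1 (Ordinal km)).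
by rewrite big_pred0 // => i; apply/negbTE; rewrite neq_ltn (leq_trans (ltn_ord i) km).
Qed.

(** Degrees above 6 and the components of first degree 0 and 1 of the derivation vanish,
    so the double sum of the definition contains all the nonzero components. *)
Lemma sum_N u y : esmooth V u -> V y ->
  \sum_(p < 7) \sum_(q < 7) \sum_(p' < 7 | p'%:Z == p%:Z + 2) \sum_(q' < 7 | q'%:Z == q%:Z + (-1))
     type_part (J y) p' q' (chart_d (fun z => type_part (J z) p q (u z)) y) = nu y (u y).
Proof.
move=> Hu Vy.
have F20 k : form20 (J y) (db k y) by exact: (form20_d_tb20 oV HF k Vy).
transitivity (\sum_(p < 7) \sum_(q < 6) type_part (J y) p.+2 q (nu y (u y))).
  apply: eq_bigr => p _; rewrite big_ord_recl /= [X in X + _]big1 ?add0r => [|p' _]; last first.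
    by rewrite big_pred0.
  apply: eq_bigr => q _.
  transitivity (\sum_(p' < 7 | (p' : nat) == p.+2) \sum_(q' < 7 | (q' : nat) == q)
      type_part (J y) p' q' (chart_d (fun z => type_part (J z) p q.+1 (u z)) y)).
    apply: eq_big => [p'|p' _]; first lia.
    by apply: eq_big => [q'|q' _] //; rewrite /= /bump /=; lia.
  rewrite (sum_ord_eq 7 (fun p' => \sum_(q' < 7 | (q' : nat) == q) type_part (J y) p' q' _)).
  case: ltnP => p7; last first.
    by rewrite type_part_big // ltn_addr.
  rewrite (sum_ord_eq 7 (fun q' => type_part (J y) p.+2 q' _)) (ltn_trans (ltn_ord q)) //.
  by rewrite (N_formula _ _ Hu Vy).
(* First degrees 2 to 8 are those reached from 0 to 6, whence nine values. *)
rewrite -[RHS](@sum_type_part _ _ (J y) 9) //.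
rewrite [RHS]big_ord_recl big_ord_recl /= [X in _ = X + _]big1 => [|q _]; last first.
  by rewrite (type_part0_deriv20 _ F20).
rewrite add0r [X in _ = X + _]big1 => [|q _]; last by rewrite (type_part1_deriv20 _ F20).
rewrite add0r; apply: eq_bigr => p _; rewrite /bump /= !add1n.
rewrite [RHS]big_ord_recr [in RHS]big_ord_recr [in RHS]big_ord_recr /=.
have big k : (6 <= k)%N -> type_part (J y) p.+2 k (nu y (u y)) = 0.
  by move=> k6; apply: type_part_big; lia.
by rewrite !big // !addr0.
Qed.

Section Structure.
Variables (Om om : rV -> E) (lam : R).
Hypothesis lam0 : lam != 0.
Hypothesis HOm : esmooth V Om.
Hypothesis OmE : forall y, V y -> conj_ext (Om y) = vol3 (fun k => tb k y).
Hypothesis omE : forall y, V y -> om y = omega_frame (fun k => th k y) (fun k => tb k y).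
Hypothesis dom : forall y, V y -> chart_d om y = (3 * lam)%:C *: re_ext (Om y).
Hypothesis dimOm : forall y, V y ->
  chart_d (fun z => im_ext (Om z)) y = (- 2 * lam)%:C *: wedge (om y) (om y).

Lemma esmooth_om : esmooth V om.
Proof.
apply: (esmooth_eq oV (u := fun y => ('i / 2) *: \sum_k wedge (th k y) (tb k y))) => [y Vy|].
  by rewrite omE.
apply: esmoothZ => //; first exact: csmooth_cst.
by apply: esmooth_sum => // k _; apply: esmooth_wedge.
Qed.

Lemma esmooth_im_Om : esmooth V (fun z => im_ext (Om z)).
Proof.
move=> S; have [_ H] := HOm S; have := csmooth_real H.
by move=> H1; apply: (csmooth_eq oV _ H1) => y _; rewrite ffunE.
Qed.

Lemma esmooth_re_Om : esmooth V (fun z => re_ext (Om z)).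
Proof.
move=> S; have [H _] := HOm S; have := csmooth_real H.
by move=> H1; apply: (csmooth_eq oV _ H1) => y _; rewrite ffunE.
Qed.

(** A nonzero multiple of Re Omega is exact. *)
Lemma chart_d_re_Om y : V y -> chart_d (fun z => re_ext (Om z)) y = 0.
Proof.
move=> Vy; have l0 : (3 * lam)%:C != 0 :> C.
  by rewrite eq_complex /= eqxx andbT mulf_neq0 // pnatr_eq0.
rewrite (chart_d_eq oV Vy (v := fun z => ((3 * lam)%:C)^-1 *: chart_d om z)) => [|z Vz]; last first.
  by rewrite dom // scalerA mulVf // scale1r.
by rewrite (chart_d_scale _ oV Vy (esmooth_chart_d oV esmooth_om))
  (chart_d_chart_d oV Vy esmooth_om) scaler0.
Qed.

Lemma chart_d_conj_Om y : V y ->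
  chart_d (fun z => conj_ext (Om z)) y = (2 * 'i * lam%:C) *: wedge (om y) (om y).
Proof.
move=> Vy.
rewrite (chart_d_eq oV Vy (v := fun z => re_ext (Om z) + (- 'i) *: im_ext (Om z))) => [|z _]; last
  first.
  exact: conj_re_im.
rewrite (chart_dD oV Vy esmooth_re_Om) ?chart_d_re_Om // ?add0r; last first.
  by apply: esmoothZ => //; [exact: csmooth_cst|exact: esmooth_im_Om].
rewrite (chart_d_scale _ oV Vy esmooth_im_Om) dimOm // scalerA; congr (_ *: _).
by rewrite rmorphM rmorphN /= (rmorph_nat (real_complex R)); ring.
Qed.

(** Both sides are the component of type (2,2) of the differential of conj Omega, which has
    type (0,3), while omega is of type (1,1). *)
Lemma deriv20_vol3 y : V y ->
  nu y (vol3 (fun k => tb k y)) = (2 * 'i * lam%:C) *: wedge (om y) (om y).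
Proof.
move=> Vy; have Hf := HF Vy.
have F20 k : form20 (J y) (db k y) by exact: (form20_d_tb20 oV HF k Vy).
have tpv z : V z -> type_part (J z) 0 3 (vol3 (fun k => tb k z)) = vol3 (fun k => tb k z).
  move=> Vz; rewrite /vol3 -[tb 2 z]wedge1r.
  by rewrite !(type_part_wedge01 _ _ _ (af_type01 (HF Vz) _), type_part_predE) type_part_ext1.
have tpbb j k : type_part (J y) 0 2 (wedge (tb j y) (tb k y)) = wedge (tb j y) (tb k y).
  by rewrite -[tb k y]wedge1r !(type_part_wedge01 _ _ _ (af_type01 Hf _), type_part_predE)
    type_part_ext1.
have esv : esmooth V (fun z => vol3 (fun k => tb k z)) by do !apply: esmooth_wedge => //.
have := N_formula 0 2 esv Vy.
rewrite (chart_d_eq oV Vy (v := fun z => conj_ext (Om z))) => [|z Vz]; last by rewrite tpv // OmE.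
rewrite chart_d_conj_Om // type_partZ.
have -> : type_part (J y) 2 2 (nu y (vol3 (fun k => tb k y))) = nu y (vol3 (fun k => tb k y)).
  rewrite deriv20E type_part_sum; apply: eq_bigr => k _.
  by rewrite (half_contract_vol3 Hf) (form20_type_part _ _ _ (F20 k)) tpbb.
move=> <-; congr (_ *: _); rewrite omE // (omega_frame_sqr Hf) type_partZ; congr (_ *: _).
rewrite type_part_sum; apply: eq_bigr => j _; rewrite type_part_sum; apply: eq_bigr => k _.
by rewrite form20_type_part ?tpbb //; apply: form20_wedge; exact: (af_type10 Hf).
Qed.

(** The (2,0)-parts are the coefficients of the derivation, recovered by contracting its
    value at conj Omega, a multiple of the square of omega. *)
Lemma d_tb20E k y : V y ->
  db k y = ('i * lam%:C) *: wedge (th (k + 1) y) (th (k + 2) y).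
Proof.
move=> Vy; have Hf := HF Vy.
have F20 l : form20 (J y) (db l y) by exact: (form20_d_tb20 oV HF l Vy).
have := deriv20_vol3_inj Hf k F20.
rewrite deriv20_vol3 // !contractZ omE // (contract2_omega_sqr Hf) scalerA => e.
have -> : db k y = 4^-1 *: (4 *: db k y) by rewrite scalerA mulVf ?scale1r // pnatr_eq0.
rewrite -e scalerA; congr (_ *: _).
by rewrite (_ : 2 * 'i * lam%:C * 2 = 4 * ('i * lam%:C)) ?mulKf ?pnatr_eq0 //; ring.
Qed.

Lemma N_frame u y : esmooth V u -> V y ->
  \sum_(p < 7) \sum_(q < 7) \sum_(p' < 7 | p'%:Z == p%:Z + 2) \sum_(q' < 7 | q'%:Z == q%:Z + (-1))
     type_part (J y) p' q' (chart_d (fun z => type_part (J z) p q (u z)) y) =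
  deriv20 (fun k => vb k y)
    (fun k => ('i * lam%:C) *: wedge (th (k + 1) y) (th (k + 2) y)) (u y).
Proof.
move=> Hu Vy; rewrite (sum_N Hu Vy) !deriv20E; apply: eq_bigr => k _.
by rewrite d_tb20E.
Qed.

Hypothesis tbE : forall k y, tb k y = conj_ext (th k y).
Hypothesis vbE : forall k y, vb k y = conj_vec (va k y).

(** Conjugation exchanges the two degrees and commutes with d, so it exchanges d^{2,-1}
    and d^{-1,2}. *)
Lemma Nbar_frame u y : esmooth V u -> V y ->
  \sum_(p < 7) \sum_(q < 7) \sum_(p' < 7 | p'%:Z == p%:Z + (-1)) \sum_(q' < 7 | q'%:Z == q%:Z + 2)
     type_part (J y) p' q' (chart_d (fun z => type_part (J z) p q (u z)) y) =
  deriv20 (fun k => va k y)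
    (fun k => (- ('i * lam%:C)) *: wedge (tb (k + 1) y) (tb (k + 2) y)) (u y).
Proof.
move=> Hu Vy; have Hcu := esmooth_conj oV Hu.
have e := congr1 (fun a => conj_ext a) (N_frame Hcu Vy).
rewrite deriv20E [RHS]conj_ext_sum in e.
transitivity (\sum_k conj_ext
   (wedge (('i * lam%:C) *: wedge (th (k + 1) y) (th (k + 2) y))
          (2^-1 *: contract (vb k y) (conj_ext (u y))))); last first.
  rewrite deriv20E; apply: eq_bigr => k _.
  rewrite conj_wedge !conj_extZ conj_wedge -!tbE conj_half conj_contract conj_extK vbE.
  rewrite conjM conj_i conjc_real mulNr; congr (wedge _ (_ *: contract _ _)).
  by apply/rowP => i; rewrite !mxE conjcK.
rewrite -e conj_ext_sum; under [RHS]eq_bigr do rewrite conj_ext_sum.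
rewrite [RHS]exchange_big /=; apply: eq_bigr => p _; apply: eq_bigr => q _.
rewrite conj_ext_sum; under [RHS]eq_bigr do rewrite conj_ext_sum.
rewrite [RHS]exchange_big /=; apply: eq_bigr => p' _; apply: eq_bigr => q' _.
rewrite conj_type_part -(chart_d_conj Vy (esmooth_type_part q p Hcu)); congr (type_part _ _ _ _).
by apply: (chart_d_eq oV Vy) => z Vz; rewrite conj_type_part conj_extK.
Qed.

End Structure.
End ChartFormula.

(** * Forms on a manifold *)
Section SharpPullback.
Context {R : realType} {n : nat}.
Local Notation E := (ext R n).
(** The metric dual of a covector does not depend on the chart: the inverse metric
    transforms contragrediently to the metric. *)
Lemma sharp_pullback (K g g' : 'M[R]_n) (u : E) : is_covector u ->
  g = K *m g' *m K^T -> g \in unitmx ->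
  sharp g (pullback K u) *m map_mx (real_complex R) K = sharp g' u.
Proof.
move=> cu gE gU.
have KU : K \in unitmx.
  by move: gU; rewrite gE !unitmx_mul unitmx_tr => /andP[/andP[]].
have KTU : K^T \in unitmx by rewrite unitmx_tr.
have e : K^T *m invmx g *m K = invmx g'.
  have H : (K^T *m invmx g *m K) *m g' = 1%:M.
    apply: (can_inj (mulmxK KTU)); rewrite mul1mx -!mulmxA (mulmxA K) -gE.
    by rewrite mulVmx // mulmx1.
  by have /mulmx1_unit[_ g'U] := H; rewrite -[LHS]mulmx1 -(mulmxV g'U) mulmxA H mul1mx.
elim/(@covector_ind R n): u / cu => [x y Hx Hy|k x Hx|t|].
- by rewrite pullbackD !sharpD mulmxDl Hx Hy.
- by rewrite pullbackZ !sharpZ -scalemxAl Hx.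
- have -> : pullback K (dx t) = \sum_i (K i t)%:C *: dx i :> E.
    rewrite -[dx t]/(monomial [set t]%SET) [LHS]subst_monomial /wedge_set enum_set1 big_seq1 //.
  have rowE (h : 'M[R]_n) i : invmx_row h i = row i (map_mx (real_complex R) (invmx h)).
    by apply/rowP => j; rewrite !mxE.
  rewrite sharp_dx (big_morph _ (sharpD g) (sharp0 g)) rowE -e !map_mxM !row_mul.
  congr (_ *m _); rewrite mulmx_sum_row; apply: eq_bigr => i _.
  by rewrite sharpZ sharp_dx rowE conjc_real !mxE.
- have -> : pullback K (0 : E) = 0 by rewrite -(scale0r (0 : E)) pullbackZ !scale0r.
  by rewrite !sharp0 mul0mx.
Qed.
End SharpPullback.

Section FormsOnManifold.
Context {R : realType} {n : nat} {M : topologicalType}.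
Variable A : smooth_manifold R n M.
Local Notation E := (ext R n).
Local Notation C := R[i].
Implicit Types (U W : set M) (eta xi : preform A).

Definition chart_image U (c : chart A) : set 'rV[R]_n := chart_map c @` (U `&` dom c).

(** Charts are homeomorphisms onto open sets. *)
Lemma chart_image_open U c : open U -> open (chart_image U c).
Proof.
move=> oU; rewrite openE => _ [p [Up cp] <-]; rewrite /interior.
have Dp : (chart_map c @` dom c) (chart_map c p) by exists p.
have nD : \forall z \near chart_map c p, (chart_map c @` dom c) z.
  by apply: open_nbhs_nbhs; split => //; exact: image_open.
have nU : \forall z \near chart_map c p, U (chart_inv c z).
  have cc : chart_inv c @ chart_map c p --> chart_inv c (chart_map c p).
    exact: chart_inv_continuous Dp.
  by apply: cc; rewrite chart_mapK //; apply: open_nbhs_nbhs.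
apply: filterS2 nD nU => z [q cq <-]; rewrite chart_mapK // => Uq.
by exists q.
Qed.

Lemma chart_image_in U c p : U p -> dom c p -> chart_image U c (chart_map c p).
Proof. by move=> Up cp; exists p. Qed.

Lemma form_esmooth U eta c : is_form U eta -> esmooth (chart_image U c) (eta c).
Proof. by move=> [H _] S; exact: H. Qed.

Lemma form_sub U W eta : W `<=` U -> is_form U eta -> is_form W eta.
Proof.
move=> WU [H1 H2]; split => [c S|c c' p /WU Up]; last exact: H2.
have [h1 h2] := H1 c S; have s : chart_image W c `<=` chart_image U c.
  by move=> _ [q [/WU Uq cq] <-]; exists q.
by split; apply: (smooth_sub s).
Qed.

Lemma form_eq U eta xi : open U ->
  (forall c p, U p -> dom c p -> eta c (chart_map c p) = xi c (chart_map c p)) ->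
  is_form U eta -> is_form U xi.
Proof.
move=> oU e Heta; split => [c S|c c' p Up cp c'p].
  have h : esmooth (chart_image U c) (xi c).
    apply: (esmooth_eq _ _ (form_esmooth c Heta)); first exact: chart_image_open.
    by move=> _ [p [Up cp] <-]; exact: e.
  exact: h.
by rewrite -!e //; exact: Heta.2.
Qed.

Lemma mk_form U eta : (forall c, esmooth (chart_image U c) (eta c)) ->
  (forall c c' p, U p -> dom c p -> dom c' p ->
     eta c (chart_map c p) =
     pullback (transition_jac c c' p) (eta c' (chart_map c' p))) -> is_form U eta.
Proof. by move=> H1 H2; split => // c S; exact: H1. Qed.

Lemma formD U eta xi : open U -> is_form U eta -> is_form U xi ->
  is_form U (fun c y => eta c y + xi c y).
Proof.
move=> oU He Hx; apply: mk_form => [c|c c' p Up cp c'p].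
  exact: (esmoothD (chart_image_open (c:=c) oU) (form_esmooth c He) (form_esmooth c Hx)).
by rewrite pullbackD -(He.2 c c') // -(Hx.2 c c').
Qed.

Lemma formZ U (k : C) eta : open U -> is_form U eta -> is_form U (fun c y => k *: eta c y).
Proof.
move=> oU He; apply: mk_form => [c|c c' p Up cp c'p].
  exact: (esmoothZ (chart_image_open (c:=c) oU) (csmooth_cst _ k) (form_esmooth c He)).
by rewrite pullbackZ -(He.2 c c').
Qed.

Lemma form1 U : is_form U (fun (c : chart A) (y : 'rV[R]_n) => ext1 : E).
Proof. by apply: mk_form => [c|c c' p _ _ _]; [exact: esmooth_cst|rewrite pullback1]. Qed.

Lemma form_sum U (K : finType) (F : K -> preform A) : open U -> (forall t, is_form U (F t)) ->
  is_form U (fun c y => \sum_t F t c y).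
Proof.
move=> oU HFt; elim: (index_enum K) => [|t r IH].
  apply: (form_eq oU (eta := fun c y => 0 *: ext1)) => [c p _ _|].
    by rewrite big_nil scale0r.
  by apply: formZ => //; exact: form1.
apply: (form_eq oU _ (formD oU (HFt t) IH)) => c p _ _; by rewrite big_cons.
Qed.

Lemma form_wedge U eta xi : open U -> is_form U eta -> is_form U xi ->
  is_form U (fun c y => wedge (eta c y) (xi c y)).
Proof.
move=> oU He Hx; apply: mk_form => [c|c c' p Up cp c'p].
  exact: (esmooth_wedge (chart_image_open (c:=c) oU) (form_esmooth c He) (form_esmooth c Hx)).
by rewrite pullback_wedge -(He.2 c c') // -(Hx.2 c c').
Qed.

Lemma form_conj U eta : open U -> is_form U eta -> is_form U (fun c y => conj_ext (eta c y)).
Proof.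
move=> oU He; apply: mk_form => [c|c c' p Up cp c'p].
  exact: (esmooth_conj (chart_image_open (c:=c) oU) (form_esmooth c He)).
by rewrite pullback_conj -(He.2 c c').
Qed.

Variable g : matrix_field A.
Hypothesis Hg : riemannian_metric g.

Lemma metric_unit c p : dom c p -> g c (chart_map c p) \in unitmx.
Proof. by case: Hg => _ _ _ pos cp; apply: posdef_unitmx => X X0; exact: pos. Qed.

Lemma csmooth_sharp U c (th : preform A) i : open U -> is_form U th ->
  csmooth (chart_image U c) (fun y => sharp (g c y) (th c y) 0 i).
Proof.
move=> oU Hth; have oV := chart_image_open (c:=c) oU.
apply: (csmooth_eq oV (w := fun y => \sum_j conjc (th c y [set j]%SET) * (invmx (g c y) j i)%:C))
  => [y _|].
  by rewrite mxE.
apply: csmooth_sum => // j _; apply: csmoothM => //; first exact: csmooth_conj oV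
  (form_esmooth c Hth _).
apply: csmooth_real; apply: smooth_invmx => // [k l|_ [p [_ cp] <-]]; last exact: metric_unit.
have [sg _ _ _] := Hg; apply: smooth_sub (sg c k l) => _ [p [_ cp] <-].
by exists p.
Qed.

Lemma form_contract U (th eta : preform A) : open U -> is_form U th ->
  (forall c p, U p -> dom c p -> is_covector (th c (chart_map c p))) -> is_form U eta ->
  is_form U (fun c y => contract (sharp (g c y) (th c y)) (eta c y)).
Proof.
move=> oU Hth cth He; apply: mk_form => [c|c c' p Up cp c'p].
  exact: (esmooth_contract (chart_image_open (c:=c) oU) (fun i => csmooth_sharp c i oU Hth)
    (form_esmooth c He)).
rewrite (He.2 c c' p Up cp c'p) pullback_contract (Hth.2 c c' p Up cp c'p); congr
  (pullback _ (contract _ _)).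
have [_ tr _ _] := Hg; apply: sharp_pullback; [exact: cth|exact: tr|exact: metric_unit].
Qed.

End FormsOnManifold.

(** * Nearly Kahler manifolds *)
Lemma d_partE {R : realType} {n : nat} {M : topologicalType} (A : smooth_manifold R n M)
  (J : matrix_field A) i j (eta : preform A) c y :
  d_part J i j eta c y =
  \sum_(p < n.+1) \sum_(q < n.+1)
      \sum_(p' < n.+1 | p'%:Z == p%:Z + i) \sum_(q' < n.+1 | q'%:Z == q%:Z + j)
        type_part (J c y) p' q' (chart_d (fun z => type_part (J c z) p q (eta c z)) y).
Proof.
apply: eq_bigr => p _; apply: eq_bigr => q _; apply: eq_bigr => p' _; apply: eq_bigr => q' _.
by rewrite type_part.unlock chart_dE.
Qed.

Section LocalFormulas.
Context {R : realType} {M : topologicalType}.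
Variables (A : smooth_manifold R 6 M) (X : nearly_kahler A).
Local Notation C := R[i].
Local Notation E := (ext R 6).
Local Notation g := (metric X).
Local Notation lam := (nk_lambda X).

Definition local_frame (W : set M) (th : 'I_3 -> preform A) : Prop :=
  (forall k, is_form W (th k)) /\
  forall c q, W q -> dom c q ->
    let y := chart_map c q in
    unitary_frame (acs X c y) (g c y) (fun k => th k c y) /\
    nk_omega X c y = omega_frame (fun k => th k c y) (fun k => conj_ext (th k c y)) /\
    nk_Omega X c y = vol3 (fun k => th k c y).

Lemma metricP : riemannian_metric g.
Proof. by case: (nk_su3 X) => _ [H _] _ _. Qed.

Lemma sum_I3 (F : 'I_3 -> E) : \sum_k F k = F 0 + F 1 + F 2.
Proof.
rewrite !big_ord_recl big_ord0 addr0 addrA.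
by congr (F _ + F _ + F _); apply: val_inj.
Qed.

Lemma local_frame_exists p : exists W th, [/\ open W, W p & local_frame W th].
Proof.
have [[_ _ JJ] [Hg HgJ] _ /(_ p)[W [t1 [t2 [t3 [oW Wp [F1 F2 F3] H]]]]]] := nk_su3 X.
exists W, (fun k : 'I_3 => if k == 0 then t1 else if k == 1 then t2 else t3); split=> //.
split=> [k|c q Wq cq y]; first by elim/I3_cases: k.
have [[T1 T2 T3] Eom EOm] := H c q Wq cq.
have [_ _ gT pos] := Hg.
have omE : nk_omega X c y = ('i / 2) *: \sum_(k : 'I_3) wedge
   ((if k == 0 then t1 else if k == 1 then t2 else t3) c y)
   (conj_ext ((if k == 0 then t1 else if k == 1 then t2 else t3) c y)).
  by rewrite sum_I3.
split; last by split=> //; rewrite EOm -wedgeA.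
apply: unitary_frame_of_metric; [exact: JJ|exact: gT|exact: HgJ| | |exact: omE].
  by move=> v v0; exact: pos.
by move=> k; elim/I3_cases: k.
Qed.

Variables (W : set M) (th : 'I_3 -> preform A).
Hypothesis oW : open W.
Hypothesis HW : local_frame W th.

Let fr c q (Wq : W q) (cq : dom c q) := (HW.2 c q Wq cq).1.

Section Chart.
Variable c : chart A.
Let V := chart_image W c.
Let oV : open V := chart_image_open oW.
Let t k (y : 'rV[R]_6) := th k c y.
Let tb k (y : 'rV[R]_6) := conj_ext (th k c y).
Let va k (y : 'rV[R]_6) := sharp (g c y) (t k y).
Let vb k (y : 'rV[R]_6) := sharp (g c y) (tb k y).

Lemma chart_adapted_frame y : V y -> adapted_frame (acs X c y) (fun k => t k y) (fun k => tb k y)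
  (fun k => va k y) (fun k => vb k y).
Proof. by move=> [q [Wq cq] <-]; exact: adapted_frame_of_unitary (fr Wq cq). Qed.

Lemma chart_esmooth_t k : esmooth V (t k).
Proof. exact: form_esmooth (HW.1 k). Qed.
Lemma chart_esmooth_tb k : esmooth V (tb k).
Proof. exact: esmooth_conj oV (chart_esmooth_t k). Qed.
Lemma chart_csmooth_va k i : csmooth V (fun y => va k y 0 i).
Proof. exact: (csmooth_sharp metricP c i oW (HW.1 k)). Qed.
Lemma chart_csmooth_vb k i : csmooth V (fun y => vb k y 0 i).
Proof. exact: (csmooth_sharp metricP c i oW (form_conj oW (HW.1 k))). Qed.

Lemma chart_esmooth_Omega : esmooth V (nk_Omega X c).
Proof.
have [_ _ HO _] := nk_su3 X.
apply: esmooth_sub (form_esmooth c HO) => _ [q [_ cq] <-]; exact: chart_image_in.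
Qed.

Lemma chart_conj_Omega y : V y -> conj_ext (nk_Omega X c y) = vol3 (fun k => tb k y).
Proof.
by move=> [q [Wq cq] <-]; rewrite (HW.2 c q Wq cq).2.2 /vol3 !conj_wedge.
Qed.

Lemma chart_omega y : V y -> nk_omega X c y = omega_frame (fun k => t k y) (fun k => tb k y).
Proof. by move=> [q [Wq cq] <-]; rewrite (HW.2 c q Wq cq).2.1. Qed.

Lemma chart_d_omega y : V y -> chart_d (nk_omega X c) y = (3 * lam)%:C *: re_ext (nk_Omega X c y).
Proof. by move=> [q [Wq cq] <-]; rewrite chart_dE; exact: (nk_d_omega X). Qed.

Lemma chart_d_im_Omega y : V y -> chart_d (fun z => im_ext (nk_Omega X c z)) y =
  (- 2 * lam)%:C *: wedge (nk_omega X c y) (nk_omega X c y).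
Proof. by move=> [q [Wq cq] <-]; rewrite chart_dE; exact: (nk_d_im_Omega X). Qed.

Lemma nk_NE eta q : is_form W eta -> W q -> dom c q ->
  nk_N X eta c (chart_map c q) =
  N_op (g c (chart_map c q)) (fun k => th k c (chart_map c q)) lam (eta c (chart_map c q)).
Proof.
move=> He Wq cq; rewrite /nk_N d_partE.
exact: (N_frame oV chart_adapted_frame chart_esmooth_t chart_esmooth_tb chart_csmooth_va
  chart_csmooth_vb
  (nk_lambda_neq0 X) chart_esmooth_Omega chart_conj_Omega chart_omega chart_d_omega chart_d_im_Omega
  (form_esmooth c He) (chart_image_in Wq cq)).
Qed.

Lemma vbE k y : vb k y = conj_vec (va k y).
Proof. exact: sharp_conj. Qed.

Lemma nk_NbarE eta q : is_form W eta -> W q -> dom c q ->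
  nk_Nbar X eta c (chart_map c q) =
  Nbar_op (g c (chart_map c q)) (fun k => th k c (chart_map c q)) lam (eta c (chart_map c q)).
Proof.
move=> He Wq cq; rewrite /nk_Nbar d_partE.
exact: (Nbar_frame oV chart_adapted_frame chart_esmooth_t chart_esmooth_tb chart_csmooth_va
  chart_csmooth_vb
  (nk_lambda_neq0 X) chart_esmooth_Omega chart_conj_Omega chart_omega chart_d_omega chart_d_im_Omega
  (fun _ _ => erefl) vbE (form_esmooth c He) (chart_image_in Wq cq)).
Qed.

Lemma nk_LE eta q : W q -> dom c q ->
  nk_L X eta c (chart_map c q) =
  L_op (fun k => th k c (chart_map c q)) (eta c (chart_map c q)).
Proof. by move=> Wq cq; rewrite /nk_L /lefschetz (HW.2 c q Wq cq).2.1. Qed.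

End Chart.

Lemma covector_form_th k c q : W q -> dom c q -> is_covector (th k c (chart_map c q)).
Proof. by move=> Wq cq; exact: covector_th (adapted_frame_of_unitary (fr Wq cq)) k. Qed.

Lemma covector_form_tb k c q : W q -> dom c q -> is_covector (conj_ext (th k c (chart_map c q))).
Proof. by move=> Wq cq; exact: conj_covector (covector_form_th k Wq cq). Qed.

Lemma form_wedge_th k eta : is_form W eta -> is_form W (fun c y => wedge (th k c y) (eta c y)).
Proof. by move=> He; apply: form_wedge => //; exact: HW.1. Qed.
Lemma form_wedge_tb k eta : is_form W eta ->
  is_form W (fun c y => wedge (conj_ext (th k c y)) (eta c y)).
Proof. by move=> He; apply: form_wedge => //; apply: form_conj => //; exact: HW.1. Qed.
Lemma form_contract_th k eta : is_form W eta ->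
  is_form W (fun c y => contract (sharp (g c y) (th k c y)) (eta c y)).
Proof.
move=> He; apply: (form_contract metricP) => //; first exact: HW.1.
by move=> c q; exact: covector_form_th.
Qed.
Lemma form_contract_tb k eta : is_form W eta ->
  is_form W (fun c y => contract (sharp (g c y) (conj_ext (th k c y))) (eta c y)).
Proof.
move=> He; apply: (form_contract metricP (th := fun c y => conj_ext (th k c y))) => //.
  by apply: form_conj => //; exact: HW.1.
by move=> c q; exact: covector_form_tb.
Qed.

(** In the coframe N is a polynomial in products and contractions with smooth forms, which
    also shows that its values are tensorial. The adjoint identities can thus be
    applied to these values. *)
Lemma form_N eta : is_form W eta -> is_form W (nk_N X eta).
Proof.
move=> He; apply: (form_eq oW (eta := fun c y => ('i * lam%:C / 2) *: \sum_k
   wedge (th (k + 1) c y) (wedge (th (k + 2) c y)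
     (contract (sharp (g c y) (conj_ext (th k c y))) (eta c y))))) => [c q Wq cq|].
  by rewrite nk_NE // N_opE.
apply: formZ => //; apply: form_sum => // k.
by do 2!apply: form_wedge_th; exact: form_contract_tb.
Qed.

Lemma form_Nbar eta : is_form W eta -> is_form W (nk_Nbar X eta).
Proof.
move=> He; apply: (form_eq oW (eta := fun c y => (- ('i * lam%:C) / 2) *: \sum_k
   wedge (conj_ext (th (k + 1) c y)) (wedge (conj_ext (th (k + 2) c y))
     (contract (sharp (g c y) (th k c y)) (eta c y))))) => [c q Wq cq|].
  by rewrite nk_NbarE // Nbar_opE.
apply: formZ => //; apply: form_sum => // k.
by do 2!apply: form_wedge_tb; exact: form_contract_th.
Qed.

Lemma form_L eta : is_form W eta -> is_form W (nk_L X eta).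
Proof.
move=> He; apply: (form_eq oW (eta := fun c y => ('i / 2) *: \sum_k
   wedge (th k c y) (wedge (conj_ext (th k c y)) (eta c y)))) => [c q Wq cq|].
  by rewrite nk_LE // /L_op wedge_omega_frame.
apply: formZ => //; apply: form_sum => // k.
by apply: form_wedge_th; exact: form_wedge_tb.
Qed.

Lemma form_Lambda eta : is_form W eta ->
  is_form W (fun c y => Lambda_op (g c y) (fun k => th k c y) (eta c y)).
Proof.
move=> He; apply: formZ => //; apply: form_sum => // k.
by apply: form_contract_tb; exact: form_contract_th.
Qed.

(** Products of coframe elements with constant coefficients take every value at a given
    point; they are test forms for the adjoint. *)
Lemma form_with_value c q (a : E) : W q -> dom c q ->
  exists2 alpha : preform A, is_form W alpha & alpha c (chart_map c q) = a.
Proof.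
move=> Wq cq; elim/(frame_ind (adapted_frame_of_unitary (fr Wq cq))): a => [a b|k a||k a|k a].
- move=> [x Hx <-] [y Hy <-]; exists (fun c y0 => x c y0 + y c y0) => //; exact: formD.
- move=> [x Hx <-]; exists (fun c y => k *: x c y) => //; exact: formZ.
- by exists (fun _ _ => ext1) => //; exact: form1.
- move=> [x Hx <-]; exists (fun c y => wedge (th k c y) (x c y)) => //; exact: form_wedge_th.
- move=> [x Hx <-]; exists (fun c y => wedge (conj_ext (th k c y)) (x c y)) => //.
  exact: form_wedge_tb.
Qed.

(** An adjoint is unique pointwise: the product at the point is nondegenerate and the
    test forms take all values there. *)
Lemma adjoint_pointwise (F G : operator A) (F0 G0 : E -> E) c q : W q -> dom c q ->
  nk_adjoint X F G ->
  (forall alpha, is_form W alpha -> F alpha c (chart_map c q) = F0 (alpha c (chart_map c q))) ->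
  adjoint_pair (g c (chart_map c q)) F0 G0 ->
  forall beta, is_form W beta -> G beta c (chart_map c q) = G0 (beta c (chart_map c q)).
Proof.
move=> Wq cq FG FF0 F0G0 beta Hb; apply: (hprod_inj (fr Wq cq)) => a.
have [alpha Ha <-] := form_with_value a Wq cq.
by rewrite -F0G0 -FF0 // -(FG W alpha beta).
Qed.

Variables (Nstar Nbarstar Lambda : operator A).
Hypothesis hN : nk_adjoint X (nk_N X) Nstar.
Hypothesis hNbar : nk_adjoint X (nk_Nbar X) Nbarstar.
Hypothesis hLambda : nk_adjoint X (nk_L X) Lambda.

Lemma Nstar_pointwise c q beta : W q -> dom c q -> is_form W beta ->
  Nstar beta c (chart_map c q) =
  Nstar_op (g c (chart_map c q)) (fun k => th k c (chart_map c q)) lam (beta c (chart_map c q)).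
Proof.
move=> Wq cq; apply: (adjoint_pointwise Wq cq hN) (adjoint_N _ (fr Wq cq)) _ => alpha Ha.
exact: nk_NE.
Qed.

Lemma Nbarstar_pointwise c q beta : W q -> dom c q -> is_form W beta ->
  Nbarstar beta c (chart_map c q) =
  Nbarstar_op (g c (chart_map c q)) (fun k => th k c (chart_map c q)) lam (beta c (chart_map c q)).
Proof.
move=> Wq cq; apply: (adjoint_pointwise Wq cq hNbar) (adjoint_Nbar _ (fr Wq cq)) _ => alpha Ha.
exact: nk_NbarE.
Qed.

Lemma Lambda_pointwise c q beta : W q -> dom c q -> is_form W beta ->
  Lambda beta c (chart_map c q) =
  Lambda_op (g c (chart_map c q)) (fun k => th k c (chart_map c q)) (beta c (chart_map c q)).
Proof.
move=> Wq cq; apply: (adjoint_pointwise Wq cq hLambda) (adjoint_L (fr Wq cq)) _ => alpha Ha.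
exact: nk_LE.
Qed.

Lemma form_Lambda_operator eta : is_form W eta -> is_form W (Lambda eta).
Proof.
move=> He; apply: (form_eq oW _ (form_Lambda He)) => c q Wq cq.
by rewrite Lambda_pointwise.
Qed.

Lemma commutators_pointwise eta c q : is_form W eta -> W q -> dom c q ->
  let y := chart_map c q in
  [/\ commutator (nk_L X) Nstar eta c y = (2 * 'i) *: nk_Nbar X eta c y,
      commutator (nk_L X) Nbarstar eta c y = (- (2 * 'i)) *: nk_N X eta c y,
      commutator Lambda (nk_N X) eta c y = (2 * 'i) *: Nbarstar eta c y
    & commutator Lambda (nk_Nbar X) eta c y = (- (2 * 'i)) *: Nstar eta c y].
Proof.
move=> He Wq cq y; rewrite /commutator; split.
- rewrite (nk_LE _ Wq cq) !Nstar_pointwise //; last exact: form_L.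
  by rewrite (nk_LE _ Wq cq) nk_NbarE // (L_Nstar _ (fr Wq cq)).
- rewrite (nk_LE _ Wq cq) !Nbarstar_pointwise //; last exact: form_L.
  by rewrite (nk_LE _ Wq cq) nk_NE // (L_Nbarstar _ (fr Wq cq)).
- rewrite (Lambda_pointwise Wq cq (form_N He)) (nk_NE (form_Lambda_operator He) Wq cq).
  rewrite (nk_NE He Wq cq) (Lambda_pointwise Wq cq He) (Lambda_N _ (fr Wq cq)).
  by rewrite Nbarstar_pointwise.
- rewrite (Lambda_pointwise Wq cq (form_Nbar He)) (nk_NbarE (form_Lambda_operator He) Wq cq).
  rewrite (nk_NbarE He Wq cq) (Lambda_pointwise Wq cq He) (Lambda_Nbar _ (fr Wq cq)).
  by rewrite Nstar_pointwise.
Qed.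

End LocalFormulas.

Theorem proposition5p1 (R : realType) (M : topologicalType)
    (A : smooth_manifold R 6 M) (X : nearly_kahler A)
    (Nstar Nbarstar Lambda : operator A)
    (hN : nk_adjoint X (nk_N X) Nstar)
    (hNbar : nk_adjoint X (nk_Nbar X) Nbarstar)
    (hLambda : nk_adjoint X (nk_L X) Lambda) :
  [/\ eq_operator (commutator (nk_L X) Nstar)
                  (scale_operator (2 * 'i) (nk_Nbar X)),
      eq_operator (commutator (nk_L X) Nbarstar)
                  (scale_operator (- (2 * 'i)) (nk_N X)),
      eq_operator (commutator Lambda (nk_N X))
                  (scale_operator (2 * 'i) Nbarstar)
    & eq_operator (commutator Lambda (nk_Nbar X))
                  (scale_operator (- (2 * 'i)) Nstar)].
Proof.
(* The identities are local, so the open set may be shrunk to the domain of a coframe. *)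
have local (U : set M) (eta : preform A) (p : M) : open U -> is_form U eta -> U p ->
  exists W th, [/\ open W, local_frame X W th, is_form W eta & W p].
  move=> oU He Up; have [W [th [oW Wp [H1 H2]]]] := local_frame_exists X p.
  have UW : U `&` W `<=` W by move=> q [].
  exists (U `&` W), th; split => //.
  - exact: openI.
  - split=> [k|c' q [_ Wq]]; [exact: form_sub UW (H1 k)|exact: H2].
  - by apply: form_sub He => q [].
split=> U eta oU He c p Up cp;
  have [W [th [oW HW HeW Wp]]] := local U eta p oU He Up;
  by have [] := commutators_pointwise oW HW hN hNbar hLambda HeW Wp cp.
Qed.
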